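(* Let $1<p<N$, $m>0$, $0\le\mu<\bar\mu=\left(\frac{N-p}{p}\right)^p$, and let $f\in C(\mathbb{R})$ satisfy $$\limsup_{t\to0}\frac{|f(t)|}{|t|^{q-1}}\le A<\infty \quad\text{and}\quad \limsup_{|t|\to\infty}\frac{|f(t)|}{|t|^{p^*-1}}\le A<\infty$$ for some $q>p$ and some constant $A>0$, where $p^*=Np/(N-p)$. Let $u\in W^{1,p}(\mathbb{R}^N)$ be a positive radial weak solution of $$-\Delta_p u-\frac{\mu}{|x|^p}|u|^{p-2}u+m|u|^{p-2}u=f(u)\quad\text{in }\mathbb{R}^N.$$ Let $\gamma_1\in[0,(N-p)/p)$ be the smaller of the two nonnegative roots of $\gamma^{p-1}[(p-1)\gamma-(N-p)]+\mu=0$. Then there is a constant $0<C<\infty$ such that $$\lim_{|x|\to0}u(x)|x|^{\gamma_1}=C.$$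
   Context: $N$ is the (integer) dimension and $\Delta_p u=\sum_{i=1}^N\partial_{x_i}(|\nabla u|^{p-2}\partial_{x_i}u)$ is the $p$-Laplacian. Weak solution: $u\in W^{1,p}(\mathbb{R}^N)$ is a weak subsolution (resp. supersolution) of the equation if for every nonnegative $\varphi\in C_0^\infty(\mathbb{R}^N)$ one has $$\int_{\mathbb{R}^N}\left(|\nabla u|^{p-2}\nabla u\cdot\nabla\varphi-\frac{\mu}{|x|^p}|u|^{p-2}u\varphi+m|u|^{p-2}u\varphi\right)\le\ (\text{resp. }\ge)\ \int_{\mathbb{R}^N}f(u)\varphi;$$ it is a weak solution if it is both a weak subsolution and a weak supersolution. Exponents: define $\Gamma_\mu(\gamma)=\gamma^{p-1}[(p-1)\gamma-(N-p)]+\mu$ for $\gamma\in[0,\infty)$. Under $1<p<N$, $0\le\mu<\bar\mu$, the equation $\Gamma_\mu(\gamma)=0$ is taken to have the two nonnegative solutions $\gamma_1,\gamma_2$ with $0\le\gamma_1<\frac{N-p}{p}<\gamma_2\le\frac{N-p}{p-1}$ (for $\mu=0$: $\gamma_1=0$ and $\gamma_2=(N-p)/(p-1)$). A radial function in $W^{1,p}(\mathbb{R}^N)$ is identified with its representative that is continuous on $\mathbb{R}^N\setminus\{0\}$. *)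

(* Defs.v *)
From HB Require Import structures.
From mathcomp Require Import all_boot all_order all_algebra.
From mathcomp Require Import all_classical all_reals all_analysis.
Import Order.TTheory GRing.Theory Num.Theory.
Import numFieldNormedType.Exports.

Set Implicit Arguments.
Unset Strict Implicit.
Unset Printing Implicit Defensive.

Local Open Scope classical_set_scope.
Local Open Scope ring_scope.

Section measurable_rV.
Context (R : realType) (n : nat).

Let coord (i : 'I_n) (v : 'rV[R]_n) : R := v ord0 i.

Let rV_set0 : g_sigma_preimage coord set0.
Proof. exact: sigma_algebra0. Qed.

Let rV_setC A : g_sigma_preimage coord A -> g_sigma_preimage coord (~` A).
Proof. exact: sigma_algebraC. Qed.

Let rV_bigcup (F : (set 'rV[R]_n)^nat) :
  (forall i, g_sigma_preimage coord (F i)) ->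
  g_sigma_preimage coord (\bigcup_i F i).
Proof. exact: sigma_algebra_bigcup. Qed.

HB.instance Definition _ := @isMeasurable.Build
  (measure_tuple_display default_measure_display)
  'rV[R]_n (g_sigma_preimage coord) rV_set0 rV_setC rV_bigcup.

Lemma measurable_coord i : measurable_fun [set: 'rV[R]_n] (coord i).
Proof.
move=> _ Y mY; rewrite setTI; apply: sub_sigma_algebra => /=.
rewrite -bigcup_seq/=; exists i => /=; first by rewrite mem_index_enum.
by exists Y => //; rewrite setTI.
Qed.

Lemma measurable_fun_rV d (T : measurableType d) (f : T -> 'rV[R]_n) :
  (forall i, measurable_fun [set: T] (fun x => f x ord0 i)) ->
  measurable_fun [set: T] f.
Proof.
move=> mf.
apply: (@measurability _ _ _ _ _ _
  (\big[setU/set0]_(i < n) preimage_set_system setT (coord i) measurable)) => //.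
move=> _ [B + <-].
rewrite -bigcup_seq => -[i _ [A mA <-]].
by rewrite !setTI -[X in measurable X]setTI; exact: mf.
Qed.

End measurable_rV.

Section lebesgue_rV.
Context (R : realType).
Local Open Scope ereal_scope.

Definition rV_cons n (z : measurableTypeR R * 'rV[R]_n) : 'rV[R]_n.+1 :=
  row_mx (\row_(i < 1) z.1) z.2.

Definition rV_uncons n (v : 'rV[R]_n.+1) : measurableTypeR R * 'rV[R]_n :=
  (v ord0 ord0, \row_j v ord0 (lift ord0 j)).

Lemma rV_cons0 n (z : measurableTypeR R * 'rV[R]_n) : rV_cons z ord0 ord0 = z.1.
Proof.
have -> : (ord0 : 'I_n.+1) = lshift n (ord0 : 'I_1) by exact: val_inj.
by rewrite /rV_cons (@row_mxEl _ 1 1 n) mxE.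
Qed.

Lemma rV_consS n (z : measurableTypeR R * 'rV[R]_n) j :
  rV_cons z ord0 (lift ord0 j) = z.2 ord0 j.
Proof.
have -> : lift ord0 j = rshift 1 j by exact: val_inj.
by rewrite /rV_cons (@row_mxEr _ 1 1 n).
Qed.

Lemma rV_consK n : cancel (@rV_cons n) (@rV_uncons n).
Proof.
move=> z; rewrite /rV_uncons rV_cons0 [RHS]surjective_pairing; congr pair.
by apply/rowP => j; rewrite mxE rV_consS.
Qed.

Lemma measurable_rV_cons n :
  measurable_fun [set: measurableTypeR R * 'rV[R]_n] (@rV_cons n).
Proof.
apply: measurable_fun_rV => i; case: (unliftP ord0 i) => [j|] ->.
  under eq_fun do rewrite rV_consS.
  by apply: (measurableT_comp (measurable_coord j)); exact: measurable_snd.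
under eq_fun do rewrite rV_cons0.
exact: measurable_fst.
Qed.

Lemma measurable_rV_uncons n :
  measurable_fun [set: 'rV[R]_n.+1] (@rV_uncons n).
Proof.
apply: measurable_fun_pair; first exact: measurable_coord.
apply: measurable_fun_rV => i; under eq_fun do rewrite mxE.
exact: measurable_coord.
Qed.

Section step.
Context n (mu : {sigma_finite_measure set 'rV[R]_n -> \bar R}).

Definition lebesgue_rV_step : set 'rV[R]_n.+1 -> \bar R :=
  pushforward (@lebesgue_measure R \x mu) (@rV_cons n).

Let measurable_preimage A : measurable A -> measurable (@rV_cons n @^-1` A).
Proof.
by move=> mA; rewrite -[X in measurable X]setTI; exact: measurable_rV_cons.
Qed.

Let step0 : lebesgue_rV_step set0 = 0.
Proof. by rewrite /lebesgue_rV_step /pushforward preimage_set0 measure0. Qed.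

Let step_ge0 A : 0 <= lebesgue_rV_step A.
Proof. by rewrite /lebesgue_rV_step /pushforward measure_ge0. Qed.

Let step_sigma_additive : semi_sigma_additive lebesgue_rV_step.
Proof.
move=> F mF tF mUF; rewrite /lebesgue_rV_step /pushforward preimage_bigcup.
apply: measure_semi_sigma_additive.
- by move=> k; exact: measurable_preimage.
- apply/trivIsetP => i j _ _ ij; rewrite -preimage_setI.
  by move/trivIsetP : tF => /(_ _ _ _ _ ij) ->//; rewrite preimage_set0.
- by rewrite -preimage_bigcup; exact: measurable_preimage.
Qed.

HB.instance Definition _ := isMeasure.Build _ _ _ lebesgue_rV_step
  step0 step_ge0 step_sigma_additive.

Let step_sigma_finite : sigma_finite setT lebesgue_rV_step.
Proof.
have /sigma_finiteP[F [FT ndF Foo]] := sigma_finiteT (@lebesgue_measure R).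
have /sigma_finiteP[G [GT ndG Goo]] := sigma_finiteT mu.
exists (fun k => @rV_uncons n @^-1` (F k `*` G k)).
  rewrite -preimage_bigcup (_ : \bigcup_k _ = setT) ?preimage_setT//.
  rewrite -setXTT FT GT predeqE => -[x y]; split.
    by move=> [k _ []/= ? ?]; split; exists k.
  move=> [/= [i _ Fx] [j _ Gy]]; exists (maxn i j) => //; split.
  - by move: x Fx; exact/subsetPset/ndF/leq_maxl.
  - by move: y Gy; exact/subsetPset/ndG/leq_maxr.
move=> k; have [mF ?] := Foo k; have [mG ?] := Goo k; split.
  rewrite -[X in measurable X]setTI; apply: measurable_rV_uncons => //.
  exact: measurableX.
rewrite /lebesgue_rV_step /pushforward -comp_preimage.
rewrite (_ : _ \o _ = id); last by apply/funext => z /=; rewrite rV_consK.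
by rewrite preimage_id product_measure1E// lte_mul_pinfty// ge0_fin_numE.
Qed.

HB.instance Definition _ := Measure_isSigmaFinite.Build _ _ _ lebesgue_rV_step
  step_sigma_finite.

End step.

Fixpoint lebesgue_rV n : {sigma_finite_measure set 'rV[R]_n -> \bar R} :=
  if n is n'.+1 then lebesgue_rV_step (lebesgue_rV n')
  else dirac (0 : 'rV[R]_0)%R.

Lemma measurable_box n (a b : 'I_n -> R) :
  measurable [set v : 'rV[R]_n | forall i, (a i <= v ord0 i <= b i)%R].
Proof.
rewrite (_ : [set _ | _] = \bigcap_(i in [set: 'I_n])
    ((fun v : 'rV[R]_n => v ord0 i) @^-1` `[a i, b i])); last first.
  apply/seteqP; split=> [v /= vB i _|v /= vB i].
    by have := vB i; rewrite /= in_itv/=; exact.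
  by have := vB i I; rewrite /= in_itv/=; exact.
apply: fin_bigcap_measurable => // i _.
rewrite -[X in measurable X]setTI.
by apply: (@measurable_coord R n i) => //; exact: measurable_itv.
Qed.

Lemma lebesgue_rV_box n (a b : 'I_n -> R) : (forall i, (a i <= b i)%R) ->
  lebesgue_rV n [set v : 'rV[R]_n | forall i, (a i <= v ord0 i <= b i)%R] =
  (\prod_i (b i - a i))%:E.
Proof.
elim: n a b => [|n IH] a b ab /=.
  by rewrite big_ord0 diracE mem_set// => -[].
rewrite /lebesgue_rV_step /pushforward.
pose B := [set v : 'rV[R]_n |
  forall i, (a (lift ord0 i) <= v ord0 i <= b (lift ord0 i))%R].
rewrite (_ : _ @^-1` _ = `[a ord0, b ord0]%classic `*` B); last first.
  apply/seteqP; split=> -[x v] /=.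
    move=> vB; split=> [|i].
      by have := vB ord0; rewrite rV_cons0 in_itv.
    by have := vB (lift ord0 i); rewrite rV_consS.
  rewrite in_itv/= => -[xab vB] i; case: (unliftP ord0 i) => [j|] ->.
    by rewrite rV_consS; exact: vB.
  by rewrite rV_cons0.
rewrite product_measure1E; [|exact: measurable_itv|exact: measurable_box].
rewrite [X in _ * X]IH// big_ord_recl EFinM; congr (_ * _).
rewrite [LHS]lebesgue_measure_itv/= lte_fin; case: ltP => [_|ba].
  by rewrite -EFinB.
by have /eqP -> : a ord0 == b ord0; rewrite ?eq_le ?ab// subrr.
Qed.

End lebesgue_rV.

Section calculus.
Context (R : realType) (N : nat).
Implicit Types (phi : 'rV[R]_N -> R) (x y : 'rV[R]_N).

(* The library norm `|x| on 'rV[R]_N is the sup norm. *)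
Definition enorm x : R := Num.sqrt (\sum_i x ord0 i ^+ 2).

Definition dotp x y : R := \sum_i x ord0 i * y ord0 i.

Definition partial (i : 'I_N) phi : 'rV[R]_N -> R := 'D_(delta_mx ord0 i) phi.

Definition gradient phi x : 'rV[R]_N := \row_i partial i phi x.

Fixpoint Ck (k : nat) phi : Prop :=
  continuous phi /\
  if k is k'.+1 then
    forall i, (forall x, derivable phi x (delta_mx ord0 i)) /\
              Ck k' (partial i phi)
  else True.

Definition smooth phi := forall k, Ck k phi.

Definition test_function phi :=
  smooth phi /\ compact (closure [set x | phi x != 0]).

Definition radial (u : 'rV[R]_N -> R) :=
  forall x y, enorm x = enorm y -> u x = u y.

End calculus.

Section sobolev.
Context (R : realType) (N : nat) (p : R).
Local Notation leb := (lebesgue_rV R N).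
Implicit Types (u : 'rV[R]_N -> R) (G : 'rV[R]_N -> 'rV[R]_N).

Definition is_weak_gradient u G :=
  (forall i, (fun x => G x ord0 i) \in Lfun leb p%:E) /\
  (forall phi i, test_function phi ->
    (\int[leb]_x (u x * partial i phi x)%:E =
     - \int[leb]_x (G x ord0 i * phi x)%:E)%E).

Definition sobolev u := u \in Lfun leb p%:E /\ exists G, is_weak_gradient u G.

(* Weak gradients are unique up to a null set; this selects one of them when
   [sobolev u] holds. *)
Definition weak_gradient u : 'rV[R]_N -> 'rV[R]_N :=
  xget (fun=> 0) [set G | is_weak_gradient u G].

End sobolev.

Section equation.
Context (R : realType) (N : nat) (p mu m : R) (f : R -> R).
Local Notation leb := (lebesgue_rV R N).
Implicit Types (u phi : 'rV[R]_N -> R).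

(* At the origin, and where u or its weak gradient vanishes, the negative
   powers below take the junk values 0 `^ a = 0 (a != 0) and 0^-1 = 0. This is
   harmless: the origin is a null set, and |s|^(p-2) s is indeed 0 at s = 0. *)
Definition weak_form u phi x : R :=
  enorm (weak_gradient p u x) `^ (p - 2) *
    dotp (weak_gradient p u x) (gradient phi x)
  - mu / enorm x `^ p * (`|u x| `^ (p - 2) * u x) * phi x
  + m * (`|u x| `^ (p - 2) * u x) * phi x.

Definition weak_subsolution u :=
  sobolev p u /\
  forall phi, test_function phi -> (forall x, 0 <= phi x) ->
    (\int[leb]_x (weak_form u phi x)%:E <=
     \int[leb]_x (f (u x) * phi x)%:E)%E.

Definition weak_supersolution u :=
  sobolev p u /\
  forall phi, test_function phi -> (forall x, 0 <= phi x) ->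
    (\int[leb]_x (weak_form u phi x)%:E >=
     \int[leb]_x (f (u x) * phi x)%:E)%E.

Definition weak_solution u := weak_subsolution u /\ weak_supersolution u.

End equation.

Section exponents.
Context (R : realType) (N : nat) (p mu : R).

Definition mu_bar : R := ((N%:R - p) / p) `^ p.

Definition p_star : R := N%:R * p / (N%:R - p).

Definition Gamma (g : R) : R :=
  g `^ (p - 1) * ((p - 1) * g - (N%:R - p)) + mu.

Definition is_gamma1 (g1 : R) :=
  [/\ 0 <= g1 < (N%:R - p) / p,
      Gamma g1 = 0 &
      forall g, 0 <= g -> Gamma g = 0 -> g1 <= g].

End exponents.

(* The filter of |t| -> oo, i.e. t -> +oo or t -> -oo. *)
Definition norm_oo_nbhs (R : realType) : set_system R :=
  filter_from setT (fun M : R => [set t | M < `|t|]).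

(* Main.v *)
Require Import Defs.

From mathcomp Require Import all_boot all_order all_algebra.
From mathcomp Require Import all_classical all_reals all_analysis.
From mathcomp Require Import measurable_realfun ring lra.
Import Order.TTheory GRing.Theory Num.Theory.
Import numFieldNormedType.Exports.
Set Implicit Arguments.
Unset Strict Implicit.
Unset Printing Implicit Defensive.
Local Open Scope classical_set_scope.
Local Open Scope ring_scope.

(** The idea is to reduce the statement to an ordinary differential equation
  for the logarithmic derivative of [u], and to compare that equation with an
  autonomous one of which [gamma1] is an equilibrium.

  _Radial profile._ Write [u x = U (rho x)], where [rho x = vol c x] is the
  volume of the ball of radius [|x|]. The image of Lebesgue measure under
  [rho] is Lebesgue measure on the half line ([image_vol]), so that integrals
  of radial functions become integrals in [s = rho x] without a weight. The
  weak gradient of [u] is [h (rho x) * grad rho x] for some locally integrable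
  [h] with [U b - U a = \int_a^b h] ([profile_density], [gradient_shell]).
  Testing the equation with functions of [rho] yields [\int flux * z' = \int
  source * z] for every test function [z >= 0] on the half line, where [flux =
  |h sigma|^(p-2) (h sigma) sigma] and [sigma] is the area of the sphere
  ([radial_equation]). By du Bois-Reymond's lemma the flux is an
  antiderivative of [- source]; the latter is continuous, and inverting the
  signed power gives that [h] is continuous: [U] is of class C^1 and the
  equation holds in the classical sense away from the origin
  ([shell_regularity]).

  _Decay._ Since [\int |grad u|^p] is finite, [u x = o (|x|^(-k))] at the
  origin, where [k = (N - p) / p] ([finite_energy_decay]). Hence the critical
  growth of [f] gives [|x|^p f(u) / u^(p-1) = O (|x|^p + (u |x|^k)^(p/k))],
  which tends to [0].

  _Riccati equation._ With [t = ln |x|], [L = ln u] and [v = - dL/dt], the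
  radial equation becomes [(|v|^(p-2) v)' = Gam v + e], where [Gam v = (p-1)
  |v|^p - (N-p) |v|^(p-2) v + mu] ([riccati_rhs]) and [e] tends to [0] at
  [-oo]. For [v >= 0] the zeros of [Gam] are the roots of the equation for
  [gamma]. As a function of [z = |v|^(p-2) v], [Gam] is convex, with minimum
  at [v = k], where its value is negative because [mu < mu_bar]. So [k] is a
  barrier: if [v] came close to [k] near [-oo] it would exceed [k] at all
  earlier times, contradicting [L + k t --> -oo]; and [v] cannot be very
  negative, since it would blow up in finite backward time. Thus [v <= k -
  eta] near [-oo], a region where [Gam] is strictly decreasing in [z] and
  vanishes only at [gamma1]. It follows that [L + k t <= C + eta t] and that
  [e] is exponentially small, then that [v - gamma1] is exponentially small,
  and finally that [L + gamma1 t = ln (u |x|^gamma1)] converges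
  ([riccati_limit], [radial_limit]). *)

(** * Signed powers and mean value inequalities *)

Section signed_power.
Context {R : realType}.
Implicit Types a p x y : R.

Lemma powR_lt2r a x y : 0 < a -> 0 <= x -> x < y -> x `^ a < y `^ a.
Proof.
by move=> a0 x0 xy; apply: (gt0_ltr_powR a0) => //; rewrite nnegrE (le_trans x0)// ltW.
Qed.

Lemma powR_le2r a x y : 0 <= a -> 0 <= x -> x <= y -> x `^ a <= y `^ a.
Proof.
by move=> a0 x0 xy; apply: (ge0_ler_powR a0) => //; rewrite nnegrE (le_trans x0).
Qed.

(** With [a = p - 1], the nonlinearity [|x|^(p-2) x] of the p-Laplacian. *)
Definition spow a x : R := Num.sg x * `|x| `^ a.

Lemma spow0 a : spow a 0 = 0.
Proof. by rewrite /spow sgr0 mul0r. Qed.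

Lemma spow_ge0E a x : a != 0 -> 0 <= x -> spow a x = x `^ a.
Proof.
move=> a0; rewrite le_eqVlt => /predU1P[<-|x0].
  by rewrite spow0 powR0.
by rewrite /spow gtr0_sg// mul1r gtr0_norm.
Qed.

Lemma spowN a x : spow a (- x) = - spow a x.
Proof. by rewrite /spow sgrN normrN mulNr. Qed.

Lemma normr_spow a x : a != 0 -> `|spow a x| = `|x| `^ a.
Proof.
move=> a0; rewrite /spow normrM normr_sg (ger0_norm (powR_ge0 _ _)).
by have [->|x0] := eqVneq x 0; rewrite ?normr0 ?powR0 ?mulr0 ?mul1r.
Qed.

Lemma spow_gt0 a x : 0 < x -> 0 < spow a x.
Proof. by move=> x0; rewrite /spow gtr0_sg// mul1r powR_gt0// normr_gt0 gt_eqF. Qed.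

Lemma mul_spow p x : 1 < p -> x * spow (p - 1) x = `|x| `^ p.
Proof.
move=> p1; rewrite /spow mulrA [x * _]mulrC -normrEsg mulr_powRB1//; lra.
Qed.

Lemma spow_mono a : 0 < a -> {homo spow a : x y / x < y}.
Proof.
move=> a0 x y xy; have a00 : a != 0 by rewrite gt_eqF.
have [y0|y0] := leP 0 y; last first.
  have -> : x = - - x by rewrite opprK.
  have -> : y = - - y by rewrite opprK.
  rewrite (spowN a (- x)) (spowN a (- y)) ltrN2 !spow_ge0E//; try lra.
  by apply: powR_lt2r; lra.
have [x0|x0] := leP 0 x.
  by rewrite !spow_ge0E//; apply: powR_lt2r; lra.
apply: (@lt_le_trans _ _ 0); last by rewrite spow_ge0E// powR_ge0.
have -> : x = - - x by rewrite opprK.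
by rewrite (spowN a (- x)) oppr_lt0 spow_gt0//; lra.
Qed.

Lemma spow_lt a x y : 0 < a -> (spow a x < spow a y) = (x < y).
Proof. by move=> a0; exact: (leW_mono (le_mono (spow_mono a0))). Qed.

Lemma spow_le a x y : 0 < a -> (spow a x <= spow a y) = (x <= y).
Proof. by move=> a0; exact: (le_mono (spow_mono a0)). Qed.

(** Young's inequality, read as: the tangent line of the convex function [(p -
  1) * |z| ^ (p / (p - 1))] at [z = spow (p - 1) x] stays below its graph. *)
Lemma young_spow p x y : 1 < p ->
  p * x * spow (p - 1) y <= `|x| `^ p + (p - 1) * `|y| `^ p.
Proof.
move=> p1; have p10 : p - 1 != 0 by apply/eqP; lra.
have := @conjugate_powR R `|x| (`|y| `^ (p - 1)) p (p / (p - 1)).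
rewrite -powRrM [_ * (p / (p - 1))]mulrC divfK// => H.
have {}H : `|x| * `|y| `^ (p - 1) <= `|x| `^ p / p + `|y| `^ p / (p / (p - 1)).
  apply: H; rewrite ?powR_ge0//; [lra | apply: divr_gt0; lra |].
  by field; apply/andP; split => //; apply/eqP; lra.
apply: (@le_trans _ _ (p * (`|x| * `|y| `^ (p - 1)))).
  rewrite -mulrA ler_pM2l//; last lra.
  by rewrite -(@normr_spow _ y)// -normrM ler_norm.
rewrite -ler_pdivlMl; last lra.
apply: (le_trans H); rewrite le_eqVlt; apply/orP; left; apply/eqP.
by field; apply/andP; split => //; apply/eqP; lra.
Qed.

End signed_power.

Section mean_value.
Context {R : realType}.
Implicit Types (f df : R -> R) (a b K : R).

Lemma derive_le f df a b K : a <= b ->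
  (forall x, a <= x <= b -> is_derive x 1 f (df x)) ->
  (forall x, a <= x <= b -> df x <= K) -> f b - f a <= K * (b - a).
Proof.
move=> ab fdf dfK.
have fdf' x : x \in `[a, b] -> is_derive x 1 f (df x).
  by rewrite in_itv/= => xab; exact: fdf.
have fo x : x \in `]a, b[ -> is_derive x 1 f (df x).
  by move=> xab; apply: fdf'; exact: subset_itv_oo_cc.
have fc : {within `[a, b], continuous f}.
  by apply: derivable_within_continuous => x /fdf' [].
have [c cab ->] := MVT_segment ab fo fc.
by apply: ler_wpM2r; [lra|apply: dfK; move: cab; rewrite in_itv].
Qed.

Lemma derive_ge f df a b K : a <= b ->
  (forall x, a <= x <= b -> is_derive x 1 f (df x)) ->
  (forall x, a <= x <= b -> K <= df x) -> K * (b - a) <= f b - f a.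
Proof.
move=> ab fdf dfK.
have := @derive_le (- f) (- df) a b (- K) ab
  (fun x xab => is_deriveN (fdf x xab))
  (fun x xab => (ltac:(rewrite lerN2; exact: dfK))).
rewrite !fctE; lra.
Qed.

Lemma derive_continuous f (x d : R) : is_derive x 1 f d -> {for x, continuous f}.
Proof. by move=> [+ _] => /derivable1_diffP /differentiable_continuous. Qed.

(** At the last time before [b] where [f] takes the value [c], the derivative
  of [f] would have to be nonnegative. *)
Lemma barrier f df c b : (forall x, x <= b -> is_derive x 1 f (df x)) ->
  (forall x, x <= b -> f x = c -> df x < 0) ->
  c < f b -> forall a, a <= b -> c < f a.
Proof.
move=> fdf cross cfb a ab; apply: contrapT => /negP; rewrite -leNgt => fac.
pose E := [set x | x <= b /\ f x <= c].
have Ea : E a by [].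
have supE : has_sup E by split; [exists a | exists b => x []].
pose s := sup E.
have sb : s <= b by apply: ge_sup; [exists a | move=> x []].
have as_ : a <= s by apply: ub_le_sup => //; exact: supE.2.
have cont x : x <= b -> {for x, continuous f}.
  by move=> /fdf; exact: derive_continuous.
have above x : s < x -> x <= b -> c < f x.
  move=> sx xb; rewrite ltNge; apply/negP => fxc.
  by move: sx; rewrite ltNge => /negP; apply; apply: ub_le_sup => //; exact: supE.2.
have fs : f s <= c.
  rewrite leNgt; apply/negP => cfs.
  have /cvgrPdist_lt /(_ (f s - c)) := cont s sb.
  rewrite subr_gt0 => /(_ cfs) [e /= e0 he].
  have [x [xb fx] sx] := sup_adherent e0 supE.
  have xs : x <= s by apply: ub_le_sup => //; exact: supE.2.
  have /he : ball s e x by rewrite /ball/= ger0_norm; rewrite -/s in sx *; lra.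
  by move=> /= /ltr_normlP []; lra.
have sltb : s < b by rewrite lt_neqAle sb andbT; apply/eqP => sb'; move: cfb; rewrite -sb'; lra.
have fsc : f s = c.
  apply/eqP; rewrite eq_le fs/= leNgt; apply/negP => fsc.
  have /cvgrPdist_lt /(_ (c - f s)) := cont s sb.
  rewrite subr_gt0 => /(_ fsc) [e /= e0 he].
  pose x := s + Num.min (e / 2) (b - s).
  have m0 : 0 < Num.min (e / 2) (b - s) by rewrite lt_min; apply/andP; split; lra.
  have m1 : Num.min (e / 2) (b - s) <= e / 2 by rewrite ge_min lexx.
  have m2 : Num.min (e / 2) (b - s) <= b - s by rewrite ge_min lexx orbT.
  have /he : ball s e x by rewrite /ball/= distrC ger0_norm /x; lra.
  have : c < f x by apply: above; rewrite /x; lra.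
  by move=> + /= /ltr_normlP []; lra.
have dfs := cross _ sb fsc.
have [df1 df2] := fdf _ sb.
have : (fun h => h^-1 *: (f (h *: (1 : R) + s) - f s)) @ 0^' --> df s.
  by rewrite -df2; exact: df1.
move=> /cvgrPdist_lt /(_ (- df s)); rewrite oppr_gt0 => /(_ dfs) [e /= e0 he].
pose h := Num.min (e / 2) (b - s).
have h0 : 0 < h by rewrite lt_min; apply/andP; split; lra.
have h1 : h <= e / 2 by rewrite ge_min lexx.
have h2 : h <= b - s by rewrite ge_min lexx orbT.
have /he : ball 0 e h by rewrite /ball/= sub0r normrN gtr0_norm; lra.
rewrite gt_eqF// => /(_ isT).
have -> : h *: (1 : R) + s = s + h by rewrite /GRing.scale/= mulr1 addrC.
have : c < f (s + h) by apply: above; lra.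
rewrite fsc => H /= /ltr_normlP[]; rewrite /GRing.scale/=.
have : 0 < h^-1 * (f (s + h) - c) by apply: mulr_gt0; rewrite ?invr_gt0//; lra.
by lra.
Qed.

End mean_value.

(** * The perturbed Riccati equation near minus infinity *)

Section pointwise_derivatives.
Context {R : realType}.
Implicit Types (f g : R -> R) (x a b : R).

Lemma isd_eq f x a b : is_derive x 1 f a -> a = b -> is_derive x 1 f b.
Proof. by move=> fa <-. Qed.

Lemma isdD f g x a b : is_derive x 1 f a -> is_derive x 1 g b ->
  is_derive x 1 (fun t => f t + g t) (a + b).
Proof. exact: is_deriveD. Qed.

Lemma isdB f g x a b : is_derive x 1 f a -> is_derive x 1 g b ->
  is_derive x 1 (fun t => f t - g t) (a - b).
Proof. exact: is_deriveB. Qed.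

Lemma isdN f x a : is_derive x 1 f a -> is_derive x 1 (fun t => - f t) (- a).
Proof. exact: is_deriveN. Qed.

Lemma isdM f g x a b : is_derive x 1 f a -> is_derive x 1 g b ->
  is_derive x 1 (fun t => f t * g t) (f x * b + g x * a).
Proof. exact: is_deriveM. Qed.

Lemma isdZ c f x a : is_derive x 1 f a -> is_derive x 1 (fun t => c * f t) (c * a).
Proof. exact: is_deriveZ. Qed.

Lemma isd_id x : is_derive x 1 (fun t : R => t) 1.
Proof. exact: is_derive_id. Qed.

Lemma isd_cst (c x : R) : is_derive x 1 (fun _ : R => c) (0 : R).
Proof. exact: is_derive_cst. Qed.

Lemma isd_comp f g x a b : is_derive (g x) 1 f a -> is_derive x 1 g b ->
  is_derive x 1 (fun t => f (g t)) (a * b).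
Proof. exact: is_derive1_comp. Qed.

Lemma isd_exp c x : is_derive x 1 (fun t => expR (c * t)) (c * expR (c * x)).
Proof.
have := isd_comp (is_derive_expR (c * x)) (isdZ c (isd_id x)).
by move=> h; apply: (isd_eq h); rewrite mulr1 mulrC.
Qed.

Lemma exp_small (c e K : R) : 0 < c -> 0 < e ->
  exists t0, forall t, t <= t0 -> K * expR (c * t) <= e.
Proof.
move=> c0 e0; have K1 : 0 < `|K| + 1 by have := normr_ge0 K; lra.
exists (ln (e / (`|K| + 1)) / c) => t tt0.
apply: (@le_trans _ _ ((`|K| + 1) * expR (c * t))).
  by rewrite ler_wpM2r ?expR_ge0//; have := ler_norm K; lra.
rewrite -ler_pdivlMl// -[X in _ <= X]lnK; last first.
  by rewrite posrE mulr_gt0// invr_gt0.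
by move: tt0; rewrite ler_expR [_^-1 * e]mulrC ler_pdivlMr// [c * t]mulrC.
Qed.

End pointwise_derivatives.

Section riccati.
Context {R : realType} (p k mu g1 : R).
Hypotheses (p1 : 1 < p) (k0 : 0 < k) (mu0 : 0 <= mu) (muk : mu < k `^ p).

Let phi := @spow R (p - 1).
Definition riccati_rhs (x : R) : R :=
  (p - 1) * `|x| `^ p - p * k * phi x + mu.
Local Notation Gam := riccati_rhs.

Let p10 : 0 < p - 1. Proof. by rewrite subr_gt0. Qed.
Let phi0 : phi 0 = 0. Proof. exact: spow0. Qed.
Let phi_le x y : (phi x <= phi y) = (x <= y). Proof. exact: spow_le. Qed.
Let phi_lt x y : (phi x < phi y) = (x < y). Proof. exact: spow_lt. Qed.
Let mul_phi x : x * phi x = `|x| `^ p. Proof. exact: mul_spow. Qed.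

(** [riccati_rhs] is a convex function of [z = phi x]; this is its tangent line
  inequality, the slope at [x] being [p * (x - k)]. *)
Lemma riccati_tangent x y : Gam x <= Gam y + p * (x - k) * (phi x - phi y).
Proof.
have [[P1 P10] [K0 MU0]] := ((p1, p10), (k0, mu0)).
have Y : p * x * phi y <= `|x| `^ p + (p - 1) * `|y| `^ p := young_spow x y p1.
have := mul_phi x; rewrite /riccati_rhs => H; nra.
Qed.

Lemma riccati_rhs_k : Gam k = mu - k `^ p.
Proof.
by rewrite /riccati_rhs -mulrA mul_phi gtr0_norm//; ring.
Qed.

Context (g1_lt : 0 <= g1 < k) (g1_root : Gam g1 = 0).

Context (T : R) (L v e : R -> R).
Let z t := phi (v t).
Let M t := L t + k * t.
Hypothesis dL : forall t, t <= T -> is_derive t 1 L (- v t).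
Hypothesis dz : forall t, t <= T -> is_derive t 1 z (Gam (v t) + e t).
Hypothesis e_small : forall d : R, 0 < d -> exists t0, forall t, t <= t0 -> `|e t| <= d.
Hypothesis M_Noo : forall B : R, exists t0, forall t, t <= t0 -> M t < B.

Let dM t : t <= T -> is_derive t 1 M (k - v t).
Proof.
move=> tT; have := isdD (dL tT) (isdZ k (isd_id t)).
by move=> h; apply: (isd_eq h); ring.
Qed.

(** [Gam k] is negative, so [z] decreases in time whenever [v] is close to
  [k]. In backward time, a trajectory that enters a band around [k] therefore
  leaves it upwards and stays above it; from then on [M], whose derivative is
  [k - v], increases in backward time and cannot tend to [-oo]. *)
Lemma riccati_upper : exists eta t0, [/\ 0 < eta, g1 <= k - eta, t0 <= T &
  forall t, t <= t0 -> v t <= k - eta].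
Proof.
have [[P1 P10] [K0 [MU0 G1]]] := ((p1, p10), (k0, (mu0, g1_lt))).
have Gk : Gam k < 0 by rewrite riccati_rhs_k subr_lt0.
have ph2k : 0 < phi (2 * k) by rewrite -phi0 phi_lt; lra.
pose eta := Num.min ((k - g1) / 2) (- Gam k / (2 * p * phi (2 * k))).
have D0 : 0 < 2 * p * phi (2 * k) by apply: mulr_gt0 => //; lra.
have eta0 : 0 < eta.
  by rewrite lt_min; apply/andP; split; [lra|apply: divr_gt0 => //; lra].
have eta1 : eta <= (k - g1) / 2 by rewrite ge_min lexx.
have eta2 : 2 * p * phi (2 * k) * eta <= - Gam k.
  by rewrite mulrC -ler_pdivlMr// ge_min lexx orbT.
have near_k x : k - eta <= x <= k + eta -> Gam x <= Gam k / 2.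
  move=> xk; apply: (le_trans (riccati_tangent x k)).
  have Q1 : 0 <= phi x <= phi (2 * k) by rewrite -{1}phi0 (phi_le 0) phi_le; lra.
  have Q2 : 0 <= phi k <= phi (2 * k) by rewrite -{1}phi0 (phi_le 0) phi_le; lra.
  have : (x - k) * (phi x - phi k) <= eta * phi (2 * k).
    have [xk'|xk'] := leP k x.
      have := phi_le k x; rewrite xk' => Q3; nra.
    have : phi x <= phi k by rewrite phi_le; lra.
    nra.
  move=> H.
  have : p * ((x - k) * (phi x - phi k)) <= p * (eta * phi (2 * k)).
    by rewrite ler_wpM2l//; lra.
  lra.
have [t1 et1] := e_small (ltac:(lra) : 0 < - Gam k / 4).
pose t2 := Num.min t1 T.
have et2 t : t <= t2 -> t <= T /\ `|e t| <= - Gam k / 4.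
  by rewrite /t2 le_min => /andP[? ?]; split => //; exact: et1.
exists eta, t2; split => //; [lra|by rewrite ge_min lexx orbT|].
move=> t3 t32; rewrite leNgt; apply/negP => vt3.
have ddz t : t <= t3 -> is_derive t 1 z (Gam (v t) + e t).
  by move=> tt3; apply: dz; have [] := et2 t (le_trans tt3 t32).
have slope t : t <= t3 -> k - eta <= v t <= k + eta -> Gam (v t) + e t <= Gam k / 4.
  move=> tt3 /near_k; have [_] := et2 t (le_trans tt3 t32).
  by rewrite ler_norml; lra.
have phi_inj x y : phi x = phi y -> x = y.
  by move=> xy; apply/le_anti; rewrite -(phi_le x) -(phi_le y) xy lexx.
have above1 t : t <= t3 -> k - eta < v t.
  move=> tt3; rewrite -phi_lt.
  apply: (barrier (f := z) ddz) tt3; last by rewrite phi_lt.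
  by move=> s st3 /phi_inj vs; apply: (le_lt_trans (slope s st3 _)); rewrite ?vs; lra.
have [t4 [t43 vt4]] : exists t4, t4 <= t3 /\ k + eta < v t4.
  apply: contrapT => H.
  have below t : t <= t3 -> v t <= k + eta.
    by move=> tt3; rewrite leNgt; apply/negP => ?; apply: H; exists t.
  pose D := phi (k + eta) - z t3.
  have D00 : 0 <= D by rewrite subr_ge0 phi_le below.
  pose s := t3 + (D + 1) / (Gam k / 4).
  have st3 : s <= t3.
    by rewrite /s gerDl; apply: mulr_ge0_le0; [lra|rewrite invr_le0; lra].
  have : z t3 - z s <= Gam k / 4 * (t3 - s).
    apply: (derive_le (df := fun t => Gam (v t) + e t)) => // x /andP[_ xt3].
      exact: ddz.
    by apply: slope => //; rewrite below// ltW// above1.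
  have sD : Gam k / 4 * (t3 - s) = - (D + 1).
    by rewrite /s opprD addNKr mulrN mulrC divfK//; apply/eqP; lra.
  rewrite sD; have : z s <= phi (k + eta) by rewrite phi_le below.
  by rewrite /D; lra.
have above2 t : t <= t4 -> k + eta < v t.
  move=> tt4; rewrite -phi_lt.
  apply: (barrier (f := z) (b := t4)) tt4; last by rewrite phi_lt.
    by move=> s st4; apply: ddz; lra.
  by move=> s st4 /phi_inj vs; apply: (le_lt_trans (slope s _ _)); rewrite ?vs; lra.
have [t5 Mt5] := M_Noo (M t4).
pose s := Num.min t4 t5.
have s4 : s <= t4 by rewrite ge_min lexx.
have s5 : s <= t5 by rewrite ge_min lexx orbT.
have : M t4 - M s <= 0 * (t4 - s).
  apply: (derive_le (df := fun t => k - v t)) => // x /andP[_ xt4].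
    by apply: dM; have [] := et2 x (ltac:(lra)).
  by have := above2 x xt4; lra.
by have := Mt5 s s5; lra.
Qed.

(** For very negative [z] the linear term of [Gam] absorbs the forcing term,
  and the power term makes [z] blow up in finite backward time. *)
Lemma riccati_lower : exists K t0, [/\ 0 < K, t0 <= T &
  forall t, t <= t0 -> - K <= z t].
Proof.
have [[P1 P10] [K0 [MU0 G1]]] := ((p1, p10), (k0, (mu0, g1_lt))).
have pk : 0 < p * k by apply: mulr_gt0; lra.
pose K := 2 / (p * k).
have KK0 : 0 < K by apply: divr_gt0; lra.
have pkK : p * k * K = 2 by rewrite /K mulrC divfK//; apply/eqP; lra.
have [t1 et1] := e_small ltr01.
pose t2 := Num.min t1 T.
have et2 t : t <= t2 -> t <= T /\ `|e t| <= 1.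
  by rewrite /t2 le_min => /andP[? ?]; split => //; exact: et1.
exists K, t2; split => //; first by rewrite ge_min lexx orbT.
move=> t3 t32; rewrite leNgt; apply/negP => zt3.
have ddz t : t <= t3 -> is_derive t 1 z (Gam (v t) + e t).
  by move=> tt3; apply: dz; have [] := et2 t (le_trans tt3 t32).
have low t : t <= t3 -> z t <= - K -> (p - 1) * `|v t| `^ p <= Gam (v t) + e t.
  move=> tt3 ztK; have [_] := et2 t (le_trans tt3 t32).
  rewrite /riccati_rhs -/(z t) ler_norml.
  have : 2 <= - (p * k * z t).
    by rewrite -mulrN -pkK ler_wpM2l//; [exact: ltW|lra].
  lra.
have below t : t <= t3 -> z t < - K.
  move=> tt3; rewrite -ltrN2 opprK.
  apply: (barrier (f := fun t => - z t) (fun s st => isdN (ddz s st))) tt3; last lra.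
  move=> s st3 zs; rewrite oppr_lt0.
  have zs' : z s <= - K by lra.
  apply: (lt_le_trans _ (low s st3 zs')); apply: mulr_gt0 => //.
  apply: powR_gt0; rewrite normr_gt0; apply/eqP => vs0.
  by move: zs'; rewrite /z vs0 phi0; lra.
pose al := 1 / (p - 1).
(* a nonnegative function, yet its derivative is at least [1] *)
pose h t := (- z t) `^ (- al).
have dh t : t <= t3 -> is_derive t 1 h
    (- al * (- z t) `^ (- al - 1) * - (Gam (v t) + e t)).
  move=> tt3; have zt0 : 0 < - z t by have := below t tt3; lra.
  have H1 := is_derive1_powR (- al) zt0; have H2 := isdN (ddz t tt3).
  exact: (isd_comp (f := fun y => y `^ (- al)) (g := fun t => - z t) H1 H2).
have h_ge0 t : 0 <= h t by exact: powR_ge0.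
have s3 : t3 - h t3 - 1 <= t3 by have := h_ge0 t3; lra.
have : 1 * (t3 - (t3 - h t3 - 1)) <= h t3 - h (t3 - h t3 - 1).
  apply: (derive_ge (df := fun t =>
    - al * (- z t) `^ (- al - 1) * - (Gam (v t) + e t))) => // x /andP[_ xt3].
    exact: dh.
  have vx0 : v x < 0 by rewrite -phi_lt phi0; have := below x xt3; rewrite /z; lra.
  have zE : - z x = `|v x| `^ (p - 1).
    rewrite /z -spowN spow_ge0E ?ltr0_norm//; [by apply/eqP; lra|lra].
  rewrite mulrN mulNr mulNr opprK zE -powRrM.
  have -> : (p - 1) * (- al - 1) = - p.
    by rewrite /al; field; apply/eqP; lra.
  rewrite powRN.
  have vp : 0 < `|v x| `^ p by rewrite powR_gt0// normr_gt0 lt_eqF.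
  have := low x xt3 (ltW (below x xt3)).
  set r := _ + e x; rewrite /al => H.
  have -> : 1 / (p - 1) / `|v x| `^ p * r = r / ((p - 1) * `|v x| `^ p).
    by field; rewrite !gt_eqF.
  by rewrite ler_pdivlMr ?mulr_gt0// mul1r.
have := h_ge0 (t3 - h t3 - 1).
have -> : t3 - (t3 - h t3 - 1) = h t3 + 1 by ring.
rewrite mul1r lerBrDl addrCA gerDl => hs hs1.
by have := ltr_wpDl hs ltr01; rewrite ltNge hs1.
Qed.

(** By convexity: to the left of [k - eta] the slope of [Gam], as a function
  of [z = phi x], is at most [- p * eta]. *)
Lemma riccati_damping eta x : 0 < eta -> g1 <= k - eta -> x <= k - eta ->
  (phi x - phi g1) * Gam x <= - (p * eta) * (phi x - phi g1) ^+ 2.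
Proof.
move=> eta0 g1eta xeta; have P1 := p1.
have p0 : 0 < p by lra.
have [g1x|xg1] := leP g1 x.
  have := riccati_tangent x g1; rewrite g1_root add0r => H.
  have yp : 0 <= phi x - phi g1 by rewrite subr_ge0 phi_le.
  set y := phi x - phi g1 in H yp *.
  apply: (le_trans (ler_wpM2l yp H)).
  have -> : y * (p * (x - k) * y) = p * (x - k) * y ^+ 2 by ring.
  by apply: ler_wpM2r; rewrite ?sqr_ge0// -mulrN ler_pM2l//; lra.
have := riccati_tangent g1 x; rewrite g1_root.
have yp : 0 < phi g1 - phi x by rewrite subr_gt0 phi_lt.
set y := phi g1 - phi x in yp * => H.
have -> : phi x - phi g1 = - y by rewrite /y opprB.
have {}H : p * eta * y <= Gam x.
  have : p * eta * y <= p * (k - g1) * y.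
    by rewrite ler_wpM2r ?(ltW yp)// ler_pM2l//; lra.
  lra.
have := ler_wpM2l (ltW yp) H; rewrite sqrrN expr2; lra.
Qed.

(** The damping gives a linear differential inequality for [(z - phi g1) ^+
  2]. It is integrated from [-oo], where [z] is bounded, so that only the
  forcing term contributes. *)
Lemma riccati_decay eta K s C t0 : 0 < eta -> g1 <= k - eta ->
  0 < s -> 0 <= C -> t0 <= T ->
  (forall t, t <= t0 -> v t <= k - eta) -> (forall t, t <= t0 -> - K <= z t) ->
  (forall t, t <= t0 -> `|e t| <= C * expR (s * t)) ->
  exists C', 0 <= C' /\
    forall t, t <= t0 -> (z t - phi g1) ^+ 2 <= C' * expR (s * t).
Proof.
move=> eta0 g1eta s0 C0 t0T vup zlow eC.
have P1 := p1; have G1 := g1_lt; have K0 := k0.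
have p0 : 0 < p by lra.
pose Y := `|K| + phi k.
have Y0 : 0 <= Y.
  by rewrite addr_ge0// -phi0 phi_le ltW.
have yY t : t <= t0 -> `|z t - phi g1| <= Y.
  move=> tt0; have := zlow t tt0; have := ler_norm K; have := normr_ge0 K.
  have : z t <= phi k by rewrite phi_le; have := vup t tt0; lra.
  have : 0 <= phi g1 <= phi k by rewrite -phi0 !phi_le; lra.
  by rewrite /Y ler_norml; lra.
pose lam := p * eta; have lam0 : 0 < lam by exact: mulr_gt0.
pose C' := 2 * Y * C / (2 * lam + s).
have l2s : 0 < 2 * lam + s by lra.
have C'0 : 0 <= C' by rewrite divr_ge0 ?mulr_ge0//; lra.
exists C'; split=> // t tt0.
pose y t := z t - phi g1.
pose D t := y t * y t * expR (2 * lam * t) - C' * expR ((2 * lam + s) * t).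
have dy u : u <= t0 -> is_derive u 1 y (Gam (v u) + e u).
  move=> ut0; have H := isdB (dz (le_trans ut0 t0T)) (isd_cst (phi g1) u).
  by apply: (isd_eq H); rewrite subr0.
pose dD u := (y u * y u * (2 * lam * expR (2 * lam * u)) +
  expR (2 * lam * u) * (y u * (Gam (v u) + e u) + y u * (Gam (v u) + e u)))
  - C' * ((2 * lam + s) * expR ((2 * lam + s) * u)).
have HD u : u <= t0 -> is_derive u 1 D (dD u).
  move=> ut0; apply: isdB; last exact: isdZ (isd_exp _ _).
  by apply: (isdM (f := fun t => y t * y t)); [exact: isdM (dy u ut0) (dy u ut0)|exact: isd_exp].
have dD0 u : u <= t0 -> dD u <= 0.
  move=> ut0; rewrite /dD.
  have Es : expR ((2 * lam + s) * u) = expR (2 * lam * u) * expR (s * u).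
    by rewrite [(2 * lam + s) * u]mulrDl expRD.
  rewrite Es.
  have E2 := expR_gt0 (2 * lam * u).
  set E := expR (2 * lam * u) in E2 *.
  have -> : C' * ((2 * lam + s) * (E * expR (s * u))) = E * (2 * (Y * (C * expR (s * u)))).
    by rewrite /C'; field; rewrite gt_eqF.
  have H1 : y u * Gam (v u) <= - lam * (y u) ^+ 2.
    by apply: riccati_damping => //; exact: vup.
  have H2 : y u * e u <= Y * (C * expR (s * u)).
    apply: (le_trans (ler_norm _)); rewrite normrM.
    by apply: ler_pM => //; [exact: yY|exact: eC].
  set W := Y * (C * expR (s * u)) in H2 *.
  have -> : y u * y u * (2 * lam * E) + E * (y u * (Gam (v u) + e u) + y u * (Gam (v u) + e u)) - E * (2 * W)
    = E * (2 * (lam * y u ^+ 2 + y u * Gam (v u) + y u * e u - W)) by ring.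
  by apply: mulr_ge0_le0; [exact: ltW|move: H1 H2; set a := y u * Gam _; set b := y u * e u; set c := lam * _; rewrite mulNr -/c; lra].
have DD r : r <= t -> D t <= D r.
  move=> rt; have : D t - D r <= 0 * (t - r).
    apply: (derive_le (df := dD)) => // x /andP[_ xt].
      by apply: HD; exact: le_trans xt tt0.
    by apply: dD0; exact: le_trans xt tt0.
  by rewrite mul0r subr_le0.
suff : D t <= 0.
  rewrite /D [(2 * lam + s) * t]mulrDl expRD.
  have E2 := expR_gt0 (2 * lam * t).
  set E := expR (2 * lam * t) in E2 *.
  have -> : y t * y t * E - C' * (E * expR (s * t)) = E * (y t ^+ 2 - C' * expR (s * t)) by ring.
  by rewrite pmulr_rle0// subr_le0.
rewrite leNgt; apply/negP => Dt.
have [r0 Hr0] := exp_small (Y ^+ 2) (ltac:(lra) : 0 < 2 * lam) (ltac:(lra) : 0 < D t / 2).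
pose r := Num.min t r0.
have rt : r <= t by rewrite ge_min lexx.
have rr0 : r <= r0 by rewrite ge_min lexx orbT.
have := DD r rt; have := Hr0 r rr0.
have : D r <= Y ^+ 2 * expR (2 * lam * r).
  rewrite /D lerBlDr (le_trans (y := Y ^+ 2 * expR (2 * lam * r)))//.
    rewrite ler_wpM2r ?expR_ge0// -expr2 -(real_normK (num_real (y r))).
    by rewrite lerXn2r ?nnegrE//; apply: yY; exact: le_trans rt tt0.
  by rewrite lerDl mulr_ge0// expR_ge0.
by move: Dt; move: (D t) (D r) (Y ^+ 2 * _) => a b c; lra.
Qed.

End riccati.

Section asymptotics.
Context {R : realType}.

Lemma lt0_of_spow (a x : R) : 0 < spow a x -> 0 < x.
Proof.
rewrite /spow => H; have := sgr_gt0 x => <-.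
by rewrite -(pmulr_lgt0 _ (_ : 0 < `|x| `^ a))// lt_neqAle powR_ge0 andbT eq_sym;
  apply/eqP => h; move: H; rewrite h mulr0 ltxx.
Qed.

(** The inverse of [spow a] is Lipschitz continuous away from the origin, and
  Hoelder continuous at the origin, which is the root [g1] when [mu] vanishes.
  *)
Lemma spow_inv_holder (a g : R) : 0 < a -> 0 <= g ->
  exists C th d : R, [/\ 0 <= C, 0 < th, 0 < d & forall x,
    `|spow a x - spow a g| <= d -> `|x - g| <= C * `|spow a x - spow a g| `^ th].
Proof.
move=> a0; have a00 : a != 0 by rewrite gt_eqF.
rewrite le_eqVlt => /predU1P[<-|g0].
  exists 1, a^-1, 1; split=> //; first by rewrite invr_gt0.
  move=> x _; rewrite spow0 !subr0 mul1r normr_spow// -powRrM mulfV// powRr1//.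
pose w := spow a g; have w0 : 0 < w by exact: spow_gt0.
have gE : g = w `^ a^-1.
  by rewrite /w spow_ge0E ?(ltW g0)// -powRrM mulfV// powRr1// ltW.
pose b := a^-1; have b0 : 0 < b by rewrite invr_gt0.
pose B := b * ((w / 2) `^ (b - 1) + (2 * w) `^ (b - 1)).
have B0 : 0 <= B by rewrite mulr_ge0 ?(ltW b0)// addr_ge0 ?powR_ge0.
exists B, 1, (w / 2); split=> //; first lra.
move=> x; rewrite powRr1//.
have [y yE] : {y | y = spow a x} by exists (spow a x).
rewrite -yE -/w => yw.
have yb : w / 2 <= y <= 2 * w by move: yw; rewrite ler_norml; lra.
have xE : x = y `^ b.
  have x0 : 0 < x by apply: (@lt0_of_spow a); rewrite -yE; lra.
  by rewrite yE spow_ge0E ?(ltW x0)// -powRrM mulfV// powRr1// ltW.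
rewrite xE gE -/b.
have dB c : w / 2 <= c <= 2 * w -> 0 <= b * c `^ (b - 1) <= B.
  move=> cw; apply/andP; split; first by rewrite mulr_ge0 ?(ltW b0)// powR_ge0.
  rewrite /B ler_pM2l//.
  have [b1|b1] := leP 0 (b - 1).
    apply: (@le_trans _ _ ((2 * w) `^ (b - 1))); last by rewrite lerDr powR_ge0.
    by apply: powR_le2r => //; lra.
  apply: (@le_trans _ _ ((w / 2) `^ (b - 1))); last by rewrite lerDl powR_ge0.
  rewrite -(opprK (b - 1)) !(powRN _ (- (b - 1))) lef_pV2 ?posrE ?powR_gt0//; try lra.
  by apply: powR_le2r; lra.
have key s t : w / 2 <= s -> s <= t -> t <= 2 * w ->
    0 <= t `^ b - s `^ b <= B * (t - s).
  move=> ws st tw; apply/andP; split.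
    by rewrite subr_ge0 powR_le2r//; lra.
  apply: (derive_le (f := fun c => c `^ b) (df := fun c => b * c `^ (b - 1))) => // c cst.
    by apply: is_derive1_powR; lra.
  by have /andP[] := dB c (ltac:(lra)).
have [wy|/ltW yw'] := leP w y.
  have := key w y; rewrite !ger0_norm; [|lra|]; last first.
    by rewrite subr_ge0 powR_le2r//; lra.
  by move=> H; have /andP[] := H (ltac:(lra)) wy (ltac:(lra)).
have := key y w; rewrite !(distrC _ w) !(distrC _ (w `^ b)) !ger0_norm; [|lra|]; last first.
  by rewrite subr_ge0 powR_le2r//; lra.
by move=> H; have /andP[] := H (ltac:(lra)) yw' (ltac:(lra)).
Qed.

(** With [E t = C / ka * expR (ka * t)], the function [H + E] is
  nondecreasing, [H - E] is nonincreasing, and [E] vanishes at [-oo]. *)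
Lemma tail_limit (H dH : R -> R) (C ka t0 : R) : 0 <= C -> 0 < ka ->
  (forall t, t <= t0 -> is_derive t 1 H (dH t)) ->
  (forall t, t <= t0 -> `|dH t| <= C * expR (ka * t)) ->
  exists l, forall eps, 0 < eps -> exists t1, forall t, t <= t1 -> `|H t - l| <= eps.
Proof.
move=> C0 ka0 dHd dHC.
pose E t := C / ka * expR (ka * t).
have Ck : 0 <= C / ka by rewrite divr_ge0// ltW.
have E_ge0 t : 0 <= E t by rewrite mulr_ge0// expR_ge0.
have dE (t : R) : is_derive t 1 E (C * expR (ka * t)).
  by apply: (isd_eq (isdZ (C / ka) (isd_exp ka t))); rewrite mulrA divfK// gt_eqF.
have up s t : s <= t -> t <= t0 -> H s + E s <= H t + E t.
  move=> st tt0; have : 0 * (t - s) <= (H t + E t) - (H s + E s).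
    apply: (derive_ge (f := fun t => H t + E t) (df := fun u => dH u + C * expR (ka * u))) => //.
      by move=> x /andP[_ xt]; apply: isdD => //; apply: dHd; exact: le_trans xt tt0.
    move=> x /andP[_ xt]; have := dHC x (le_trans xt tt0).
    by rewrite ler_norml; lra.
  by rewrite mul0r subr_ge0.
have down s t : s <= t -> t <= t0 -> H t - E t <= H s - E s.
  move=> st tt0; have : (H t - E t) - (H s - E s) <= 0 * (t - s).
    apply: (derive_le (f := fun t => H t - E t) (df := fun u => dH u - C * expR (ka * u))) => //.
      by move=> x /andP[_ xt]; apply: isdB => //; apply: dHd; exact: le_trans xt tt0.
    move=> x /andP[_ xt]; have := dHC x (le_trans xt tt0).
    by rewrite ler_norml; lra.
  by rewrite mul0r subr_le0.
pose A := [set H t + E t | t in [set t | t <= t0]].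
have lbA : lbound A (H t0 - E t0).
  move=> _ [t /= tt0 <-]; have := down t t0 tt0 (lexx _); have := E_ge0 t; lra.
have infA : has_inf A.
  split; first by exists (H t0 + E t0), t0 => //=.
  by exists (H t0 - E t0).
exists (inf A) => eps eps0.
have [_ [s /= st0 <-] Hs] := inf_adherent eps0 infA.
have [t1 Ht1] := exp_small (C / ka) ka0 eps0.
exists (Num.min s t1) => t; rewrite le_min => /andP[ts tt1].
have := up t s ts st0; have := Ht1 t tt1; rewrite -/(E t).
have : inf A <= H t + E t.
  by apply: ge_inf; [exact: infA.2|exists t => //=; exact: le_trans ts st0].
by have := E_ge0 t; rewrite ler_norml; lra.
Qed.

(** The forcing term tends to zero because [L + k * t] tends to [-oo], but a
  rate is needed to integrate [v - g1]. The bound [v <= k - eta] makes [L + k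
  * t] at most linear with slope [eta], hence the forcing term exponentially
  small; the damping passes this on to [z - phi g1], and the Hoelder bound to
  [v - g1]. *)
Theorem riccati_limit (p k mu g1 beta C0 T : R) (L v e : R -> R) :
  1 < p -> 0 < k -> 0 <= mu -> mu < k `^ p -> 0 <= g1 < k ->
  riccati_rhs p k mu g1 = 0 -> 0 < beta -> 0 <= C0 ->
  (forall t, t <= T -> is_derive t 1 L (- v t)) ->
  (forall t, t <= T -> is_derive t 1 (fun t => spow (p - 1) (v t))
    (riccati_rhs p k mu (v t) + e t)) ->
  (forall t, t <= T ->
    `|e t| <= C0 * (expR (p * t) + expR (beta * (L t + k * t)))) ->
  (forall B : R, exists t0, forall t, t <= t0 -> L t + k * t < B) ->
  exists l, forall eps, 0 < eps ->
    exists t1, forall t, t <= t1 -> `|L t + g1 * t - l| <= eps.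
Proof.
move=> p1 k0 mu0 muk g1k g1r be0 C00 dL dz eC MN.
have p0 : 0 < p by lra.
pose M t := L t + k * t.
have e_small d : 0 < d -> exists t0, forall t, t <= t0 -> `|e t| <= d.
  move=> d0; have d0' : 0 < d / (2 * (C0 + 1)) by rewrite divr_gt0//; lra.
  have [t1 Ht1] := exp_small 1 p0 d0'.
  have [t2 Ht2] := exp_small 1 be0 d0'.
  have [t3 Ht3] := MN t2.
  exists (Num.min T (Num.min t1 t3)) => t; rewrite !le_min => /and3P[tT tt1 tt3].
  apply: (le_trans (eC t tT)).
  have := Ht1 t tt1; have := Ht2 _ (ltW (Ht3 t tt3)); rewrite !mul1r.
  rewrite -/(M t); have := expR_ge0 (beta * M t); have := expR_ge0 (p * t).
  move: (expR (p * t)) (expR (beta * M t)) => x y x0 y0 H2 H1.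
  apply: (@le_trans _ _ ((C0 + 1) * (x + y))); first by rewrite ler_wpM2r//; lra.
  have -> : d = (C0 + 1) * (d / (2 * (C0 + 1)) + d / (2 * (C0 + 1))).
    by field; apply/eqP; lra.
  by rewrite ler_wpM2l//; lra.
have [eta [t1 [eta0 g1eta t1T vup]]] :=
  riccati_upper p1 k0 mu0 muk g1k dL dz e_small MN.
have [K [t2 [K0 t2T zlow]]] := riccati_lower p1 k0 mu0 g1k dz e_small.
pose t3 := Num.min 0 (Num.min t1 t2).
have Ht3 t : t <= t3 -> [/\ t <= 0, t <= T, t <= t1 & t <= t2].
  rewrite /t3 !le_min => /and3P[? tt1 ?]; split=> //; exact: le_trans tt1 t1T.
have [t30 t3T t3t1 t3t2] := Ht3 t3 (lexx _).
pose s := Num.min p (beta * eta).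
have be_eta : 0 < beta * eta by exact: mulr_gt0.
have s0 : 0 < s by rewrite lt_min p0.
pose C1 := C0 * (1 + expR (beta * (M t3 - eta * t3))).
have C10 : 0 <= C1 by rewrite mulr_ge0// addr_ge0// expR_ge0.
have eC1 t : t <= t3 -> `|e t| <= C1 * expR (s * t).
  move=> tt3; have [tn tT tt1 tt2] := Ht3 t tt3.
  apply: (le_trans (eC t tT)); rewrite /C1 -mulrA ler_wpM2l// mulrDl mul1r lerD//.
    by rewrite ler_expR ler_wnM2r// ge_min lexx.
  rewrite -expRD ler_expR.
  have : eta * (t3 - t) <= M t3 - M t.
    apply: (derive_ge (df := fun t => k - v t)) => // x /andP[_ xt3].
      have [_ xT _ _] := Ht3 x xt3.
      by apply: (isd_eq (isdD (dL x xT) (isdZ k (isd_id x)))); ring.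
    by have [_ _ xt1 _] := Ht3 x xt3; have := vup x xt1; lra.
  rewrite -/(M t) => HM.
  have : beta * M t <= beta * (M t3 - eta * (t3 - t)) by rewrite ler_pM2l//; lra.
  have : (beta * eta) * t <= s * t by rewrite ler_wnM2r// ge_min lexx orbT.
  lra.
have [C2 [C20 yC2]] := riccati_decay p1 k0 mu0 g1k g1r dz eta0 g1eta s0 C10 t3T
  (fun t tt3 => vup t (le_trans tt3 t3t1)) (fun t tt3 => zlow t (le_trans tt3 t3t2)) eC1.
have [C3 [th [d [C30 th0 d0 hol]]]] := spow_inv_holder (ltac:(lra) : 0 < p - 1)
  (ltac:(lra) : 0 <= g1).
have yC t : t <= t3 -> `|spow (p - 1) (v t) - spow (p - 1) g1| <=
    Num.sqrt C2 * expR (s / 2 * t).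
  move=> /yC2 H; rewrite -(@ler_pXn2r _ 2)// ?nnegrE ?mulr_ge0 ?sqrtr_ge0 ?expR_ge0//.
  rewrite real_normK ?num_real// exprMn sqr_sqrtr// -expRM_natl.
  by rewrite (_ : 2 * (s / 2 * t) = s * t)//; field.
have [t4 Ht4] := exp_small (Num.sqrt C2) (ltac:(lra) : 0 < s / 2) d0.
pose t5 := Num.min t3 t4.
have Ht5 t : t <= t5 -> t <= t3 /\ t <= t4 by rewrite le_min => /andP.
apply: (@tail_limit _ (fun t => - v t + g1) (C3 * (Num.sqrt C2) `^ th) (s / 2 * th) t5).
- by rewrite mulr_ge0// powR_ge0.
- by rewrite mulr_gt0//; lra.
- move=> t /Ht5[tt3 _]; have [_ tT _ _] := Ht3 t tt3.
  by apply: (isd_eq (isdD (dL t tT) (isdZ g1 (isd_id t)))); rewrite mulr1.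
- move=> t /Ht5[tt3 tt4]; rewrite addrC distrC.
  apply: (le_trans (hol _ (le_trans (yC t tt3) (Ht4 t tt4)))).
  rewrite -mulrA ler_wpM2l//.
  rewrite mulrAC expRM -powRM ?sqrtr_ge0 ?expR_ge0//.
  apply: powR_le2r => //; first exact: ltW.
  exact: yC.
Qed.

End asymptotics.

(** * Radial solutions of finite energy *)

Section emden_fowler.
Context {R : realType}.

Lemma mul_le_powRD (p x y : R) : 1 < p -> 0 <= x -> 0 <= y ->
  x * y <= x `^ p + y `^ (p / (p - 1)).
Proof.
move=> p1 x0 y0.
have H := @conjugate_powR R x y p (p / (p - 1)) x0 y0.
apply: (le_trans (H _ _ _)); [lra|by apply: divr_gt0; lra| |].
  by field; apply/andP; split; apply/eqP; lra.
have le_div (a b : R) : 0 <= a -> 1 <= b -> a / b <= a.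
  by move=> a0 b1; rewrite ler_pdivrMr ?ler_peMr//; lra.
apply: lerD; apply: le_div; rewrite ?powR_ge0//; first lra.
by rewrite ler_pdivlMr; lra.
Qed.

Lemma spowMr (a x y : R) : a != 0 -> 0 <= y -> spow a (x * y) = spow a x * y `^ a.
Proof.
move=> a0; rewrite le_eqVlt => /predU1P[<-|y0].
  by rewrite mulr0 spow0 powR0// mulr0.
rewrite /spow sgrM (gtr0_sg y0) mulr1 normrM (gtr0_norm y0) powRM ?(ltW y0)//.
by rewrite mulrA.
Qed.

Variables (n p c S0 : R) (U dU : R -> R).
Hypotheses (p1 : 1 < p) (pn : p < n) (c0 : 0 < c) (S00 : 0 < S0).

(** The radius of the sphere enclosing the volume [s]. *)
Definition ball_radius (s : R) : R := (s / c) `^ n^-1.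

Let k := (n - p) / p.
Let s_ t := c * expR (n * t).

Lemma ball_radius_exp t : ball_radius (c * expR (n * t)) = expR t.
Proof.
have n0 : n != 0 by apply/eqP; have := p1; have := pn; lra.
by rewrite /ball_radius mulrC mulKf ?gt_eqF// -expRM mulrAC divff// mul1r.
Qed.

Let T0 := ln (S0 / (2 * c)) / n.

Let n0 : 0 < n. Proof. by rewrite (lt_trans _ pn)// (lt_trans _ p1). Qed.
Let p0 : 0 < p. Proof. by rewrite (lt_trans _ p1). Qed.
Let k0 : 0 < k. Proof. by rewrite divr_gt0 ?subr_gt0. Qed.
Let pk : p * k = n - p. Proof. by rewrite /k mulrC divfK// gt_eqF. Qed.

Let s_gt0 t : 0 < s_ t. Proof. by rewrite mulr_gt0// expR_gt0. Qed.

Let s_lt t : t <= T0 -> s_ t < S0.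
Proof.
move=> tT; rewrite /s_ mulrC -ltr_pdivlMr//.
apply: (@le_lt_trans _ _ (S0 / (2 * c))); last first.
  have := S00; have := c0 => C0 S1; rewrite ltr_pdivrMr; last lra.
  by rewrite (_ : S0 / c * (2 * c) = 2 * S0); [lra|field; rewrite gt_eqF].
have e0 : 0 < S0 / (2 * c) by rewrite divr_gt0// mulr_gt0.
by rewrite -[leRHS]lnK ?posrE// ler_expR mulrC -ler_pdivlMr.
Qed.

Let ds (t : R) : is_derive t 1 s_ (n * s_ t).
Proof.
by apply: (isd_eq (isdZ c (isd_exp n t))); rewrite /s_ mulrCA.
Qed.

(** The area [n * c * r ^ (n - 1)] of the sphere of radius [r = ball_radius
  s]. It is also the norm of the gradient of the volume variable, that is, the
  factor between derivatives in [s] and in [r]. *)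
Definition sphere_area (s : R) : R := n * s / ball_radius s.

Let sphere_area_s t : sphere_area (s_ t) = n * s_ t * expR (- t).
Proof. by rewrite /sphere_area ball_radius_exp expRN. Qed.

Hypothesis U_gt0 : forall s, 0 < s -> s < S0 -> 0 < U s.
Hypothesis dUP : forall s, 0 < s -> s < S0 -> is_derive s 1 U (dU s).

Let g t := dU (s_ t) * sphere_area (s_ t).

Let dV (t : R) : t <= T0 -> is_derive t 1 (fun t => U (s_ t)) (g t * expR t).
Proof.
move=> tT; have H := isd_comp (dUP (s_gt0 t) (s_lt tT)) (ds t).
apply: (isd_eq H); rewrite /g sphere_area_s -!mulrA -expRD addNr expR0 mulr1//.
Qed.

(** A finite energy forces [U] to be smaller than the scale invariant power
  [r ^ (- (n - p) / p)]: this is the radial Sobolev inequality, obtained here by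
  splitting [|g| r] with Young's inequality at a scale depending on the
  point. *)
Lemma finite_energy_decay (J : R -> R) (I : R) :
  (forall s, 0 < s -> s < S0 -> is_derive s 1 J (`|dU s * sphere_area s| `^ p)) ->
  (forall s, 0 < s -> s < S0 -> I <= J s) ->
  forall eps, 0 < eps -> exists t0, forall t, t <= t0 ->
    U (c * expR (n * t)) * expR (k * t) <= eps.
Proof.
move=> dJ JI eps eps0.
have [[N0 P0] [K0 [P1 PN]]] := ((n0, p0), (k0, (p1, pn))).
pose al := 1 / (p - 1); have al0 : 0 < al by rewrite divr_gt0//; lra.
have alp : al * (p - 1) = 1 by rewrite /al divfK//; apply/eqP; lra.
pose ka := p * k * al; have ka0 : 0 < ka by apply: mulr_gt0 => //; exact: mulr_gt0.
pose Jt t := J (s_ t).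
have dJt t : t <= T0 -> is_derive t 1 Jt (`|g t| `^ p * (n * s_ t)).
  by move=> tT; exact: (isd_comp (dJ _ (s_gt0 t) (s_lt tT)) (ds t)).
pose A := [set Jt t | t in [set t | t <= T0]].
have infA : has_inf A.
  split; first by exists (Jt T0), T0 => //=.
  by exists I => _ [t /= tT <-]; apply: JI => //; exact: s_lt.
(* the constant making the third term small *)
have [x [Lam0 HL]] : exists Lam : R, 0 < Lam /\ Lam `^ (- al) / ka <= eps / 3.
  exists ((ka * eps / 3) `^ (- al^-1)).
  have h0 : 0 < ka * eps / 3 by rewrite divr_gt0// mulr_gt0.
  split; first exact: powR_gt0.
  rewrite -powRrM mulrNN mulVf ?gt_eqF// powRr1 ?(ltW h0)//.
  by rewrite ler_pdivrMr//; lra.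
set Lam := x in Lam0 HL *.
have d0 : 0 < eps / 3 * (n * c) / Lam by rewrite divr_gt0// !mulr_gt0//; lra.
have [_ [t1 /= t1T <-] Ht1] := inf_adherent d0 infA.
have [t2 Ht2] := exp_small (U (s_ t1)) K0 (ltac:(lra) : 0 < eps / 3).
exists (Num.min t1 t2) => t; rewrite le_min => /andP[tt1 tt2].
pose lam := Lam * expR (- k * t).
have lam0 : 0 < lam by rewrite mulr_gt0// expR_gt0.
pose Phi u := U (s_ u) + lam / (n * c) * Jt u - lam `^ (- al) / ka * expR (- ka * u).
have mono : Phi t <= Phi t1.
  suff : 0 * (t1 - t) <= Phi t1 - Phi t by rewrite mul0r subr_ge0.
  pose dPhi u := g u * expR u + lam / (n * c) * (`|g u| `^ p * (n * s_ u))
    - lam `^ (- al) / ka * (- ka * expR (- ka * u)).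
  apply: (derive_ge (df := dPhi)) => // u /andP[_ ut1].
    have uT := le_trans ut1 t1T.
    apply: isdB; last exact: isdZ (isd_exp _ _).
    by apply: isdD; [exact: dV|apply: isdZ; exact: dJt].
  rewrite /dPhi.
  have -> : lam / (n * c) * (`|g u| `^ p * (n * s_ u)) = lam * expR (n * u) * `|g u| `^ p.
    by rewrite /s_; field; rewrite !gt_eqF.
  have -> : lam `^ (- al) / ka * (- ka * expR (- ka * u)) = - (lam `^ (- al) * expR (- ka * u)).
    by field; rewrite gt_eqF.
  rewrite opprK.
  have := @mul_le_powRD p ((lam * expR (n * u)) `^ p^-1 * `|g u|)
    ((lam * expR (n * u)) `^ (- p^-1) * expR u) P1.
  have q0 : 0 < lam * expR (n * u) by rewrite mulr_gt0// expR_gt0.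
  rewrite !mulr_ge0 ?powR_ge0 ?expR_ge0// => /(_ isT isT).
  rewrite mulrACA powRN mulfV ?mul1r ?(gt_eqF (powR_gt0 _ q0))//.
  rewrite powRM ?powR_ge0// -powRrM mulVf ?gt_eqF// powRr1 ?(ltW q0)//.
  rewrite -powRN powRM ?powR_ge0 ?expR_ge0// -powRrM.
  have -> : - p^-1 * (p / (p - 1)) = - al.
    by rewrite /al; field; apply/andP; split; apply/eqP; lra.
  rewrite -expRM powRM ?expR_ge0 ?(ltW lam0)// -expRM.
  rewrite -[lam `^ (- al) * _ * _]mulrA -expRD.
  have -> : n * u * - al + u * (p / (p - 1)) = - ka * u.
    by rewrite /ka pk /al; field; apply/eqP; lra.
  have : - (`|g u| * expR u) <= g u * expR u.
    by rewrite -mulNr ler_wpM2r ?expR_ge0// lerNl -normrN ler_norm.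
  rewrite addrAC -!addrA; lra.
have Ek := expR_gt0 (k * t).
have lamE : lam * expR (k * t) = Lam.
  by rewrite /lam -mulrA -expRD mulNr addNr expR0 mulr1.
have lamal : lam `^ (- al) / ka * expR (- ka * t) * expR (k * t) = Lam `^ (- al) / ka.
  rewrite /lam powRM ?(ltW Lam0) ?expR_ge0// -expRM.
  have E3 a b e1 e2 e3 : a * e1 / b * e2 * e3 = a / b * (e1 * e2 * e3) :> R.
    by ring.
  rewrite E3 -!expRD.
  have -> : - k * t * - al + - ka * t + k * t = k * t * (1 - al * (p - 1)).
    by rewrite /ka; ring.
  by rewrite alp subrr mulr0 expR0 mulr1.
have Jlow : inf A <= Jt t.
  by apply: ge_inf; [exact: infA.2|exists t => //=; exact: le_trans tt1 t1T].
have H1 : U (s_ t) <= U (s_ t1) + lam / (n * c) * (Jt t1 - Jt t) + lam `^ (- al) / ka * expR (- ka * t).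
  have : 0 <= lam `^ (- al) / ka * expR (- ka * t1).
    by rewrite mulr_ge0 ?expR_ge0// divr_ge0 ?powR_ge0// ltW.
  move: mono; rewrite /Phi.
  move: (lam `^ (- al) / ka * expR (- ka * t1)) (lam `^ (- al) / ka * expR (- ka * t)) => a b.
  move: (U (s_ t)) (U (s_ t1)) (Jt t) (Jt t1) (lam / (n * c)) => u1 u2 j1 j2 l; nra.
have {}H1 := ler_wpM2r (ltW Ek) H1.
apply: (le_trans H1); rewrite !mulrDl lamal.
have -> : eps = eps / 3 + eps / 3 + eps / 3 by field.
apply: lerD => //; apply: lerD; first exact: Ht2.
rewrite mulrAC (_ : lam / (n * c) * expR (k * t) = Lam / (n * c)); last first.
  by rewrite mulrAC lamE.
have D : Jt t1 - Jt t <= eps / 3 * (n * c) / Lam by move: Ht1 Jlow; lra.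
have nc : 0 < n * c by rewrite mulr_gt0.
apply: (@le_trans _ _ (Lam / (n * c) * (eps / 3 * (n * c) / Lam))).
  by rewrite ler_wpM2l// divr_ge0// ltW.
by rewrite le_eqVlt; apply/orP; left; apply/eqP; field; rewrite !gt_eqF.
Qed.

(** The volume variable [s] and the radius are exponentials of the same
  parameter [t]; in that parameter the radial equation for [U] becomes a
  perturbed Riccati equation for [v = - d (ln U) / dt]. The flux [W] carries
  the equation, and the energy [J] the decay of [U]. *)
Theorem radial_limit (mu m Cf g1 : R) (f W : R -> R) (J : R -> R) (I : R) :
  0 <= mu -> mu < k `^ p -> 0 <= g1 < k -> riccati_rhs p k mu g1 = 0 -> 0 <= Cf ->
  0 < m ->
  (forall x, 0 < x ->
     `|f x| <= Cf * (x `^ (p - 1) + x `^ (n * p / (n - p) - 1))) ->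
  (forall s, 0 < s -> s < S0 -> is_derive s 1 J (`|dU s * sphere_area s| `^ p)) ->
  (forall s, 0 < s -> s < S0 -> I <= J s) ->
  (forall s, 0 < s -> s < S0 -> W s = spow (p - 1) (dU s * sphere_area s) * sphere_area s) ->
  (forall s, 0 < s -> s < S0 -> is_derive s 1 W
     (- ((mu / ball_radius s `^ p - m) * U s `^ (p - 1) + f (U s)))) ->
  exists C, 0 < C /\ forall eps, 0 < eps -> exists t0, forall t, t <= t0 ->
    `|U (c * expR (n * t)) * expR (g1 * t) - C| <= eps.
Proof.
move=> mu0 muk g1k g1r Cf0 m0 fC dJ JI WE dW.
have [[N0 P0] [K0 [P1 PN]]] := ((n0, p0), (k0, (p1, pn))).
have decay := finite_energy_decay dJ JI.
pose L t := ln (U (s_ t)).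
pose v t := - (g t * expR t / U (s_ t)).
pose e t := expR (p * t) * (f (U (s_ t)) / U (s_ t) `^ (p - 1) - m).
pose be := p / k.
have be0 : 0 < be by rewrite divr_gt0.
have U0 t : t <= T0 -> 0 < U (s_ t) by move=> tT; apply: U_gt0 => //; exact: s_lt.
have dL t : t <= T0 -> is_derive t 1 L (- v t).
  move=> tT; have H := isd_comp (is_derive1_ln (U0 t tT)) (dV tT).
  by apply: (isd_eq H); rewrite /v opprK mulrC.
have UL t : t <= T0 -> U (s_ t) = expR (L t).
  by move=> tT; rewrite /L lnK// posrE U0.
have zE t : s_ t < S0 -> spow (p - 1) (v t) =
    - (n * c)^-1 * (expR ((p - n) * t) * (W (s_ t) * U (s_ t) `^ (- (p - 1)))).
  move=> tT; have Ut := U_gt0 (s_gt0 t) tT.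
  have p10 : p - 1 != 0 by apply/eqP; lra.
  have Ui : 0 <= (U (s_ t))^-1 by rewrite invr_ge0 ltW.
  rewrite /v spowN (spowMr _ p10 Ui) (spowMr _ p10 (expR_ge0 t)).
  rewrite WE// -/(g t) -powR_inv1 ?(ltW Ut)// -powRrM mulN1r sphere_area_s -expRM.
  rewrite !mulNr; congr (- _).
  have -> : n * s_ t * expR (- t) = n * c * expR ((n - 1) * t).
    by rewrite /s_ -!mulrA -expRD; congr (_ * (_ * expR _)); ring.
  have -> : t * (p - 1) = (p - n) * t + (n - 1) * t by ring.
  by rewrite expRD; field; rewrite !gt_eqF.
have dz t : t <= T0 -> is_derive t 1 (fun t => spow (p - 1) (v t))
    (riccati_rhs p k mu (v t) + e t).
  move=> tT; have Ut := U0 t tT; have st := s_lt tT.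
  have H := isdZ (- (n * c)^-1) (isdM (isd_exp (p - n) t) (isdM
    (isd_comp (dW _ (s_gt0 t) st) (ds t))
    (isd_comp (is_derive1_powR (- (p - 1)) Ut) (dV tT)))).
  apply: (@near_eq_is_derive _ _ _ (fun t => - (n * c)^-1 *
     (expR ((p - n) * t) * (W (s_ t) * U (s_ t) `^ (- (p - 1)))))).
    have /cvgrPdist_lt/(_ (S0 - s_ t)) := derive_continuous (ds t).
    rewrite subr_gt0 => /(_ st); apply: filterS => y Hy; rewrite zE//.
    by move: Hy; rewrite distrC => /ltr_normlP[]; lra.
  apply: (isd_eq H); rewrite /riccati_rhs -(mul_spow (v t) P1).
  have -> : e t = expR (p * t) * (f (U (s_ t)) * U (s_ t) `^ (- (p - 1)) - m).
    by rewrite /e powRN.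
  rewrite zE// pk /s_ ball_radius_exp -/(s_ t).
  have -> : U (s_ t) `^ (- (p - 1) - 1) = U (s_ t) `^ (- (p - 1)) / U (s_ t).
    rewrite powRD ?(gt_eqF Ut) ?implybT//; congr (_ * _).
    by rewrite powR_inv1 // ltW.
  have -> : expR t `^ p = expR (p * t) by rewrite -expRM mulrC.
  have -> : U (s_ t) `^ (p - 1) = (U (s_ t) `^ (- (p - 1)))^-1.
    by rewrite powRN invrK.
  have En : expR (n * t) = expR (p * t) / expR ((p - n) * t).
    by rewrite -expRN -expRD; congr expR; ring.
  have sE : s_ t = c * (expR (p * t) / expR ((p - n) * t)) by rewrite /s_ En.
  rewrite /v.
  have X0 : 0 < U (s_ t) `^ (- (p - 1)) by exact: powR_gt0.
  move: (expR_gt0 (p * t)) (expR_gt0 ((p - n) * t)) => Ep0 E0.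
  set X := U _ `^ _ in X0 *; set Et := expR t; set Ep := expR (p * t) in Ep0 sE *.
  set E := expR _ in E0 sE *; set Us := U _ in Ut *; set Ws := W _.
  by rewrite sE; field; rewrite !gt_eqF.
have eC t : t <= T0 -> `|e t| <=
    (Cf + m) * (expR (p * t) + expR (be * (L t + k * t))).
  move=> tT; have Ut := U0 t tT.
  have Up : 0 < U (s_ t) `^ (p - 1) by exact: powR_gt0.
  rewrite /e normrM ger0_norm ?expR_ge0//.
  have -> : expR (be * (L t + k * t)) = expR (p * t) * U (s_ t) `^ (be).
    rewrite UL// -expRM -expRD; congr expR.
    by rewrite /be; field; rewrite gt_eqF.
  rewrite -{2}[expR (p * t)]mulr1 -mulrDr mulrCA ler_pM2l ?expR_gt0//.
  apply: (le_trans (ler_normB _ _)); rewrite (gtr0_norm m0) normrM normfV (gtr0_norm Up).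
  have -> : (Cf + m) * (1 + U (s_ t) `^ be) =
    Cf * (1 + U (s_ t) `^ be) + m + m * U (s_ t) `^ be by ring.
  apply: (@le_trans _ _ (Cf * (1 + U (s_ t) `^ be) + m)); last first.
    by rewrite lerDl mulr_ge0 ?powR_ge0// ltW.
  rewrite lerD2r ler_pdivrMr//; apply: (le_trans (fC _ Ut)).
  rewrite -[leRHS]mulrA ler_wpM2l// mulrDl mul1r -powRD ?(gt_eqF Ut) ?implybT//.
  have -> // : n * p / (n - p) - 1 = be + (p - 1).
  by rewrite /be /k; field; apply/andP; split; apply/eqP; lra.
have MN (B : R) : exists t0, forall t, t <= t0 -> L t + k * t < B.
  have B0 : 0 < expR (B - 1) by exact: expR_gt0.
  have [t1 Ht1] := decay _ B0.
  exists (Num.min T0 t1) => t; rewrite le_min => /andP[tT tt1].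
  have := Ht1 t tt1; rewrite UL// -expRD ler_expR; lra.
have [l Hl] := riccati_limit P1 K0 mu0 muk g1k g1r be0
  (ltac:(lra) : 0 <= Cf + m) dL dz eC MN.
exists (expR l); split; first exact: expR_gt0.
move=> eps eps0.
have /cvgrPdist_le/(_ eps eps0)[d /= d0 Hd] : {for l, continuous (@expR R)}.
  exact: continuous_expR.
have [t1 Ht1] := Hl (d / 2) (ltac:(lra)).
exists (Num.min T0 t1) => t; rewrite le_min => /andP[tT tt1].
rewrite UL// -expRD distrC; apply: Hd; rewrite /ball/= distrC.
by have := Ht1 t tt1; lra.
Qed.

End emden_fowler.

(** * Smooth functions of one variable *)

Section smooth_line.
Context {R : realType}.
Implicit Types (h g : R -> R) (k : nat).

Fixpoint Ck1 k h : Prop :=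
  continuous h /\
  if k is k'.+1 then (forall x : R, derivable h x 1) /\ Ck1 k' h^`()%classic else True.

Definition smooth1 h := forall k, Ck1 k h.

Lemma derive1_is h g : (forall x : R, is_derive x 1 h (g x)) -> h^`()%classic = g.
Proof. by move=> hg; apply/funext => x; rewrite derive1E; have [_ ->] := hg x. Qed.

Lemma Ck1S k h g : (forall x : R, is_derive x 1 h (g x)) -> Ck1 k g -> Ck1 k.+1 h.
Proof.
move=> hg Cg; split; first by move=> x; exact: derive_continuous (hg x).
by split; [move=> x; have [] := hg x|rewrite (derive1_is hg)].
Qed.

Lemma Ck1_continuous k h : Ck1 k h -> continuous h.
Proof. by case: k => [|k] []. Qed.

Lemma Ck1_is_derive k h : Ck1 k.+1 h -> forall x : R, is_derive x 1 h (h^`()%classic x).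
Proof. by move=> [_ [dh _]] x; rewrite derive1E; exact/derivableP. Qed.

Lemma Ck1_pred k h : Ck1 k.+1 h -> Ck1 k h.
Proof.
elim: k h => [|k IH] h; first by move=> [].
by move=> [ch [dh Ch]]; split => //; split => //; exact: IH.
Qed.

Lemma smooth1_is_derive h : smooth1 h -> forall x : R, is_derive x 1 h (h^`()%classic x).
Proof. by move=> sh; exact: Ck1_is_derive (sh 1%N). Qed.

Lemma smooth1_derive h : smooth1 h -> smooth1 h^`()%classic.
Proof. by move=> sh k; have [_ []] := sh k.+1. Qed.

Lemma smooth1_continuous h : smooth1 h -> continuous h.
Proof. by move=> sh; exact: Ck1_continuous (sh 0%N). Qed.

Lemma Ck1_cst k (c : R) : Ck1 k (fun=> c).
Proof.
elim: k c => [|k IH] c; first by split => //; exact: cst_continuous.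
by apply: (Ck1S (g := fun=> 0)) => // x; exact: isd_cst.
Qed.

Lemma Ck1D k h g : Ck1 k h -> Ck1 k g -> Ck1 k (fun x => h x + g x).
Proof.
elim: k h g => [|k IH] h g Ch Cg.
  by split => // x; apply: cvgD; [exact: (Ck1_continuous Ch)|exact: (Ck1_continuous Cg)].
apply: (Ck1S (g := fun x => h^`()%classic x + g^`()%classic x)).
  by move=> x; apply: isdD; [exact: Ck1_is_derive Ch x|exact: Ck1_is_derive Cg x].
by apply: IH; [have [_ []] := Ch|have [_ []] := Cg].
Qed.

Lemma Ck1M k h g : Ck1 k h -> Ck1 k g -> Ck1 k (fun x => h x * g x).
Proof.
elim: k h g => [|k IH] h g Ch Cg.
  by split => // x; apply: cvgM; [exact: (Ck1_continuous Ch)|exact: (Ck1_continuous Cg)].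
apply: (Ck1S (g := fun x => h x * g^`()%classic x + g x * h^`()%classic x)).
  by move=> x; apply: isdM; [exact: Ck1_is_derive Ch x|exact: Ck1_is_derive Cg x].
apply: Ck1D; apply: IH; do ?exact: Ck1_pred.
- by have [_ []] := Cg.
- by have [_ []] := Ch.
Qed.

Lemma Ck1Z k (c : R) h : Ck1 k h -> Ck1 k (fun x => c * h x).
Proof. by move=> Ch; apply: Ck1M => //; exact: Ck1_cst. Qed.

Lemma Ck1_affine k (a b : R) h : Ck1 k h -> Ck1 k (fun x => h (a * x + b)).
Proof.
elim: k h => [|k IH] h Ch.
  split => // x; apply: (@continuous_comp _ _ _ (fun x => a * x + b) h).
    apply: cvgD; last exact: cvg_cst.
    by apply: cvgM; [exact: cvg_cst|exact: cvg_id].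
  exact: Ck1_continuous Ch _.
apply: (Ck1S (g := fun x => a * h^`()%classic (a * x + b))).
  move=> x; rewrite mulrC; apply: (isd_comp (g := fun x => a * x + b)).
    exact: Ck1_is_derive Ch _.
  by apply: (isd_eq (isdD (isdZ a (isd_id x)) (isd_cst b x))); rewrite mulr1 addr0.
by apply: Ck1Z; apply: IH; have [_ []] := Ch.
Qed.

Lemma is_derive0_quadratic h (C : R) : h 0 = 0 ->
  (forall x, `|h x| <= C * x ^+ 2) -> is_derive (0 : R) 1 h 0.
Proof.
move=> h0 hC.
have H : (fun t => t^-1 *: (h (t *: (1 : R) + 0) - h 0)) @ 0^' --> (0 : R).
  apply/cvgrPdist_lt => e e0.
  have C0 : 0 <= C by have := hC 1; rewrite expr1n mulr1; have := normr_ge0 (h 1); lra.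
  exists (e / (C + 1)) => /=; first by rewrite divr_gt0//; lra.
  move=> t /=; rewrite sub0r normrN ltr_pdivlMr; last lra.
  move=> te t0; rewrite sub0r normrN h0 subr0 addr0 /GRing.scale/= mulr1 normrM normfV.
  rewrite ltr_pdivrMl ?normr_gt0//; apply: (le_lt_trans (hC t)).
  rewrite -(real_normK (num_real t)) expr2.
  have t0' : 0 < `|t| by rewrite normr_gt0.
  by nra.
split; first by apply/cvg_ex; exists 0.
by apply/cvg_lim => //; exact: Rhausdorff.
Qed.

(** The functions [t ^ (-n) * e ^ (-1/t)] are closed under differentiation, up
  to linear combinations; hence they are smooth at the origin too. *)
Definition flat (n : nat) (t : R) : R :=
  if 0 < t then t^-1 ^+ n * expR (- t^-1) else 0.

Lemma flat_quadratic n x : `|flat n x| <= n.+2`!%:R * x ^+ 2.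
Proof.
rewrite /flat; case: ifPn => [x0|_]; last by rewrite normr0 mulr_ge0 ?sqr_ge0.
have y0 : 0 < x^-1 by rewrite invr_gt0.
rewrite ger0_norm ?mulr_ge0 ?exprn_ge0 ?(ltW y0) ?expR_ge0//.
have [y yE] : {y | y = x^-1} by exists x^-1.
have xE : x = y^-1 by rewrite yE invrK.
have := expR_ge1Dxn n.+1 (ltW y0); rewrite -yE xE.
rewrite -{}yE in y0; move=> H; rewrite expRN exprVn.
rewrite ler_pdivrMr ?expR_gt0// mulrAC.
rewrite ler_pdivlMr ?exprn_gt0// -exprD addn2.
have f0 : (0 : R) < n.+2`!%:R by rewrite ltr0n fact_gt0.
rewrite mulrC -ler_pdivrMr//.
by apply: le_trans H; rewrite lerDr.
Qed.

Lemma is_derive_flat n (x : R) : is_derive x 1 (flat n)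
  (flat n.+2 x - n%:R * flat n.+1 x).
Proof.
have [x0|x0|->] := ltgtP x 0.
- have flat0 k t : t <= 0 -> flat k t = 0 by move=> t0; rewrite /flat ltNge t0.
  rewrite !flat0 ?(ltW x0)// mulr0 subr0.
  apply: (@near_eq_is_derive _ _ _ (fun=> 0 : R)).
  near=> t; rewrite flat0//; apply/ltW; near: t; exact: lt_nbhsl.
- apply: (@near_eq_is_derive _ _ _ (fun t : R => t^-1 ^+ n * expR (- t^-1))).
    near=> t; rewrite /flat ifT//; near: t; exact: lt_nbhsr.
  have dv : is_derive x 1 (fun t : R => t^-1) (- x ^- 2).
    have := is_derive1_powR (-1) x0; rewrite mulN1r.
    have -> : x `^ (-1 - 1) = x ^- 2.
      by rewrite (_ : -1 - 1 = - 2%:R)// ?powR_invn ?(ltW x0)//; lra.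
    apply: near_eq_is_derive; near=> t; rewrite powR_inv1// ltW//.
    near: t; exact: lt_nbhsr.
  have de : is_derive x 1 (fun t : R => expR (- t^-1)) (expR (- x^-1) * - - x ^- 2).
    by apply: (isd_comp (g := fun t => - t^-1)); exact: isdN.
  have dn : is_derive x 1 (fun t : R => t^-1 ^+ n) (n%:R * x^-1 ^+ n.-1 * - x ^- 2).
    have := is_deriveX n dv.
    by rewrite (_ : (fun t : R => t^-1) ^+ n = (fun t : R => t^-1 ^+ n))// exprfctE.
  apply: (isd_eq (isdM dn de)); rewrite /flat x0 opprK -!exprVn.
  by case: n {dn} => [|n] /=; rewrite ?mul0r ?expr0 ?mulr0 ?addr0 ?subr0 !exprS ?expr0; ring.
- rewrite [X in is_derive _ _ _ X](_ : _ = 0).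
    apply: (is_derive0_quadratic (C := n.+2`!%:R)); first by rewrite /flat ltxx.
    exact: flat_quadratic.
  by rewrite /flat ltxx mulr0 subr0.
Unshelve. all: by end_near. Qed.

Lemma smooth1_flat n : smooth1 (flat n).
Proof.
move=> k; elim: k n => [|k IH] n.
  split => // x; exact: derive_continuous (is_derive_flat n x).
apply: Ck1S; first exact: is_derive_flat.
apply: Ck1D => //; rewrite (_ : (fun _ => _) = (fun x => - n%:R * flat n.+1 x)).
  exact: Ck1Z.
by apply/funext => x; rewrite mulNr.
Qed.

End smooth_line.

(** * Smooth functions of several variables *)

Section smooth_space.
Context {R : realType} {n : nat}.
Implicit Types (f g phi psi : 'rV[R]_n -> R) (x v : 'rV[R]_n) (k : nat).
Local Notation e_ i := (delta_mx ord0 i : 'rV[R]_n).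

(** A directional derivative is a derivative along a line, so the calculus of
  one variable applies. *)
Lemma is_derive_slice (V : normedModType R) (f : V -> R) (x v : V) (d : R) :
  is_derive x v f d <-> is_derive (0 : R) 1 (fun t : R => f (t *: v + x)) d.
Proof.
have E : (fun h : R => h^-1 *: ((f \o shift x) (h *: v) - f x)) =
  (fun h : R => h^-1 *: (((fun t : R => f (t *: v + x)) \o shift 0) (h *: (1 : R))
     - (fun t : R => f (t *: v + x)) 0)).
  by apply/funext => h /=; rewrite scale0r add0r addr0 /GRing.scale/= mulr1.
split=> -[df <-]; split.
- by rewrite /derivable -E.
- by rewrite /derive -E.
- by rewrite /derivable E.
- by rewrite /derive E.
Qed.

Lemma isdvM f g x v (a b : R) : is_derive x v f a -> is_derive x v g b ->
  is_derive x v (fun y => f y * g y) (f x * b + g x * a).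
Proof. exact: is_deriveM. Qed.

Lemma isdvD f g x v (a b : R) : is_derive x v f a -> is_derive x v g b ->
  is_derive x v (fun y => f y + g y) (a + b).
Proof. exact: is_deriveD. Qed.

Lemma isdv_eq f x v (a b : R) : is_derive x v f a -> a = b -> is_derive x v f b.
Proof. by move=> fa <-. Qed.

Lemma isdv_comp (h : R -> R) f x v (a b : R) : is_derive (f x) 1 h a ->
  is_derive x v f b -> is_derive x v (fun y => h (f y)) (a * b).
Proof.
move=> ha /is_derive_slice fb; apply/is_derive_slice.
apply: (isd_comp (g := fun t => f (t *: v + x))) => //.
by rewrite scale0r add0r.
Qed.

Lemma isdv_coord x i j :
  is_derive x (e_ i) (fun y : 'rV[R]_n => y ord0 j) (i == j)%:R.
Proof.
apply/is_derive_slice.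
have := isdD (isdM (isd_id 0) (isd_cst (i == j)%:R 0)) (isd_cst (x ord0 j) 0).
rewrite mul0r mulr1 !add0r addr0 => H.
rewrite (_ : (fun t : R => _) = (fun t => t * (i == j)%:R + x ord0 j)).
  exact: H.
by apply/funext => t; rewrite !mxE eqxx eq_sym.
Qed.

Lemma partialE f g i : (forall x, is_derive x (e_ i) f (g x)) -> partial i f = g.
Proof. by move=> fg; apply/funext => x; rewrite /partial; have [_ ->] := fg x. Qed.

Lemma CkS k f : continuous f ->
  (forall i, exists g, (forall x, is_derive x (e_ i) f (g x)) /\ Ck k g) -> Ck k.+1 f.
Proof.
move=> cf H; split=> // i; have [g [fg Cg]] := H i.
split; first by move=> x; have [] := fg x.
by rewrite (partialE fg).
Qed.

Lemma Ck_continuous k f : Ck k f -> continuous f.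
Proof. by case: k => [|k] []. Qed.

Lemma Ck_is_derive k f i x : Ck k.+1 f -> is_derive x (e_ i) f (partial i f x).
Proof. by move=> [_ /(_ i)[df _]]; exact: derivableP. Qed.

Lemma Ck_partial k f i : Ck k.+1 f -> Ck k (partial i f).
Proof. by move=> [_ /(_ i)[_]]. Qed.

Lemma Ck_pred k f : Ck k.+1 f -> Ck k f.
Proof.
elim: k f => [|k IH] f; first by move=> [].
move=> [cf H]; split=> // i; split; first exact: (H i).1.
exact: IH (H i).2.
Qed.

Lemma Ck_cst k (c : R) : Ck k (fun _ : 'rV[R]_n => c).
Proof.
elim: k c => [|k IH] c; first by split => //; exact: cst_continuous.
apply: CkS; first exact: cst_continuous.
by move=> i; exists (fun=> 0); split => // x; exact: is_derive_cst.
Qed.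

Lemma CkD k f g : Ck k f -> Ck k g -> Ck k (fun x => f x + g x).
Proof.
elim: k f g => [|k IH] f g Cf Cg.
  by split => // x; have := cvgD (Ck_continuous Cf (x := x)) (Ck_continuous Cg (x := x)); exact.
apply: CkS.
  by move=> x; have := cvgD (Ck_continuous Cf (x := x)) (Ck_continuous Cg (x := x)); exact.
move=> i; exists (fun x => partial i f x + partial i g x); split.
  by move=> x; exact: (isdvD (Ck_is_derive i x Cf) (Ck_is_derive i x Cg)).
by apply: IH; exact: Ck_partial.
Qed.

Lemma CkM k f g : Ck k f -> Ck k g -> Ck k (fun x => f x * g x).
Proof.
elim: k f g => [|k IH] f g Cf Cg.
  by split => // x; have := cvgM (Ck_continuous Cf (x := x)) (Ck_continuous Cg (x := x)); exact.
apply: CkS.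
  by move=> x; have := cvgM (Ck_continuous Cf (x := x)) (Ck_continuous Cg (x := x)); exact.
move=> i; exists (fun x => f x * partial i g x + g x * partial i f x); split.
  by move=> x; exact: (isdvM (Ck_is_derive i x Cf) (Ck_is_derive i x Cg)).
by apply: CkD; apply: IH; do ?[exact: Ck_partial|exact: Ck_pred].
Qed.

Lemma Ck_comp1 k (h : R -> R) f : Ck1 k h -> Ck k f -> Ck k (fun x => h (f x)).
Proof.
elim: k h f => [|k IH] h f Ch Cf.
  split => // x; apply: (@continuous_comp _ _ _ f h); first exact: (Ck_continuous Cf).
  exact: Ck1_continuous Ch _.
apply: CkS.
  move=> x; apply: (@continuous_comp _ _ _ f h); first exact: (Ck_continuous Cf).
  exact: Ck1_continuous Ch _.
move=> i; exists (fun x => (h^`()%classic) (f x) * partial i f x); split.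
  by move=> x; exact: (isdv_comp (Ck1_is_derive Ch (f x)) (Ck_is_derive i x Cf)).
apply: CkM; last exact: Ck_partial.
by apply: IH; [have [_ []] := Ch|exact: Ck_pred].
Qed.

Lemma Ck_coord k j : Ck k (fun x : 'rV[R]_n => x ord0 j).
Proof.
case: k => [|k]; first by split => //; exact: coord_continuous.
apply: CkS; first exact: coord_continuous.
move=> i; exists (fun=> (i == j)%:R); split; last exact: Ck_cst.
by move=> x; exact: isdv_coord.
Qed.

Lemma Ck_sum k (I : Type) (s : seq I) (F : I -> 'rV[R]_n -> R) :
  (forall i, Ck k (F i)) -> Ck k (fun x => \sum_(i <- s) F i x).
Proof.
move=> CF; elim: s => [|a s IH].
  rewrite (_ : (fun _ => _) = (fun=> 0)); first exact: Ck_cst.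
  by apply/funext => x; rewrite big_nil.
rewrite (_ : (fun _ => _) = (fun x => F a x + \sum_(i <- s) F i x)).
  exact: CkD.
by apply/funext => x; rewrite big_cons.
Qed.

Lemma Ck_prod k (I : Type) (s : seq I) (F : I -> 'rV[R]_n -> R) :
  (forall i, Ck k (F i)) -> Ck k (fun x => \prod_(i <- s) F i x).
Proof.
move=> CF; elim: s => [|a s IH].
  rewrite (_ : (fun _ => _) = (fun=> 1)); first exact: Ck_cst.
  by apply/funext => x; rewrite big_nil.
rewrite (_ : (fun _ => _) = (fun x => F a x * \prod_(i <- s) F i x)).
  exact: CkM.
by apply/funext => x; rewrite big_cons.
Qed.

Definition sqn x : R := \sum_i x ord0 i ^+ 2.

Lemma sqn_ge0 x : 0 <= sqn x.
Proof. by apply: sumr_ge0 => i _; exact: sqr_ge0. Qed.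

Lemma Ck_sqn k : Ck k sqn.
Proof.
apply: Ck_sum => i; rewrite (_ : (fun _ => _) = (fun x => x ord0 i * x ord0 i)).
  by apply: CkM; exact: Ck_coord.
by apply/funext => x; rewrite expr2.
Qed.

Lemma isdv_sqn x i : is_derive x (e_ i) sqn (2 * x ord0 i).
Proof.
have := @is_derive_sum R _ _ n (fun j (y : 'rV[R]_n) => y ord0 j * y ord0 j) x (e_ i) _
  (fun j => isdvM (isdv_coord x i j) (isdv_coord x i j)).
rewrite (_ : \sum_(j < n) (fun y : 'rV[R]_n => y ord0 j * y ord0 j) = sqn); last first.
  by rewrite fct_sumE; apply/funext => y; apply: eq_bigr => j _; rewrite expr2.
move=> H; apply: (isdv_eq H).
rewrite (bigD1 i)//= eqxx mulr1 big1 ?addr0; first by rewrite mulrDl mul1r.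
by move=> j /negPf ji; rewrite eq_sym ji mulr0 addr0.
Qed.

End smooth_space.

Section radial_functions.
Context {R : realType} (n : nat) (c : R).
Hypotheses (n0 : (0 < n)%N) (c0 : 0 < c).
Implicit Types (z : R -> R) (x : 'rV[R]_n) (k : nat).
Local Notation e_ i := (delta_mx ord0 i : 'rV[R]_n).

(** With [c] the volume of the unit ball, the volume of the ball of radius
  [|x|]. Unlike the radius, it maps Lebesgue measure to Lebesgue measure. *)
Definition vol x : R := c * sqn x `^ (n%:R / 2).

(** Powers of the square of the norm are smooth only away from the origin, so
  the profile has to vanish near zero. *)
Definition pow_profile z (s : R) (y : R) : R :=
  if 0 < y then z (c * y `^ (n%:R / 2)) * y `^ s else 0.

Let th := n%:R / 2 : R.
Let th0 : 0 < th. Proof. by rewrite divr_gt0// ltr0n. Qed.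

Lemma pow_profile0 z a s : 0 < a -> (forall t, t <= a -> z t = 0) ->
  exists2 d, 0 < d & forall y, y <= d -> pow_profile z s y = 0.
Proof.
move=> a0 za; exists ((a / c) `^ th^-1); first by rewrite powR_gt0// divr_gt0.
move=> y yd; rewrite /pow_profile; case: ifPn => // y0; rewrite za ?mul0r//.
rewrite mulrC -ler_pdivlMr//.
have <- : ((a / c) `^ th^-1) `^ th = a / c.
  by rewrite -powRrM mulVf ?gt_eqF// powRr1// divr_ge0// ltW.
by apply: powR_le2r => //; exact: ltW.
Qed.

Lemma is_derive_pow_profile z (dz : R -> R) (a s y : R) : 0 < a ->
  (forall t, t <= a -> z t = 0) -> (forall t, t <= a -> dz t = 0) ->
  (forall t : R, is_derive t 1 z (dz t)) ->
  is_derive y 1 (pow_profile z s)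
    (c * th * pow_profile dz (th - 1 + s) y + s * pow_profile z (s - 1) y).
Proof.
move=> a0 za dza zd.
have [y0|y0] := ltP 0 y; last first.
  have [d d0 Hd] := pow_profile0 s a0 za.
  apply: (@isd_eq _ _ _ 0); last first.
    by rewrite /pow_profile ltNge y0/= !mulr0 addr0.
  apply: (@near_eq_is_derive _ _ _ (fun=> 0 : R)).
  by near=> t; rewrite Hd//; apply/ltW; near: t; apply: lt_nbhsl; exact: le_lt_trans d0.
apply: (@near_eq_is_derive _ _ _ (fun y : R => z (c * y `^ th) * y `^ s)).
  by near=> t; rewrite /pow_profile ifT//; near: t; exact: lt_nbhsr.
have H := isdM (isd_comp (g := fun y : R => c * y `^ th) (zd (c * y `^ th))
  (isdZ c (is_derive1_powR th y0))) (is_derive1_powR s y0).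
apply: (isd_eq H); rewrite /pow_profile y0 -/th.
by rewrite (@powRD _ y (th - 1) s) ?(gt_eqF y0) ?implybT//; ring.
Unshelve. all: by end_near. Qed.

Lemma near_eq_continuous (T : topologicalType) (f g : T -> R) (x : T) :
  (\forall y \near x, f y = g y) -> {for x, continuous f} -> {for x, continuous g}.
Proof.
move=> fg cf; rewrite /prop_for /continuous_at -(nbhs_singleton fg).
by apply: cvg_trans cf; apply: near_eq_cvg; apply: filterS fg.
Qed.

Lemma Ck1_vanish k z (a : R) : Ck1 k.+1 z -> (forall t, t <= a -> z t = 0) ->
  forall t, t < a -> (z^`()%classic) t = 0.
Proof.
move=> Cz za t ta; suff : is_derive t 1 z 0 by move=> [_ <-]; rewrite derive1E.
apply: (@near_eq_is_derive _ _ _ (fun=> 0 : R)).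
by near=> y; rewrite za//; apply/ltW; near: y; exact: lt_nbhsl.
Unshelve. all: by end_near. Qed.

Lemma Ck1_pow_profile k z a s : 0 < a -> (forall t, t <= a -> z t = 0) ->
  Ck1 k z -> Ck1 k (pow_profile z s).
Proof.
elim: k z a s => [|k IH] z a s a0 za Cz.
  have [d d0 Hd] := pow_profile0 s a0 za.
  split => // y; have [y0|y0] := ltP 0 y; last first.
    apply: (@near_eq_continuous _ (fun=> 0)); last exact: cst_continuous.
    by near=> t; rewrite Hd//; apply/ltW; near: t; apply: lt_nbhsl; exact: le_lt_trans d0.
  apply: (@near_eq_continuous _ (fun y : R => z (c * y `^ th) * y `^ s)).
    by near=> t; rewrite /pow_profile ifT//; near: t; exact: lt_nbhsr.
  have cp r : {for y, continuous (fun y : R => y `^ r)}.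
    exact: derive_continuous (is_derive1_powR r y0).
  apply: (@cvgM _ _ _ _ (fun y : R => z (c * y `^ th)) (fun y : R => y `^ s)); last exact: cp.
  apply: (@continuous_comp _ _ _ (fun y : R => c * y `^ th) z).
    by apply: cvgM; [exact: cvg_cst|exact: cp].
  exact: Ck1_continuous Cz _.
have a2 : 0 < a / 2 by rewrite divr_gt0.
have z2 t : t <= a / 2 -> z t = 0 by move=> ta; apply: za; lra.
have dz2 t : t <= a / 2 -> (z^`()%classic) t = 0.
  by move=> ta; apply: (Ck1_vanish Cz za); lra.
apply: Ck1S.
  by move=> y; exact: (is_derive_pow_profile s y a2 z2 dz2 (Ck1_is_derive Cz)).
apply: Ck1D; apply: Ck1Z.
  by apply: (IH _ _ _ a2 dz2); have [_ []] := Cz.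
by apply: (IH _ _ _ a0 za); exact: Ck1_pred.
Unshelve. all: by end_near. Qed.

Lemma vol_profile z x : z 0 = 0 -> z (vol x) = pow_profile z 0 (sqn x).
Proof.
move=> z0; rewrite /pow_profile /vol powRr0 mulr1; case: ifPn => //.
rewrite -leNgt => s0; have -> : sqn x = 0 by apply/le_anti; rewrite s0 sqn_ge0.
by rewrite powR0 ?gt_eqF// mulr0 z0.
Qed.

Lemma Ck_vol k z a : 0 < a -> (forall t, t <= a -> z t = 0) -> Ck1 k z ->
  Ck k (fun x => z (vol x)).
Proof.
move=> a0 za Cz; have z0 : z 0 = 0 by rewrite za// ltW.
rewrite (_ : (fun _ => _) = (fun x => pow_profile z 0 (sqn x))).
  by apply: Ck_comp1; [exact: Ck1_pow_profile a0 za Cz|exact: Ck_sqn].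
by apply/funext => x; exact: vol_profile.
Qed.

Definition grad_vol x (i : 'I_n) : R := n%:R * vol x / sqn x * x ord0 i.

Lemma isdv_vol z a i x : 0 < a -> (forall t, t <= a -> z t = 0) -> Ck1 1 z ->
  is_derive x (e_ i) (fun x => z (vol x)) ((z^`()%classic) (vol x) * grad_vol x i).
Proof.
move=> a0 za Cz; have z0 : z 0 = 0 by rewrite za// ltW.
have a2 : 0 < a / 2 by rewrite divr_gt0.
have z2 t : t <= a / 2 -> z t = 0 by move=> ta; apply: za; lra.
have dz2 t : t <= a / 2 -> (z^`()%classic) t = 0.
  by move=> ta; apply: (Ck1_vanish Cz za); lra.
rewrite (_ : (fun _ => _) = (fun x => pow_profile z 0 (sqn x))); last first.
  by apply/funext => y; exact: vol_profile.
have H := isdv_comp (is_derive_pow_profile 0 (sqn x) a2 z2 dz2 (Ck1_is_derive Cz))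
  (isdv_sqn x i).
apply: (isdv_eq H); rewrite mul0r addr0 /pow_profile; case: ifPn => [s0|s0].
  rewrite addr0 /grad_vol /vol -/th powRB ?(gt_eqF s0) ?implybT// powRr1 ?(ltW s0)//.
  have -> : n%:R = 2 * th by rewrite /th mulrC divfK.
  by field; rewrite gt_eqF.
rewrite mulr0 mul0r /grad_vol.
have -> : sqn x = 0 by apply/le_anti; rewrite leNgt s0 sqn_ge0.
by rewrite invr0 mulr0 mul0r mulr0.
Qed.

End radial_functions.

(** * Borel sets and Lebesgue measure of the Euclidean space *)

Section borel_rV.
Context {R : realType} {n : nat}.
Implicit Types (x v : 'rV[R]_n) (a b : 'I_n -> R).

Definition box a b : set 'rV[R]_n := [set v | forall i, a i <= v ord0 i <= b i].

Lemma ball_rVP x v (e : R) : 0 < e -> (forall i, `|x ord0 i - v ord0 i| < e) ->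
  ball x e v.
Proof. by move=> e0 H; split=> // i j; rewrite (ord1 i); exact: H. Qed.

(** The boxes with rational centres and radii [1 / k] form a countable base of
  the topology. *)
Lemma open_measurable_rV (O : set 'rV[R]_n) : open O -> measurable O.
Proof.
move=> oO.
pose B (q : {ffun 'I_n -> rat}) (k : nat) : set 'rV[R]_n :=
  box (fun i => ratr (q i) - k.+1%:R^-1) (fun i => ratr (q i) + k.+1%:R^-1).
pose F m : set 'rV[R]_n := if (unpickle m : option ({ffun 'I_n -> rat} * nat)) is Some qk then
  if `[< B qk.1 qk.2 `<=` O >] then B qk.1 qk.2 else set0 else set0.
suff -> : O = \bigcup_m F m.
  apply: bigcupT_measurable => m; rewrite /F; case: unpickle => [[q k]|]; last exact: measurable0.
  by case: asboolP => _; [exact: measurable_box|exact: measurable0].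
apply/seteqP; split=> [x Ox|x [m _]]; last first.
  rewrite /F; case: unpickle => [[q k]|]//=.
  by case: asboolP => // BO /BO.
have /nbhs_ballP[e /= e0 xeO] : nbhs x O by exact: open_nbhs_nbhs.
have e2 : 0 < e / 2 by lra.
have [k _ Hk] := near_infty_natSinv_lt (PosNum e2).
have {}Hk : (k.+1%:R : R)^-1 < e / 2 by exact: (Hk k (leqnn k)).
have k0 : (0 : R) < k.+1%:R^-1 by rewrite invr_gt0.
have Hq i : exists q : rat, (ratr q : R) \in `]x ord0 i - k.+1%:R^-1, x ord0 i + k.+1%:R^-1[.
  by apply: rat_in_itvoo; rewrite ltrD2l; apply: lt_trans k0; rewrite oppr_lt0.
have [q qP] := choice Hq.
exists (pickle ([ffun i => q i], k)) => //; rewrite /F pickleK /=.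
case: asboolP => [_ i|]; last first.
  case; apply: subset_trans xeO => v vB; apply: ball_rVP => // i.
  have := vB i; have := qP i; rewrite ffunE in_itv/= ltr_norml.
  by move: (k.+1%:R^-1 : R) Hk => d; lra.
have := qP i; rewrite ffunE in_itv/=.
by move: (k.+1%:R^-1 : R) Hk => d; lra.
Qed.

Lemma continuous_measurable_rV (f : 'rV[R]_n -> R) :
  continuous f -> measurable_fun [set: 'rV[R]_n] f.
Proof.
move=> /continuousP cf; apply: (measurability _ (measurable_realfun.RGenOInfty.measurableE R)).
move=> _ [_ [r ->] <-]; rewrite setTI; apply: open_measurable_rV; apply: cf.
exact: interval_open.
Qed.

Definition boxes : set (set 'rV[R]_n) := [set box ab.1 ab.2 | ab in [set: ('I_n -> R) * ('I_n -> R)]].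

Lemma boxesI : setI_closed boxes.
Proof.
move=> _ _ [[a b] _ <-] [[a' b'] _ <-] /=.
exists ((fun i => Num.max (a i) (a' i)), (fun i => Num.min (b i) (b' i))) => //=.
apply/seteqP; split=> [v H|v [H H'] i].
  by split=> i; have := H i; rewrite ge_max le_min => /andP[/andP[? ?] /andP[? ?]]; apply/andP.
have /andP[? ?] := H i; have /andP[? ?] := H' i.
by rewrite ge_max le_min; apply/andP; split; apply/andP.
Qed.

Lemma measurable_boxesE : @measurable _ 'rV[R]_n = <<s boxes >>.
Proof.
apply/seteqP; split; last first.
  apply: smallest_sub; first exact: sigma_algebra_measurable.
  by move=> _ [[a b] _ <-]; exact: measurable_box.
apply: smallest_sub; first exact: smallest_sigma_algebra.
rewrite -bigcup_seq => A [i _ [B mB <-]]; rewrite setTI.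
pose T := g_sigma_algebraType boxes.
have H : measurable_fun [set: T] (fun v : T => (v : 'rV[R]_n) ord0 i).
  apply: (measurability _ (measurable_realfun.RGenCInfty.measurableE R)).
  move=> _ [_ [r ->] <-]; rewrite setTI.
  rewrite (_ : _ @^-1` _ = \bigcup_k box (fun j => if j == i then r else - k%:R) (fun _ => k%:R)).
    by apply: bigcupT_measurable => k; apply: sub_sigma_algebra; eexists (_, _).
  apply/seteqP; split=> [v /=|v [k _ /(_ i)]].
    rewrite in_itv/= andbT => rv.
    have [k kv] : exists k : nat, forall j, `|v ord0 j| <= k%:R.
      exists (Num.truncn (\sum_j `|v ord0 j|)).+1 => j.
      apply: (@le_trans _ _ (\sum_j `|v ord0 j|)); last by apply/ltW; rewrite truncnS_gt.
      by rewrite (bigD1 j)//= lerDl sumr_ge0.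
    exists k => // j; have := kv j; rewrite ler_norml.
    by case: eqVneq => [->|_]; lra.
  by rewrite eqxx /= in_itv/= andbT => /andP[].
by have := H measurableT B mB; rewrite setTI.
Qed.

Lemma box_cover : \bigcup_k box (fun=> - k%:R) (fun=> k%:R) = [set: 'rV[R]_n].
Proof.
apply/seteqP; split=> // v _.
exists (Num.truncn (\sum_j `|v ord0 j|)).+1 => // j.
have : `|v ord0 j| <= (Num.truncn (\sum_j `|v ord0 j|)).+1%:R.
  apply: (@le_trans _ _ (\sum_j `|v ord0 j|)); last by apply/ltW; rewrite truncnS_gt.
  by rewrite (bigD1 j)//= lerDl sumr_ge0.
by rewrite ler_norml.
Qed.

Lemma box_empty a b i : b i < a i -> box a b = set0.
Proof. by move=> ab; apply/seteqP; split=> // v /(_ i); lra. Qed.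

End borel_rV.

(** [pushforward] as a measure, and not only as a set function. *)
Definition image_measure d d' (T1 : measurableType d) (T2 : measurableType d')
  (R : realType) (m : {measure set T1 -> \bar R}) (f : T1 -> T2)
  (mf : measurable_fun setT f) : {measure set T2 -> \bar R} :=
  measure_function_pushforward__canonical__measure_function_Measure m mf.

Section scaling.
Context {R : realType} {n : nat}.
Local Notation leb := (lebesgue_rV R n).

Lemma measurable_scale (t : R) :
  measurable_fun [set: 'rV[R]_n] (fun x : 'rV[R]_n => t *: x).
Proof.
apply: measurable_fun_rV => i.
rewrite (_ : (fun _ => _) = (fun x : 'rV[R]_n => t * x ord0 i)); last first.
  by apply/funext => x; rewrite mxE.
by apply: measurable_funM; [exact: measurable_cst|exact: measurable_coord].
Qed.

(** Both sides are measures in [A] that agree on the boxes. *)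
Lemma lebesgue_rV_scale (t : R) (A : set 'rV[R]_n) : 0 < t -> measurable A ->
  leb [set x | A (t^-1 *: x)] = ((t ^+ n)%:E * leb A)%E.
Proof.
move=> t0 mA.
have tn : 0 <= t ^+ n by rewrite exprn_ge0// ltW.
pose m1 := image_measure leb (measurable_scale t^-1).
pose m2 : {measure set 'rV[R]_n -> \bar R} := mscale (NngNum tn) leb.
have m12 B : boxes B -> m1 B = m2 B.
  move=> [[a b] _ <-] /=.
  have preb : [set x | box a b (t^-1 *: x)] = box (fun i => t * a i) (fun i => t * b i).
    have sc (x w y : R) : (x <= t^-1 * w <= y) = (t * x <= w <= t * y).
      by rewrite -(ler_pM2l t0 x) -(ler_pM2l t0 _ y) mulVKf// gt_eqF.
    by apply/seteqP; split=> v H i; have := H i; rewrite mxE sc.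
  have -> : m1 (box a b) = leb [set x | box a b (t^-1 *: x)] by [].
  rewrite preb /m2/= /mscale/=.
  have [[i abi]|ab] := pselect (exists i, b i < a i).
    rewrite !(@box_empty _ _ _ _ i)//; first by rewrite !measure0 mule0.
    by rewrite ltr_pM2l.
  have {}ab i : a i <= b i by rewrite leNgt; apply/negP => abi; apply: ab; exists i.
  rewrite !lebesgue_rV_box//; last by move=> i; rewrite ler_pM2l.
  rewrite -EFinM; congr EFin.
  under eq_bigr do rewrite -mulrBr.
  by rewrite big_split/= prodr_const card_ord.
have -> : leb [set x | A (t^-1 *: x)] = m1 A by [].
have -> : ((t ^+ n)%:E * leb A)%E = m2 A by [].
apply: (@measure_unique _ _ _ boxes (fun k => box (fun=> - k%:R) (fun=> k%:R))) => //.
- exact: measurable_boxesE.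
- exact: boxesI.
- by move=> k; eexists (_, _).
- exact: box_cover.
- move=> k; rewrite m12; last by eexists (_, _).
  rewrite /m2/= /mscale/= lebesgue_rV_box; last by move=> i; have := ler0n R k; lra.
  by rewrite -EFinM ltry.
Qed.

End scaling.

(** * The volume of balls as a radial variable *)

Section polar.
Context {R : realType} (n : nat).
Hypothesis n0 : (0 < n)%N.
Local Notation leb := (lebesgue_rV R n).

Lemma measurable_sqn : measurable_fun [set: 'rV[R]_n] sqn.
Proof. by apply: continuous_measurable_rV; exact: Ck_continuous (Ck_sqn 0). Qed.

Lemma measurable_sqn_le (r : R) : measurable [set x : 'rV[R]_n | sqn x <= r].
Proof.
rewrite (_ : [set _ | _] = [set: 'rV[R]_n] `&` sqn @^-1` `]-oo, r]%classic).
  by apply: measurable_sqn => //; exact: measurable_itv.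
by rewrite setTI; apply/seteqP; split=> x /=; rewrite in_itv.
Qed.

Lemma coord_sqn (x : 'rV[R]_n) i : x ord0 i ^+ 2 <= sqn x.
Proof. by rewrite /sqn (bigD1 i)//= lerDl sumr_ge0// => j _; exact: sqr_ge0. Qed.

Definition unit_vol : R := fine (leb [set x | sqn x <= 1]).

Lemma unit_ball_lty : (leb [set x | (sqn x <= 1)%R] < +oo)%E.
Proof.
apply: (@le_lt_trans _ _ (leb (box (fun=> -1) (fun=> 1)))); last first.
  by rewrite lebesgue_rV_box ?ltry//; lra.
apply: le_measure; rewrite ?inE; [exact: measurable_sqn_le|exact: measurable_box|].
move=> x /= x1 i; have := coord_sqn x i => H.
have : x ord0 i ^+ 2 <= 1 by lra.
rewrite -ler_norml => H1; rewrite -(@ler_pXn2r _ 2)// ?nnegrE//.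
by rewrite real_normK ?num_real// expr1n.
Qed.

Lemma unit_volE : leb [set x | (sqn x <= 1)%R] = unit_vol%:E.
Proof. by rewrite fineK// ge0_fin_numE ?measure_ge0// unit_ball_lty. Qed.

Lemma unit_vol_gt0 : 0 < unit_vol.
Proof.
have n1 : (0 : R) < n%:R by rewrite ltr0n.
suff : (0 < leb [set x | (sqn x <= 1)%R])%E by rewrite unit_volE lte_fin.
apply: (@lt_le_trans _ _ (leb (box (fun=> - n%:R^-1) (fun=> n%:R^-1)))).
  have ni : (0 : R) < n%:R^-1 by rewrite invr_gt0.
  rewrite lebesgue_rV_box; last by move=> i; lra.
  by rewrite lte_fin prodr_gt0// => i _; lra.
apply: le_measure; rewrite ?inE; [exact: measurable_box|exact: measurable_sqn_le|].
move=> x xB /=; apply: (@le_trans _ _ (\sum_(i < n) n%:R^-1)); last first.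
  by rewrite sumr_const card_ord -[X in X <= _]mulr_natr mulVf ?gt_eqF.
apply: ler_sum => i _.
have ni : n%:R^-1 <= 1 :> R by rewrite invf_le1// ler1n.
have H : `|x ord0 i| <= n%:R^-1 by rewrite ler_norml; exact: xB.
rewrite -real_normK ?num_real// expr2.
apply: (@le_trans _ _ (1 * n%:R^-1)); last by rewrite mul1r.
by apply: ler_pM => //; exact: le_trans H ni.
Qed.

Lemma leb_ball (t : R) : 0 < t ->
  leb [set x | (sqn x <= t ^+ 2)%R] = (t ^+ n * unit_vol)%:E.
Proof.
move=> t0; rewrite EFinM -unit_volE -(lebesgue_rV_scale t0 (measurable_sqn_le 1)).
congr (leb _); apply/seteqP; split=> x /=; rewrite /sqn;
  under [X in _ -> X <= _]eq_bigr do rewrite ?mxE ?exprMn;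
  under [X in X <= _ -> _]eq_bigr do rewrite ?mxE ?exprMn;
  by rewrite -mulr_sumr exprVn ler_pdivrMl ?exprn_gt0// mulr1.
Qed.

Local Notation rho := (@vol R n unit_vol).

Lemma vol_ge0 (x : 'rV[R]_n) : 0 <= rho x.
Proof. by rewrite mulr_ge0 ?powR_ge0// ltW// unit_vol_gt0. Qed.

Lemma measurable_vol : measurable_fun [set: 'rV[R]_n] rho.
Proof.
apply: measurable_funM; first exact: measurable_cst.
by apply: (measurableT_comp (measurable_powR _)); exact: measurable_sqn.
Qed.

Lemma measurable_vol_le (b : R) : measurable [set x | rho x <= b].
Proof.
rewrite (_ : [set _ | _] = [set: 'rV[R]_n] `&` rho @^-1` `]-oo, b]%classic).
  by apply: measurable_vol => //; exact: measurable_itv.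
by rewrite setTI; apply/seteqP; split=> x /=; rewrite in_itv.
Qed.

Lemma leb_vol_le (b : R) : 0 <= b -> leb [set x | (rho x <= b)%R] = b%:E.
Proof.
have c0 := unit_vol_gt0; have n1 : (0 : R) < n%:R by rewrite ltr0n.
rewrite le_eqVlt => /predU1P[<-|b0].
  apply/eqP; rewrite eq_le measure_ge0 andbT.
  apply: (@le_trans _ _ (leb (box (fun=> 0) (fun=> 0)))); last first.
    rewrite lebesgue_rV_box// lee_fin; under eq_bigr do rewrite subrr.
    by rewrite prodr_const card_ord expr0n; case: n n0.
  apply: le_measure; rewrite ?inE//; [exact: measurable_vol_le|exact: measurable_box|].
  move=> x /= x0 i.
  have : sqn x `^ (n%:R / 2) = 0.
    by apply/le_anti; rewrite powR_ge0 andbT -(ler_pM2l c0) mulr0.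
  move=> /powR_eq0_eq0 s0; have := coord_sqn x i; rewrite s0 => xi.
  have : x ord0 i ^+ 2 == 0 by rewrite eq_le xi sqr_ge0.
  by rewrite expf_eq0/= => /eqP ->; rewrite lexx.
have h0 : 0 < n%:R / 2 :> R by rewrite divr_gt0.
pose t := (b / unit_vol) `^ n%:R^-1.
have bc : 0 < b / unit_vol by rewrite divr_gt0.
have t0 : 0 < t by rewrite powR_gt0.
have tn : t ^+ n = b / unit_vol.
  by rewrite -powR_mulrn ?(ltW t0)// /t -powRrM mulVf ?gt_eqF// powRr1// ltW.
have t2n : (t ^+ 2) `^ (n%:R / 2) = b / unit_vol.
  by rewrite -tn -powR_mulrn ?(ltW t0)// -powRrM mulrC divfK// powR_mulrn// ltW.
have -> : [set x | rho x <= b] = [set x | sqn x <= t ^+ 2].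
  apply/seteqP; split=> x /=; rewrite /vol mulrC -ler_pdivlMr// -t2n => H.
    rewrite leNgt; apply/negP => tx; have := powR_lt2r h0 (sqr_ge0 t) tx.
    by rewrite ltNge H.
  by apply: powR_le2r => //; rewrite ?sqn_ge0// ltW.
by rewrite leb_ball// tn divfK// gt_eqF.
Qed.

Let D : set (measurableTypeR R) := `[0, +oo[%classic.

(** By scaling, the set where [rho <= b] has measure [b]; both sides thus
  agree on the half-open intervals. *)
Lemma image_vol (A : set (measurableTypeR R)) : measurable A -> A `<=` D ->
  pushforward leb rho A = lebesgue_measure A.
Proof.
move=> mA AD.
have mN : measurable (`]-oo, 0[%classic : set (measurableTypeR R)) by exact: measurable_itv.
pose mu1 := @image_measure _ _ _ (measurableTypeR R) _ leb _ measurable_vol.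
pose mu2 : {measure set (measurableTypeR R) -> \bar R} := mrestr lebesgue_measure mN.
suff H B : measurable B -> lebesgue_measure B = measure_add mu1 mu2 B.
  rewrite H// measure_addE /mu2/= /mrestr.
  rewrite (_ : A `&` _ = set0) ?measure0 ?adde0//.
  apply/seteqP; split=> // x [/AD + /=]; rewrite /D/= !in_itv/= andbT => x0.
  by rewrite ltNge x0.
apply: (@lebesgue_measure_unique _ (measure_add mu1 mu2)) => _ [[a b] ab <-].
have [{}ab|ba] := leP a b; last first.
  rewrite (_ : [set` _] = set0) ?measure0//.
  by apply/seteqP; split=> // x /=; rewrite in_itv/=; lra.
suff addE : lebesgue_measure `]a, b]%classic = (mu1 `]a, b]%classic + mu2 `]a, b]%classic)%E.
  by rewrite [LHS]addE; exact: esym (measure_addE mu1 mu2 _).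
have -> : mu1 `]a, b]%classic = leb [set x | a < rho x <= b] by congr (leb _); apply/seteqP; split=> x /=; rewrite in_itv.
have -> : mu2 `]a, b]%classic = lebesgue_measure (`]a, b]%classic `&` `]-oo, 0[%classic) by [].
have mleb : forall r s : R, 0 <= r -> r <= s ->
    leb [set x | (r < rho x <= s)%R] = (s - r)%:E.
  move=> r s r0 rs.
  have -> : [set x | r < rho x <= s] = [set x | rho x <= s] `\` [set x | rho x <= r].
    apply/seteqP; split=> x /=; first by move=> /andP[rx xs]; split=> //; apply/negP; rewrite -ltNge.
    by move=> [xs /negP]; rewrite -ltNge => ->.
  rewrite measureD//; [|exact: measurable_vol_le|exact: measurable_vol_le|].
    rewrite (_ : _ `&` _ = [set x | rho x <= r]); last first.
      by apply/seteqP; split=> x /=; [move=> []|move=> xr; split=> //; exact: le_trans rs].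
    transitivity (s%:E - r%:E)%E; last by rewrite EFinB.
    by congr (_ - _)%E; apply: leb_vol_le => //; lra.
  apply: le_lt_trans (ltry s); rewrite le_eqVlt; apply/orP; left; apply/eqP.
  by apply: leb_vol_le; lra.
have [a0|a0] := leP 0 a.
  rewrite mleb// lebesgue_measure_itv/= lte_fin.
  rewrite (_ : _ `&` _ = set0) ?measure0 ?adde0.
    case: ltP => [_|ba]; first by rewrite EFinB.
    have -> : b = a by apply/le_anti; rewrite ba ab.
    by rewrite subrr.
  by apply/seteqP; split=> // x []/=; rewrite !in_itv/=; lra.
have [b0|b0] := leP 0 b.
  have -> : [set x | a < rho x <= b] = [set x | rho x <= b].
    by apply/seteqP; split=> x /=; [move=> /andP[]|move=> ->; rewrite (lt_le_trans a0)// vol_ge0].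
  rewrite leb_vol_le// (_ : _ `&` _ = `]a, 0[%classic).
    rewrite !lebesgue_measure_itv/= !lte_fin a0 ifT; last lra.
    by rewrite -!EFinB -EFinD; congr EFin; lra.
  by apply/seteqP; split=> x /=; rewrite !in_itv/=; lra.
have -> : [set x | a < rho x <= b] = set0.
  by apply/seteqP; split=> // x /=; have := vol_ge0 x; lra.
rewrite measure0 add0e (_ : _ `&` _ = `]a, b]%classic)//.
by apply/seteqP; split=> x /=; rewrite !in_itv/=; lra.
Qed.

Lemma ge0_integral_vol (E : set (measurableTypeR R)) (g : R -> \bar R) :
  measurable E -> E `<=` D -> measurable_fun E g -> (forall s, E s -> (0 <= g s)%E) ->
  (\int[leb]_(x in rho @^-1` E) g (rho x) = \int[lebesgue_measure]_(s in E) g s)%E.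
Proof.
move=> mE ED mg g0.
have g0' : {in E, forall y, (0 <= g y)%E} by move=> y; rewrite inE; exact: g0.
rewrite -[LHS](@ge0_integral_pushforward _ _ _ (measurableTypeR R) _ _ measurable_vol
  leb E g mE mg g0').
apply: (@eq_measure_integral _ (measurableTypeR R) _ E lebesgue_measure
  (@image_measure _ _ _ (measurableTypeR R) _ leb _ measurable_vol)).
move=> A mA AE; apply: image_vol => //; exact: subset_trans ED.
Qed.

Lemma integrable_vol (E : set (measurableTypeR R)) (g : R -> \bar R) :
  measurable E -> E `<=` D -> lebesgue_measure.-integrable E g ->
  leb.-integrable (rho @^-1` E) (g \o rho).
Proof.
move=> mE ED /integrableP[mg ig]; apply/integrableP; split.
  apply: measurable_comp mg _ => //.
    by move=> _ [x Ex <-].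
  exact: measurable_funTS measurable_vol.
by rewrite (ge0_integral_vol (g := fun s => `|g s|%E))//; exact: measurableT_comp.
Qed.

Lemma integral_vol (E : set (measurableTypeR R)) (g : R -> \bar R) :
  measurable E -> E `<=` D -> lebesgue_measure.-integrable E g ->
  (\int[leb]_(x in rho @^-1` E) g (rho x) = \int[lebesgue_measure]_(s in E) g s)%E.
Proof.
move=> mE ED ig; have [mg _] := integrableP _ _ _ ig.
rewrite integralE [RHS]integralE; congr (_ - _)%E.
  have H := @ge0_integral_vol E (g^\+)%E mE ED (measurable_funepos mg)
    (fun s _ => funepos_ge0 g s).
  by apply: etrans H; apply: eq_integral => x _; rewrite !funeposE.
have H := @ge0_integral_vol E (g^\-)%E mE ED (measurable_funeneg mg)
  (fun s _ => funeneg_ge0 g s).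
by apply: etrans H; apply: eq_integral => x _; rewrite !funenegE.
Qed.

End polar.

(** * Integration by parts for compactly supported functions *)

Section bounded_support.
Context {R : realType} {n : nat}.
Local Notation leb := (lebesgue_rV R n).
Local Notation cube M := (box (fun=> - M : R) (fun=> M) : set 'rV[R]_n).

(** The functions by which a locally integrable function can be multiplied to
  become integrable. *)
Definition bsupp (f : 'rV[R]_n -> R) (M K : R) :=
  [/\ measurable_fun [set: 'rV[R]_n] f, forall x, `|f x| <= K &
      forall x, ~ cube M x -> f x = 0].

Lemma leb_cube_lty (M : R) : (leb (cube M) < +oo)%E.
Proof.
have [M0|M0] := leP 0 M; first by rewrite lebesgue_rV_box ?ltry// => i; lra.
apply: (@le_lt_trans _ _ (leb (cube 0))); last by rewrite lebesgue_rV_box ?ltry// => i; lra.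
apply: le_measure; rewrite ?inE; [exact: measurable_box|exact: measurable_box|].
by move=> x xM i; have := xM i; lra.
Qed.

Lemma bsupp_restrict f M K : bsupp f M K -> EFin \o f = (EFin \o f) \_ (cube M).
Proof.
move=> [_ _ f0]; apply/funext => x; rewrite patchE; case: ifPn => //= /negP xM.
by rewrite f0// => ?; apply: xM; rewrite inE.
Qed.

Lemma bsupp_integrable f M K : bsupp f M K -> leb.-integrable setT (EFin \o f).
Proof.
move=> H; rewrite (bsupp_restrict H); have [mf fK _] := H.
apply/(integrable_mkcond _ (measurable_box _ _)).
apply: measurable_bounded_integrable; [exact: measurable_box|exact: leb_cube_lty| |].
  exact: measurable_funTS.
exists K; split; first exact: num_real.
by move=> y Ky x _ /=; apply: le_trans (fK x) _; exact: ltW.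
Qed.

Lemma bsupp_mul_integrable (h f : 'rV[R]_n -> R) M K :
  leb.-integrable (cube M) (EFin \o h) -> bsupp f M K ->
  leb.-integrable setT (fun x => (h x * f x)%:E).
Proof.
move=> ih H; have [mf fK f0] := H.
rewrite (_ : (fun _ => _) = (fun x => (h x * f x)%:E) \_ (cube M)); last first.
  apply/funext => x; rewrite patchE; case: ifPn => //= /negP xM.
  by rewrite f0 ?mulr0// => ?; apply: xM; rewrite inE.
apply/(integrable_mkcond _ (measurable_box _ _)).
have := integrableMl (measurable_box _ _) ih (measurable_funTS mf).
apply; exists K; split; first exact: num_real.
by move=> y Ky x _ /=; apply: le_trans (fK x) _; exact: ltW.
Qed.

Lemma compact_cube (M : R) : compact (cube M).
Proof.
have := @rV_compact _ n (fun=> `[- M, M]%classic) (fun=> @segment_compact R (- M) M).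
by congr compact; apply/seteqP; split=> x H i; have := H i; rewrite /= in_itv.
Qed.

Lemma continuous_bsupp (f : 'rV[R]_n -> R) M : continuous f ->
  (forall x, ~ cube M x -> f x = 0) -> exists K, bsupp f M K.
Proof.
move=> cf f0.
have [K [_ HK]] : bounded_set (f @` cube M).
  apply: compact_bounded; apply: continuous_compact; last exact: compact_cube.
  exact: continuous_subspaceT.
exists (`|K| + 1); split=> //; first exact: continuous_measurable_rV.
move=> x; have [xM|xM] := pselect (cube M x).
  by apply: HK; [rewrite (le_lt_trans (ler_norm _))// ltrDl|exists x].
by rewrite f0// normr0 addr_ge0.
Qed.

Lemma cube_open_compl (M : R) : open (~` cube M).
Proof.
rewrite openC; apply: compact_closed; last exact: compact_cube.
exact: norm_hausdorff.
Qed.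

Lemma partial_support (f : 'rV[R]_n -> R) i M :
  (forall x, ~ cube M x -> f x = 0) -> forall x, ~ cube M x -> partial i f x = 0.
Proof.
move=> f0 x xM; rewrite /partial.
rewrite (@near_eq_derive _ _ _ f (fun=> 0)); first exact: derive_cst.
have : nbhs x (~` cube M) by apply: open_nbhs_nbhs; split=> //; exact: cube_open_compl.
by apply: filterS => y /f0.
Qed.

End bounded_support.
Arguments bsupp {R n}.
Notation cube M := (box (fun=> - M) (fun=> M)).

Section divergence.
Context {R : realType}.
Local Notation lam := (@lebesgue_measure R).

Lemma rV_cons_continuousr n (t : R) :
  continuous (fun v : 'rV[R]_n => rV_cons (t, v) : 'rV[R]_n.+1).
Proof.
move=> v A /nbhs_ballP[e /= e0 eA].
have : nbhs v (ball v e) by exact: nbhsx_ballx.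
apply: filterS => w [_ vw]; apply: eA; apply: ball_rVP => // i.
case: (unliftP ord0 i) => [j|] ->; last by rewrite !rV_cons0 subrr normr0.
by rewrite !rV_consS; exact: vw.
Qed.

Lemma rV_cons_continuousl n (v : 'rV[R]_n) :
  continuous (fun t : R => rV_cons (t, v) : 'rV[R]_n.+1).
Proof.
move=> t A /nbhs_ballP[e /= e0 eA].
have : nbhs t (ball t e) by exact: nbhsx_ballx.
apply: filterS => w tw; apply: eA; apply: ball_rVP => // i.
case: (unliftP ord0 i) => [j|] ->; last by rewrite !rV_cons0.
by rewrite !rV_consS /= subrr normr0.
Qed.

Lemma shift_rVE n (h : R) (k i : 'I_n) (v : 'rV[R]_n) :
  (h *: delta_mx ord0 k + v) ord0 i = h * (i == k)%:R + v ord0 i.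
Proof. by rewrite !mxE eqxx. Qed.

Lemma rV_cons_shift0 n (h t : R) (v : 'rV[R]_n) :
  h *: delta_mx ord0 ord0 + rV_cons (t, v) = rV_cons (h + t, v) :> 'rV[R]_n.+1.
Proof.
apply/rowP => i; rewrite shift_rVE; case: (unliftP ord0 i) => [j|] ->.
  by rewrite !rV_consS/= mulr0 add0r.
by rewrite !rV_cons0/= mulr1.
Qed.

Lemma rV_cons_shiftS n (h t : R) (v : 'rV[R]_n) j :
  h *: delta_mx ord0 (lift ord0 j) + rV_cons (t, v) =
  rV_cons (t, h *: delta_mx ord0 j + v) :> 'rV[R]_n.+1.
Proof.
apply/rowP => i; rewrite shift_rVE; case: (unliftP ord0 i) => [k|] ->.
  by rewrite !rV_consS/= shift_rVE (inj_eq lift_inj).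
by rewrite !rV_cons0/= mulr0 add0r.
Qed.

Lemma integral_rV_cons n (f : 'rV[R]_n.+1 -> \bar R) :
  (lebesgue_rV R n.+1).-integrable setT f ->
  (lam \x lebesgue_rV R n)%E.-integrable setT (f \o @rV_cons R n) /\
  (\int[lebesgue_rV R n.+1]_x f x =
   \int[(lam \x lebesgue_rV R n)%E]_z f (rV_cons z))%E.
Proof.
move=> /integrableP[mf intf].
pose P := [the measure _ _ of (lam \x lebesgue_rV R n)%E].
have mc := @measurable_rV_cons R n.
have eqm (g : 'rV[R]_n.+1 -> \bar R) :
    (\int[lebesgue_rV R n.+1]_x g x = \int[image_measure P mc]_x g x)%E.
  by apply: eq_measure_integral => A _ _.
have ig : P.-integrable setT (f \o @rV_cons R n).
  apply/integrableP; split; first exact: measurableT_comp.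
  move: intf; rewrite eqm (@ge0_integral_pushforward _ _ _ _ _ _ mc P)//.
  by apply/measurableT_comp.
split=> //; rewrite eqm.
by rewrite (@integral_pushforward _ _ _ _ _ _ mc P setT f).
Qed.

Lemma integral_derive_compact (F f : R -> R) (M : R) :
  (forall t : R, is_derive t 1 F (f t)) -> continuous f ->
  (forall t, M < `|t| -> F t = 0) ->
  (forall t, M < `|t| -> f t = 0) -> (\int[lam]_t (f t)%:E = 0)%E.
Proof.
move=> dF cf F0 f0; pose B := `|M| + 1.
have B0 : 0 < B by rewrite ltr_wpDl.
have MB : M < B by rewrite (le_lt_trans (ler_norm _))// ltrDl.
rewrite (_ : (fun t => (f t)%:E) = (fun t => (f t)%:E) \_ `[- B, B]); last first.
  apply/funext => t; rewrite patchE; case: ifPn => // /negP tB.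
  rewrite f0// ltNge; apply/negP => tM; apply: tB; rewrite inE/= in_itv/=.
  by rewrite -ler_norml; lra.
rewrite -integral_mkcond.
have dFd : derivable_oo_LRcontinuous F (- B) B.
  have cF t : {for t, continuous F} by exact: derive_continuous (dF t).
  split; first by move=> t _; have [] := dF t.
  - by apply: cvg_at_right_filter; exact: cF.
  - by apply: cvg_at_left_filter; exact: cF.
rewrite (@continuous_FTC2 _ f F)//; last 3 first.
- lra.
- exact: continuous_subspaceT.
- by move=> t _; rewrite derive1E; have [_ ->] := dF t.
by rewrite !F0 ?subee// ?normrN gtr0_norm.
Qed.

(** Fubini's theorem reduces the claim to the variable [i], where it is the
  fundamental theorem of calculus. *)
Theorem integral_partial0 n (F : 'rV[R]_n -> R) i (M : R) :
  continuous F -> (forall x, derivable F x (delta_mx ord0 i)) ->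
  continuous (partial i F) -> (forall x, ~ cube M x -> F x = 0) ->
  (\int[lebesgue_rV R n]_x (partial i F x)%:E = 0)%E.
Proof.
elim: n F i => [|n IH] F i cF dF cdF F0; first by case: i {dF cdF}.
have F0' := partial_support i F0.
have [K HK] := continuous_bsupp cdF F0'.
have iF := bsupp_integrable HK.
have [ic ->] := integral_rV_cons iF.
have out t v : M < `|t| -> ~ cube M (rV_cons (t, v) : 'rV[R]_n.+1).
  by move=> tM /(_ ord0); rewrite rV_cons0/= -ler_norml leNgt tM.
have outS t (v : 'rV[R]_n) : ~ cube M v -> ~ cube M (rV_cons (t, v) : 'rV[R]_n.+1).
  by move=> vM H; apply: vM => j; have := H (lift ord0 j); rewrite rV_consS.
case: (unliftP ord0 i) => [j|] iE; last first.
  rewrite -(integral21_prod_meas1 ic).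
  rewrite (_ : (fun _ => _) = cst 0%E); first by rewrite integral0.
  apply/funext => v; rewrite /fubini_G/=.
  apply: (integral_derive_compact (F := fun t => F (rV_cons (t, v))) (M := M)).
  - move=> t; rewrite iE.
    have /is_derive_slice := derivableP (dF (rV_cons (t, v))).
    rewrite iE /partial => H; apply/is_derive_slice.
    rewrite (_ : (fun h : R => _) = (fun h => F (h *: delta_mx ord0 ord0 + rV_cons (t, v))))//.
    by apply/funext => h; rewrite rV_cons_shift0 /GRing.scale/= mulr1.
  - move=> t; apply: (@continuous_comp _ _ _ (fun t => rV_cons (t, v)) (partial i F)).
      exact: rV_cons_continuousl.
    exact: cdF.
  - by move=> t tM; rewrite F0//; exact: out.
  - by move=> t tM; rewrite F0'//; exact: out.
rewrite -(integral12_prod_meas1 ic).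
rewrite (_ : (fun _ => _) = cst 0%E); first by rewrite integral0.
apply/funext => t; rewrite /fubini_F/=.
have dS v : is_derive v (delta_mx ord0 j) (fun v => F (rV_cons (t, v)))
    (partial i F (rV_cons (t, v))).
  have /is_derive_slice := derivableP (dF (rV_cons (t, v))).
  rewrite -/(partial i F _) => H; apply/is_derive_slice.
  rewrite (_ : (fun h : R => _) = (fun h => F (h *: delta_mx ord0 i + rV_cons (t, v))))//.
  by apply/funext => h; rewrite iE rV_cons_shiftS.
have pE : partial j (fun v => F (rV_cons (t, v))) = (fun v => partial i F (rV_cons (t, v))).
  by apply/funext => v; rewrite /partial; have [_ ->] := dS v.
have := IH (fun v => F (rV_cons (t, v))) j; rewrite pE; apply.
- move=> v; apply: (@continuous_comp _ _ _ (fun v => rV_cons (t, v)) F).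
    exact: rV_cons_continuousr.
  exact: cF.
- by move=> v; have [] := dS v.
- move=> v; apply: (@continuous_comp _ _ _ (fun v => rV_cons (t, v)) (partial i F)).
    exact: rV_cons_continuousr.
  exact: cdF.
- by move=> v vM; rewrite F0//; exact: outS.
Qed.

End divergence.

(** * Smooth approximations of indicator functions *)

Section generator.
Context d (T : measurableType d) (R : realType) (mu : {measure set T -> \bar R}).
Local Open Scope ereal_scope.

(** By Dynkin's theorem the integral of [X] vanishes over all measurable sets.
  *)
Lemma ae_eq0_generator (G : set (set T)) (X : T -> \bar R) :
  @measurable _ T = <<s G >> -> setI_closed G -> mu.-integrable setT X ->
  \int[mu]_x X x = 0 -> (forall A, G A -> \int[mu]_(x in A) X x = 0) ->
  ae_eq mu setT X (cst 0).
Proof.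
move=> GE GI iX X0 GX.
have mX : measurable_fun setT X by exact: measurable_int iX.
have H A : measurable A -> \int[mu]_(x in A) X x = 0.
  rewrite GE; apply: (dynkin_induction (P := fun A => \int[mu]_(x in A) X x = 0) GE GI) => //.
    move=> S mS SX; have := integral_setU mu mS (measurableC mS).
    rewrite setUv => /(_ X mX); rewrite X0 SX add0e => <-//.
    by apply/disj_setPS; rewrite setICr.
  move=> F mF tF F0; rewrite integral_bigcup//; last first.
    by apply: integrableS iX => //; exact: bigcupT_measurable.
  by rewrite eseries0.
apply: integral_ae_eq => // E _ mE.
by rewrite H// integral0.
Qed.

Lemma dct_bounded (h : T -> R) (f_ : nat -> T -> R) (f : T -> R) (C : R) :
  mu.-integrable setT (EFin \o h) ->
  (forall k, measurable_fun setT (f_ k)) -> (forall k x, (`|f_ k x| <= C)%R) ->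
  (forall x, f_ k x @[k --> \oo] --> f x) ->
  (\int[mu]_x (h x * f_ k x)%:E) @[k --> \oo] --> \int[mu]_x (h x * f x)%:E.
Proof.
move=> ih mf fC ff.
have mh : measurable_fun setT h by apply/measurable_EFinP; exact: measurable_int ih.
have mhf k : measurable_fun setT (fun x => (h x * f_ k x)%:E).
  by apply/measurable_EFinP; exact: measurable_funM.
have cv x : (h x * f_ k x)%:E @[k --> \oo] --> (h x * f x)%:E.
  by apply: cvg_EFin; [exact: nearW|apply: cvgM; [exact: cvg_cst|exact: ff]].
have C0 (x : T) : (0 <= C)%R := le_trans (normr_ge0 _) (fC 0%N x).
have [] := @dominated_convergence _ _ _ mu setT measurableT
  (fun k x => (h x * f_ k x)%:E) (fun x => (h x * f x)%:E) (fun x => (C * `|h x|)%:E) mhf.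
- apply: (emeasurable_fun_cvg (fun k x => (h x * f_ k x)%:E)) => // x _; exact: cv.
- by apply: aeW => x _; exact: cv.
- have := integrable_abse ih.
  rewrite (_ : (fun x => (C * `|h x|)%:E) = (fun x => C%:E * (abse \o (EFin \o h)) x))//.
  exact: integrableZl.
- apply: aeW => x k _ /=; rewrite lee_fin normrM mulrC.
  by rewrite ler_wpM2r.
by [].
Qed.

End generator.

Section bumps.
Context {R : realType}.
Local Notation lam := (@lebesgue_measure R).

Lemma flat0_range (t : R) : 0 <= flat 0 t <= 1.
Proof.
rewrite /flat; case: ifPn => [t0|_]; last by rewrite lexx ler01.
by rewrite expr0 mul1r expR_ge0/= -expR0 ler_expR oppr_le0 invr_ge0 ltW.
Qed.

(** A smooth approximation of the indicator of [[a, b]], supported in the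
  [1/k]-neighbourhood of the interval, where [k = j.+1]. *)
Definition plateau (j : nat) (a b s : R) : R :=
  flat 0 (j.+1%:R * (j.+1%:R * (s - a) + 1)) * flat 0 (j.+1%:R * (j.+1%:R * (b - s) + 1)).

Lemma plateau_range j a b s : 0 <= plateau j a b s <= 1.
Proof.
have /andP[x0 x1] := flat0_range (j.+1%:R * (j.+1%:R * (s - a) + 1)).
have /andP[y0 y1] := flat0_range (j.+1%:R * (j.+1%:R * (b - s) + 1)).
by rewrite mulr_ge0//= mulr_ile1.
Qed.

Lemma smooth1_plateau j a b : smooth1 (plateau j a b).
Proof.
move=> k; set w : R := j.+1%:R.
have E (x y s : R) : w * (w * (x * s + y) + 1) = w * w * x * s + (w * w * y + w) by ring.
apply: Ck1M.
  rewrite (_ : (fun x => _) = (fun s => flat 0 (w * w * s + (w * w * - a + w)))).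
    by apply: Ck1_affine; exact: smooth1_flat.
  by apply/funext => s; congr flat; ring.
rewrite (_ : (fun x => _) = (fun s => flat 0 ((- (w * w)) * s + (w * w * b + w)))).
  by apply: Ck1_affine; exact: smooth1_flat.
by apply/funext => s; congr flat; ring.
Qed.

Lemma plateau_gt0 j a b s : a <= s <= b -> 0 < plateau j a b s.
Proof.
move=> /andP[as_ sb]; have j0 : (0 : R) < j.+1%:R by [].
have F t : 0 <= t -> 0 < flat 0 (j.+1%:R * (j.+1%:R * t + 1) : R).
  move=> t0; rewrite /flat ifT ?expr0 ?mul1r ?expR_gt0//.
  by rewrite mulr_gt0// ltr_wpDl// mulr_ge0// ltW.
by rewrite mulr_gt0// F// subr_ge0.
Qed.

Lemma plateau_eq0 j a b s e : (j.+1%:R)^-1 <= e -> s <= a - e \/ b + e <= s ->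
  plateau j a b s = 0.
Proof.
move=> je; have j0 : (0 : R) < j.+1%:R by [].
have F t : t <= - e -> flat 0 (j.+1%:R * (j.+1%:R * t + 1)) = 0.
  move=> te; rewrite /flat ltNge (_ : _ <= 0)//.
  rewrite pmulr_rle0// -lerBrDr sub0r -ler_pdivlMl// mulrN1.
  by apply: (le_trans te); rewrite lerN2.
move=> [H|H]; rewrite /plateau; first by rewrite F ?mul0r//; lra.
by rewrite [X in _ * X]F ?mulr0//; lra.
Qed.

Lemma measurable_plateau j a b : measurable_fun [set: R] (plateau j a b).
Proof. by apply: continuous_measurable_fun; exact: smooth1_continuous (smooth1_plateau j a b). Qed.

Lemma plateau_cvg a b s : plateau j a b s @[j --> \oo] --> (\1_(`[a, b]%classic) s : R).
Proof.
have [sab|sab] := pselect (a <= s <= b).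
  rewrite indicE mem_set/=; last by rewrite in_itv.
  apply/cvgrPdist_le => e e0.
  have e2 : 0 < e / 2 by lra.
  have := near_infty_natSinv_lt (PosNum e2); apply: filterS => j /= je.
  have /andP[b0 b1] := plateau_range j a b s.
  rewrite ger0_norm ?subr_ge0//.
  have j0 : (0 : R) < j.+1%:R by [].
  have F t : 0 <= t -> 1 - j.+1%:R^-1 <= flat 0 (j.+1%:R * (j.+1%:R * t + 1)) :> R.
    move=> t0; have w0 : 0 < j.+1%:R * (j.+1%:R * t + 1) :> R.
      by rewrite mulr_gt0// ltr_wpDl// mulr_ge0// ltW.
    rewrite /flat w0 expr0 mul1r; apply: le_trans (expR_ge1Dx _).
    rewrite lerD2l lerN2 lef_pV2 ?posrE//; apply: ler_peMr; first exact: ltW.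
    by rewrite lerDr mulr_ge0// ltW.
  have := F (s - a); have := F (b - s); rewrite /plateau.
  move: sab => /andP[sa sb]; rewrite !subr_ge0 => /(_ sb) + /(_ sa).
  have /andP[] := flat0_range (j.+1%:R * (j.+1%:R * (s - a) + 1)).
  have /andP[] := flat0_range (j.+1%:R * (j.+1%:R * (b - s) + 1)).
  move: (flat 0 _) (flat 0 _) => x y; move: (j.+1%:R^-1 : R) je => dl; nra.
rewrite indicE memNset/=; last by rewrite in_itv.
have [e [e0 He]] : exists e, 0 < e /\ (s <= a - e \/ b + e <= s).
  move/negP: sab; rewrite negb_and -!ltNge => /orP[sa|sb].
    by exists (a - s); split; [rewrite subr_gt0|left; lra].
  by exists (s - b); split; [rewrite subr_gt0|right; lra].
apply: (@cvg_trans _ ((fun=> 0 : R) @ \oo)); last exact: cvg_cst.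
apply: near_eq_cvg; have := near_infty_natSinv_lt (PosNum e0).
by apply: filterS => j /= je; rewrite (plateau_eq0 (ltW je) He).
Qed.

(** [sg] is the normalized antiderivative of [K]. *)
Lemma smooth_step (K : R -> R) (a b s0 : R) : smooth1 K -> (forall s, 0 <= K s) ->
  (forall s, s <= a \/ b <= s -> K s = 0) -> 0 < K s0 ->
  exists I (sg : R -> R), [/\ 0 < I, (\int[lam]_s (K s)%:E = I%:E)%E, smooth1 sg,
    (forall s : R, is_derive s 1 sg (K s / I)) &
    [/\ forall s, s <= a -> sg s = 0, forall s, b <= s -> sg s = 1 &
      forall s, 0 <= sg s <= 1]].
Proof.
move=> sK K0 Kab Ks0.
have as0 : a < s0.
  by rewrite ltNge; apply/negP => H; move: Ks0; rewrite Kab ?ltxx//; left.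
have s0b : s0 < b.
  by rewrite ltNge; apply/negP => H; move: Ks0; rewrite Kab ?ltxx//; right.
have cK := smooth1_continuous sK.
pose a0 := a - 1.
pose P s := (\int[lam]_(t in `[a0, s]) K t)%R.
have iK u v : lam.-integrable `[u, v] (EFin \o K).
  by apply: continuous_compact_integrable; [exact: segment_compact|exact: continuous_subspaceT].
have Pa s : s <= a -> P s = 0.
  move=> sa; rewrite /P (@eq_Rintegral _ _ _ _ _ (cst 0)).
    by rewrite Rintegral_cst// mul0r.
  move=> t; rewrite inE/= in_itv/= => /andP[_ ts]; rewrite Kab//; left.
  exact: le_trans ts sa.
have dP (s : R) : is_derive s 1 P (K s).
  have [sa|sa] := ltP s a.
    rewrite Kab; last by left; exact: ltW.
    apply: (@near_eq_is_derive _ _ _ (fun=> 0 : R)).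
    by near=> t; rewrite Pa//; apply/ltW; near: t; exact: lt_nbhsl.
  have [|] := @continuous_FTC1_closed R K a0 s (s + 1) (ltac:(rewrite ltrDl; exact: ltr01))
    (iK _ _) _ (cK s); first by rewrite /a0; lra.
  by move=> dPs dPE; split; [exact: dPs|rewrite -derive1E].
have Pmono s t : s <= t -> P s <= P t.
  move=> st; rewrite -subr_ge0; have : 0 * (t - s) <= P t - P s.
    by apply: (derive_ge st (fun x _ => dP x)) => x _; exact: K0.
  by rewrite mul0r.
have P_b s : b <= s -> P s = P b.
  move=> bs; apply/le_anti; rewrite (Pmono b s bs) andbT -subr_le0.
  have : P s - P b <= 0 * (s - b).
    apply: (derive_le bs (fun x _ => dP x)) => x /andP[bx _].
    by rewrite Kab//; right.
  by rewrite mul0r.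
have I0 : 0 < P b.
  have Pb0 : 0 <= P b by rewrite -(Pa a)// Pmono//; lra.
  rewrite lt_neqAle Pb0 andbT; apply/eqP => Pb.
  have Pz s : a <= s <= b -> P s = 0.
    move=> /andP[sa sb]; apply/le_anti; rewrite {1}Pb Pmono//=.
    by rewrite -(Pa a)// Pmono.
  suff : K s0 = 0 by move=> K00; move: Ks0; rewrite K00 ltxx.
  have [_ <-] := dP s0.
  rewrite (@near_eq_derive _ _ _ P (fun=> 0)); first exact: derive_cst.
  near=> t; rewrite Pz//; apply/andP; split; apply/ltW.
    by near: t; exact: lt_nbhsr.
  by near: t; exact: lt_nbhsl.
have dsg (s : R) : is_derive s 1 (fun s => P s / P b) (K s / P b).
  have H := isdM (dP s) (isd_cst (P b)^-1 s).
  by apply: (isd_eq H); rewrite mulr0 add0r mulrC.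
exists (P b), (fun s => P s / P b); split => //.
- rewrite (_ : (fun s => (K s)%:E) = (EFin \o K) \_ `[a0, b]); last first.
    apply/funext => t; rewrite patchE; case: ifPn => // /negP tab /=.
    rewrite Kab//; have [ta|at_] := leP t a; first by left.
    right; rewrite leNgt; apply/negP => tb; apply: tab; rewrite inE/= in_itv/= /a0.
    by rewrite (ltW tb) andbT; lra.
  rewrite -integral_mkcond /P /Rintegral fineK//.
  by apply: integrable_fin_num.
- case=> [|k]; first by split=> // x; exact: derive_continuous (dsg x).
  apply: (Ck1S dsg); rewrite (_ : (fun s => _) = (fun s => (P b)^-1 * K s)).
    exact: Ck1Z.
  by apply/funext => s; rewrite mulrC.
- split=> s.
  + by move=> sa; rewrite Pa// mul0r.
  + by move=> bs; rewrite P_b// divff// gt_eqF.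
  + have [bs|sb] := leP b s; first by rewrite P_b// divff ?gt_eqF// ler01 lexx.
    have Ps : 0 <= P s.
      have [sa|sa] := leP s a; first by rewrite Pa.
      by rewrite -(Pa a)// Pmono// ltW.
    by rewrite divr_ge0 ?(ltW I0)//= ler_pdivrMr// mul1r Pmono// ltW.
Unshelve. all: by end_near. Qed.

(** The difference of two smooth steps. Its derivative compares the averages
  of a function with respect to [K] and to [K']. *)
Lemma smooth_trapezoid (K K' : R -> R) (a b s a' b' s' : R) :
  smooth1 K -> (forall t, 0 <= K t) -> (forall t, t <= a \/ b <= t -> K t = 0) -> 0 < K s ->
  smooth1 K' -> (forall t, 0 <= K' t) -> (forall t, t <= a' \/ b' <= t -> K' t = 0) -> 0 < K' s' ->
  b <= a' ->
  exists I I' (z : R -> R), [/\ 0 < I, 0 < I', (\int[lam]_t (K t)%:E = I%:E)%E,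
     (\int[lam]_t (K' t)%:E = I'%:E)%E &
    [/\ smooth1 z, forall t : R, is_derive t 1 z (K t / I - K' t / I'),
      forall t, t <= a \/ b' <= t -> z t = 0, forall t, b <= t <= a' -> z t = 1 &
      forall t, 0 <= z t <= 1]].
Proof.
move=> sK K0 Kab Ks sK' K0' Kab' Ks' ba'.
have [I [sg [I0 KI ssg dsg [sga sgb sg01]]]] := smooth_step sK K0 Kab Ks.
have [I' [sg' [I0' KI' ssg' dsg' [sga' sgb' sg01']]]] := smooth_step sK' K0' Kab' Ks'.
have ab : a < b.
  rewrite ltNge; apply/negP => H; move: Ks; rewrite Kab ?ltxx//.
  by case: (leP s a) => sa; [left|right; lra].
have ab' : a' < b'.
  rewrite ltNge; apply/negP => H; move: Ks'; rewrite Kab' ?ltxx//.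
  by case: (leP s' a') => sa; [left|right; lra].
exists I, I', (fun t => sg t - sg' t); split=> //; split.
- move=> k; apply: Ck1D; first exact: ssg.
  rewrite (_ : (fun x => _) = (fun t => -1 * sg' t)); first by apply: Ck1Z; exact: ssg'.
  by apply/funext => t; rewrite mulN1r.
- by move=> t; exact: isdB (dsg t) (dsg' t).
- move=> t [ta|bt]; first by rewrite sga// sga' ?subrr//; lra.
  by rewrite sgb ?sgb' ?subrr//; lra.
- by move=> t /andP[bt ta]; rewrite sgb// sga'// subr0.
- move=> t; have := sg01 t; have := sg01' t; have [tb|bt] := leP t b.
    by rewrite (sga' t) ?subr0//; lra.
  by rewrite (sgb t) ?(ltW bt)//; lra.
Qed.

End bumps.

(** * Profiles of radial functions *)

Section local_integrability.
Context {R : realType} {n : nat}.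
Local Notation leb := (lebesgue_rV R n).

Lemma Lfun_measurable (p : R) (f : 'rV[R]_n -> R) : f \in Lfun leb p%:E ->
  measurable_fun setT f.
Proof. by move=> /sub_Lfun_mfun; rewrite inE. Qed.

Lemma le_1DpowR (p x : R) : 1 <= p -> 0 <= x -> x <= 1 + x `^ p.
Proof.
move=> p1 x0; have [x1|x1] := leP x 1; first by have := powR_ge0 x p; lra.
by have := le1r_powR (ltW x1) p1; lra.
Qed.

(** [|f| <= 1 + |f| ^ p]. *)
Lemma Lfun_locally_integrable (p : R) (f : 'rV[R]_n -> R) (M : R) : 1 <= p ->
  f \in Lfun leb p%:E -> leb.-integrable (cube M) (EFin \o f).
Proof.
move=> p1 fL; have mf := Lfun_measurable fL.
have ip := Lfun_integrable p1 fL.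
have mM := measurable_box (fun=> - M) (fun=> M) : measurable (cube M : set 'rV[R]_n).
have H : leb.-integrable (cube M) (fun x => (1 + `|f x| `^ p)%:E).
  have i1 : leb.-integrable (cube M) (EFin \o (fun=> 1 : R)).
    apply: measurable_bounded_integrable => //; first exact: leb_cube_lty.
    exists 1; split; first exact: num_real.
    by move=> y y1 x _; rewrite normr1 ltW.
  have := integrableD mM i1 (integrableS measurableT mM (@subsetT _ _) ip).
  by [].
apply: le_integrable H => //.
  by apply/measurable_EFinP; exact: measurable_funTS.
move=> x _ /=; rewrite lee_fin (le_trans (le_1DpowR p1 (normr_ge0 _)))//.
by rewrite ler_norm.
Qed.

End local_integrability.

Section radial_profile.
Context {R : realType} {n : nat}.
Hypothesis n0 : (0 < n)%N.
Local Notation leb := (lebesgue_rV R n).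
Local Notation c := (unit_vol n : R).
Local Notation rho := (vol (unit_vol n : R)).
Local Notation radius := (ball_radius n%:R (unit_vol n : R)).

Let c0 : 0 < c. Proof. exact: unit_vol_gt0. Qed.
Let nR : (0 : R) < n%:R. Proof. by rewrite ltr0n. Qed.

Lemma radius_rho (x : 'rV[R]_n) : radius (rho x) = enorm x.
Proof.
rewrite /ball_radius /vol mulrC mulKf ?gt_eqF// -powRrM.
rewrite (_ : n%:R / 2 / n%:R = 2^-1); last by field; rewrite gt_eqF.
by rewrite powR12_sqrt// sqn_ge0.
Qed.

Lemma radius_gt0 (s : R) : 0 < s -> 0 < radius s.
Proof. by move=> s0; rewrite powR_gt0// divr_gt0. Qed.

Lemma enorm_sqr (x : 'rV[R]_n) : enorm x ^+ 2 = sqn x.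
Proof. by rewrite sqr_sqrtr// sqn_ge0. Qed.

Lemma rho_enorm (x : 'rV[R]_n) : rho x = c * enorm x `^ n%:R.
Proof.
rewrite /vol -enorm_sqr -powR_mulrn ?sqrtr_ge0// -powRrM; congr (_ * _ `^ _).
by field.
Qed.

Lemma rho_gt0 (x : 'rV[R]_n) : x != 0 -> 0 < rho x.
Proof.
move=> x0; rewrite mulr_gt0// powR_gt0// lt_neqAle sqn_ge0 andbT eq_sym.
apply/eqP => s0; move/eqP: x0; apply; apply/rowP => i; rewrite mxE.
have := coord_sqn x i; rewrite s0 => xi.
have : x ord0 i ^+ 2 == 0 by rewrite eq_le xi sqr_ge0.
by rewrite expf_eq0/= => /eqP.
Qed.

Lemma rho_cube (x : 'rV[R]_n) s : rho x <= s -> cube (radius s) x.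
Proof.
move=> xs i; rewrite -ler_norml.
apply: (@le_trans _ _ (enorm x)).
  by rewrite -sqrtr_sqr ler_wsqrtr// coord_sqn.
rewrite -radius_rho; have xc : 0 <= rho x / c by rewrite divr_ge0 ?vol_ge0// ltW.
apply: powR_le2r; [by rewrite invr_ge0|exact: xc|by rewrite ler_pM2r// invr_gt0].
Qed.

(** A point of the sphere enclosing the volume [s], at which radial functions
  are read off. *)
Definition sphere_pt (s : R) : 'rV[R]_n := radius s *: delta_mx ord0 (Ordinal n0).

Lemma enorm_sphere_pt s : enorm (sphere_pt s) = radius s.
Proof.
rewrite /enorm (bigD1 (Ordinal n0))//= big1 ?addr0 => [|i /negPf ni].
  by rewrite !mxE !eqxx mulr1 sqrtr_sqr ger0_norm// powR_ge0.
by rewrite !mxE eqxx ni mulr0 expr0n.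
Qed.

Lemma rho_sphere_pt s : 0 < s -> rho (sphere_pt s) = s.
Proof.
move=> s0; rewrite rho_enorm enorm_sphere_pt /ball_radius -powRrM mulVf ?gt_eqF//.
by rewrite powRr1 ?divr_ge0 ?(ltW s0) ?(ltW c0)// mulrC divfK// gt_eqF.
Qed.

Lemma sphere_pt_neq0 s : 0 < s -> sphere_pt s != 0.
Proof.
move=> s0; apply/eqP => H; have := rho_sphere_pt s0; rewrite H rho_enorm.
rewrite -radius_rho /vol /sqn big1; last by move=> i _; rewrite mxE expr0n.
rewrite powR0 ?mulr0 /ball_radius ?mul0r ?powR0 ?mulr0; first by move=> E; move: s0; rewrite -E ltxx.
- by rewrite gt_eqF.
- by rewrite invr_neq0// gt_eqF.
- by rewrite mulf_neq0 ?invr_neq0 ?gt_eqF.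
Qed.

Lemma radius_continuous s : 0 < s -> {for s, continuous radius}.
Proof.
move=> s0; have sc : 0 < s / c by rewrite divr_gt0.
have H := isd_comp (g := fun s => s / c) (is_derive1_powR n%:R^-1 sc)
  (isdM (isd_id s) (isd_cst c^-1 s)).
exact: derive_continuous H.
Qed.

Context (u : 'rV[R]_n -> R).
Hypothesis u_radial : radial u.
Hypothesis u_cont : forall x, x != 0 -> {for x, continuous u}.

Definition profile (s : R) : R := u (sphere_pt s).

Lemma profile_rho x : u x = profile (rho x).
Proof. by apply: u_radial; rewrite enorm_sphere_pt radius_rho. Qed.

Lemma profile_continuous s : 0 < s -> {for s, continuous profile}.
Proof.
move=> s0; apply: (@continuous_comp _ _ _ sphere_pt u).
  by apply: cvgZr_tmp; exact: radius_continuous.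
exact/u_cont/sphere_pt_neq0.
Qed.

End radial_profile.

(** * The radial part of a weak gradient *)

Lemma fineN_Rintegral d (T : measurableType d) (R : realType)
  (mu : {measure set T -> \bar R}) (f g : T -> R) :
  (\int[mu]_x (f x)%:E = - \int[mu]_x (g x)%:E)%E ->
  \int[mu]_x f x = - \int[mu]_x g x.
Proof. by rewrite /Rintegral => ->; rewrite fineN. Qed.

Lemma integrable_sum_Rintegral d (T : measurableType d) (R : realType)
  (mu : {measure set T -> \bar R}) (I : Type) (s : seq I) (f : I -> T -> R) :
  (forall i, mu.-integrable setT (EFin \o f i)) ->
  mu.-integrable setT (EFin \o (fun x => \sum_(i <- s) f i x)) /\
  \int[mu]_x (\sum_(i <- s) f i x) = \sum_(i <- s) \int[mu]_x f i x.
Proof.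
move=> fi; elim: s => [|a s [IH1 IH2]].
  rewrite (_ : (fun x => _) = cst 0); last by apply/funext => x; rewrite big_nil.
  rewrite big_nil; split; last by rewrite Rintegral_cst// mul0r.
  rewrite (_ : EFin \o _ = cst 0%E)//; exact: integrable0.
rewrite (_ : (fun x => _) = (fun x => f a x + \sum_(i <- s) f i x)); last first.
  by apply/funext => x; rewrite big_cons.
split; last by rewrite big_cons -IH2 RintegralD.
exact: (integrableD measurableT (fi a) IH1).
Qed.

Section compact_support.
Context {R : realType} {n : nat}.

Lemma compact_support_test (phi : 'rV[R]_n -> R) M : smooth phi ->
  (forall x, ~ cube M x -> phi x = 0) -> test_function phi.
Proof.
move=> sphi phi0; split=> //.
apply: (subclosed_compact (@closed_closure _ _) (@compact_cube R n M)).
have cM : closed (cube M : set 'rV[R]_n).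
  by apply: compact_closed; [exact: norm_hausdorff|exact: compact_cube].
rewrite closureE => x; apply => //=; split=> // y /= /eqP phiy.
by apply: contrapT => yM; apply: phiy; exact: phi0.
Qed.

End compact_support.

Section radial_test.
Context {R : realType} {n : nat} (p : R).
Hypotheses (n0 : (0 < n)%N) (p1 : 1 < p).
Local Notation leb := (lebesgue_rV R n).
Local Notation c := (unit_vol n : R).
Local Notation rho := (vol (unit_vol n : R)).
Local Notation radius := (ball_radius n%:R (unit_vol n : R)).
Context (u : 'rV[R]_n -> R) (G : 'rV[R]_n -> 'rV[R]_n).
Hypotheses (uL : u \in Lfun leb p%:E) (uG : is_weak_gradient p u G).

Let c0 : 0 < c. Proof. exact: unit_vol_gt0. Qed.
Let nR : (0 : R) < n%:R. Proof. by rewrite ltr0n. Qed.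
Let p1' : 1 <= p. Proof. exact: ltW. Qed.

(** The component of the weak gradient along [grad rho], normalized so that it
  is [h] when the gradient is [h * grad rho]. *)
Definition radial_part x : R := (\sum_i G x ord0 i * x ord0 i) / (n%:R * rho x).

Lemma rho0 (x : 'rV[R]_n) : sqn x = 0 -> rho x = 0.
Proof. by move=> s0; rewrite /vol s0 powR0 ?mulr0// gt_eqF// divr_gt0. Qed.

(** Tests the weak gradient with the vector field [z (rho x) / (n * rho x) *
  x], the divergence of which is [z^`() (rho x)]. *)
Lemma weak_gradient_radial (z : R -> R) (a b : R) : smooth1 z -> 0 < a ->
  (forall t, t <= a \/ b <= t -> z t = 0) ->
  \int[leb]_x (u x * (z^`()%classic) (rho x)) =
  - \int[leb]_x (radial_part x * z (rho x)).
Proof.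
move=> sz a0 zab.
have za t : t <= a -> z t = 0 by move=> ta; apply: zab; left.
have z0 : z 0 = 0 by rewrite za// ltW.
have a2 : 0 < a / 2 by rewrite divr_gt0.
have za2 t : t <= a / 2 -> z t = 0 by move=> ta; apply: za; lra.
have dza2 t : t <= a / 2 -> (z^`()%classic) t = 0.
  by move=> ta; apply: (Ck1_vanish (sz 1%N) za); lra.
pose th : R := n%:R / 2.
pose K : R := (c * n%:R)^-1.
pose Q (x : 'rV[R]_n) : R := K * pow_profile n c z (- th) (sqn x).
pose phi (i : 'I_n) (x : 'rV[R]_n) : R := x ord0 i * Q x.
have sphi i : smooth (phi i).
  move=> k; apply: CkM; first exact: Ck_coord.
  apply: CkM; first exact: Ck_cst.
  apply: Ck_comp1; last exact: Ck_sqn.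
  exact: (Ck1_pow_profile n0 c0 _ a0 za (sz k)).
have phi0 i x : ~ cube (radius b) x -> phi i x = 0.
  move=> xb; rewrite /phi /Q /pow_profile; case: ifPn => s0; rewrite ?mulr0//.
  rewrite zab ?mul0r ?mulr0//; right; rewrite -/(vol c x) leNgt; apply/negP => H.
  by apply: xb; apply: rho_cube => //; exact: ltW.
have tphi i : test_function (phi i) by exact: compact_support_test (phi0 i).
pose dQ (x : 'rV[R]_n) : R := K * (c * th * pow_profile n c z^`()%classic (th - 1 + - th) (sqn x)
  + - th * pow_profile n c z (- th - 1) (sqn x)).
have dphi i x : is_derive x (delta_mx ord0 i) (phi i) (x ord0 i * (dQ x * (2 * x ord0 i)) + Q x).
  have H := isdv_comp (isdZ K (is_derive_pow_profile n0 c0 (- th) (sqn x) a2 za2 dza2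
     (smooth1_is_derive sz))) (isdv_sqn x i).
  by apply: (isdv_eq (isdvM (isdv_coord x i i) H)); rewrite eqxx mulr1.
have pphi i : partial i (phi i) = fun x => x ord0 i * (dQ x * (2 * x ord0 i)) + Q x.
  exact: partialE (dphi i).
have i1 i : leb.-integrable setT (EFin \o (fun x => u x * partial i (phi i) x)).
  have [K' HK] := continuous_bsupp (Ck_continuous (Ck_partial i (sphi i 1%N)))
    (partial_support i (phi0 i)).
  exact: (bsupp_mul_integrable (Lfun_locally_integrable _ p1' uL) HK).
have i2 i : leb.-integrable setT (EFin \o (fun x => G x ord0 i * phi i x)).
  have [K' HK] := continuous_bsupp (Ck_continuous (sphi i 0%N)) (phi0 i).
  exact: (bsupp_mul_integrable (Lfun_locally_integrable _ p1' (uG.1 i)) HK).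
have [_ S1] := integrable_sum_Rintegral (index_enum 'I_n) i1.
have [_ S2] := integrable_sum_Rintegral (index_enum 'I_n) i2.
have E1 : (fun x => \sum_i u x * partial i (phi i) x) = (fun x => u x * (z^`()%classic) (rho x)).
  apply/funext => x; rewrite -mulr_sumr; congr (_ * _).
  under eq_bigr do rewrite pphi.
  rewrite big_split/= sumr_const card_ord.
  have -> : \sum_(i < n) x ord0 i * (dQ x * (2 * x ord0 i)) = dQ x * 2 * sqn x.
    by rewrite /sqn mulr_sumr; apply: eq_bigr => j _; ring.
  rewrite -[Q x *+ n]mulr_natr /dQ /Q /pow_profile.
  case: ifPn => [s0|s0]; last first.
    have s00 : sqn x = 0 by apply/le_anti; rewrite leNgt s0 sqn_ge0.
    by rewrite rho0// dza2 ?ltW// !mulr0 addr0 mulr0 !mul0r addr0.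
  rewrite -/th -/(vol c x) (_ : th - 1 + - th = - 1); last by ring.
  rewrite powR_inv1 ?(ltW s0)//.
  rewrite (@powRD _ _ (- th) (- 1)) ?(gt_eqF s0) ?implybT// powR_inv1 ?(ltW s0)//.
  rewrite /K (_ : n%:R = 2 * th); last by rewrite /th mulrC divfK.
  have th0 : 0 < th by rewrite divr_gt0.
  by field; rewrite !gt_eqF.
have E2 : (fun x => \sum_i G x ord0 i * phi i x) = (fun x => radial_part x * z (rho x)).
  apply/funext => x; rewrite /radial_part /phi.
  under eq_bigr do rewrite mulrA; rewrite -mulr_suml -[RHS]mulrA; congr (_ * _).
  rewrite /Q /pow_profile; case: ifPn => [s0|s0]; last first.
    have s00 : sqn x = 0 by apply/le_anti; rewrite leNgt s0 sqn_ge0.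
    by rewrite rho0// z0 !mulr0.
  rewrite -/(vol c x) powRN /K /vol -/th.
  by field; rewrite !gt_eqF// powR_gt0.
rewrite -E1 -E2 S1 S2 -sumrN; apply: eq_bigr => i _.
by apply: fineN_Rintegral; exact: uG.2.
Qed.

End radial_test.

(** * Increments of the profile *)

Lemma measurable_funV_ge0 d (T : measurableType d) (R : realType) (g : T -> R) :
  (forall x, 0 <= g x) -> measurable_fun setT g ->
  measurable_fun setT (fun x => (g x)^-1).
Proof.
move=> g0 mg; rewrite (_ : (fun x => _) = fun x => g x `^ (-1)).
  exact: (measurableT_comp (measurable_powR _)).
by apply/funext => x; rewrite powR_inv1.
Qed.

Section averages.
Context {R : realType}.
Local Notation lam := (@lebesgue_measure R).

Lemma cont_supp_integrable (g : R -> R) (a b : R) : continuous g ->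
  (forall t, t <= a \/ b <= t -> g t = 0) -> lam.-integrable setT (EFin \o g).
Proof.
move=> cg g0.
rewrite (_ : EFin \o g = (EFin \o g) \_ `[a, b]); last first.
  apply/funext => t; rewrite patchE; case: ifPn => //= /negP tab.
  rewrite g0//; have [ta|at_] := leP t a; first by left.
  right; rewrite leNgt; apply/negP => tb; apply: tab; rewrite inE/= in_itv/=.
  by rewrite !ltW.
apply: (iffLR (@integrable_mkcond _ (measurableTypeR R) R lam `[a, b]%classic
  (EFin \o g) (measurable_itv _))).
by apply: continuous_compact_integrable; [exact: segment_compact|exact: continuous_subspaceT].
Qed.

Lemma mul_cut_continuous (g w : R -> R) (a : R) :
  (forall s, 0 < s -> {for s, continuous g}) -> 0 < a -> continuous w ->
  (forall t, t <= a -> w t = 0) -> continuous (fun s => g s * w s).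
Proof.
move=> cg a0 cw w0 s; have [s0|s0] := ltP 0 s.
  have := cvgM (cg s s0) (cw s); exact.
apply: (@near_eq_continuous _ _ (fun=> 0)); last exact: cst_continuous.
near=> t; rewrite w0 ?mulr0//; apply/ltW; near: t; apply: lt_nbhsl.
exact: le_lt_trans s0 a0.
Unshelve. all: by end_near. Qed.

Lemma derive1_support (z : R -> R) (a b : R) : smooth1 z ->
  (forall t, t <= a \/ b <= t -> z t = 0) ->
  forall t, t < a \/ b < t -> (z^`()%classic) t = 0.
Proof.
move=> sz z0 t tab; suff : is_derive t 1 z 0 by move=> [_ <-]; rewrite derive1E.
apply: (@near_eq_is_derive _ _ _ (fun=> 0 : R)).
by case: tab => tt; near=> t'; rewrite z0//; [left|right]; apply/ltW; near: t';
  [exact: lt_nbhsl|exact: lt_nbhsr].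
Unshelve. all: by end_near. Qed.

Lemma cont_supp_bounded (w : R -> R) (a b : R) : continuous w ->
  (forall t, t < a \/ b < t -> w t = 0) -> exists K, forall t, `|w t| <= K.
Proof.
move=> cw w0; have [K [_ HK]] : bounded_set (w @` `[a, b]).
  apply: compact_bounded; apply: continuous_compact; last exact: segment_compact.
  exact: continuous_subspaceT.
exists (`|K| + 1) => t; have [tab|tab] := boolP (a <= t <= b).
  by apply: HK; [rewrite (le_lt_trans (ler_norm _))// ltrDl|exists t => //=; rewrite in_itv].
rewrite w0 ?normr0 ?addr_ge0//.
by move: tab; rewrite negb_and -!ltNge => /orP[]; [left|right].
Qed.

(** Used with weights concentrated near a point where the continuous function
  [F] takes the value [v]. *)
Lemma weighted_average (F K : R -> R) (a b v I e : R) : 0 < I ->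
  lam.-integrable setT (EFin \o (fun t => F t * K t)) ->
  lam.-integrable setT (EFin \o K) -> \int[lam]_t K t = I ->
  (forall t, 0 <= K t) -> (forall t, t <= a \/ b <= t -> K t = 0) ->
  (forall t, a <= t <= b -> `|F t - v| <= e) ->
  `|(\int[lam]_t (F t * K t)) / I - v| <= e.
Proof.
move=> I0 iFK iK KI K0 Kab Fv.
have -> : (\int[lam]_t (F t * K t)) / I - v =
    (\int[lam]_t (F t * K t - v * K t)) / I.
  rewrite RintegralB//; last exact: (integrableZl measurableT v iK).
  by rewrite RintegralZl// KI mulrBl mulfK// gt_eqF.
have iD : lam.-integrable setT (EFin \o (fun t => F t * K t - v * K t)).
  exact: (integrableB measurableT iFK (integrableZl measurableT v iK)).
rewrite normrM normfV (gtr0_norm I0) ler_pdivrMr//.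
apply: (le_trans (le_normr_Rintegral measurableT iD)).
rewrite -KI -RintegralZl//; apply: le_Rintegral => //.
- exact: (integrable_abse iD).
- exact: (integrableZl measurableT e iK).
move=> t _; rewrite -mulrBl normrM (ger0_norm (K0 t)).
have [tab|tab] := boolP (a <= t <= b); first by rewrite ler_wpM2r// Fv.
rewrite Kab ?mulr0//; move: tab; rewrite negb_and -!ltNge => /orP[/ltW|/ltW]; tauto.
Qed.

End averages.

Section radial_integrals.
Context {R : realType} {n : nat}.
Hypothesis n0 : (0 < n)%N.
Local Notation leb := (lebesgue_rV R n).
Local Notation lam := (@lebesgue_measure R).
Local Notation rho := (vol (unit_vol n : R)).
Let E : set (measurableTypeR R) := `[0, +oo[%classic.

Let mE : measurable E. Proof. exact: measurable_itv. Qed.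

Let rhoE : rho @^-1` E = [set: 'rV[R]_n].
Proof. by apply/seteqP; split=> // x _; rewrite /E/= in_itv/= andbT vol_ge0. Qed.

Lemma integrable_rho (g : R -> R) : lam.-integrable setT (EFin \o g) ->
  leb.-integrable setT (EFin \o (fun x => g (rho x))).
Proof.
move=> ig; rewrite -rhoE; have := @integrable_vol R n n0 E (EFin \o g) mE (@subset_refl _ _).
by apply; exact: integrableS ig.
Qed.

Lemma Rintegral_rho (g : R -> R) : lam.-integrable setT (EFin \o g) ->
  (forall s, s < 0 -> g s = 0) ->
  \int[leb]_x g (rho x) = \int[lam]_s g s.
Proof.
move=> ig g0; rewrite /Rintegral; congr fine.
rewrite -rhoE (@integral_vol R n n0 E (EFin \o g) mE (@subset_refl _ _)); last exact: integrableS ig.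
rewrite [LHS]integral_mkcond; apply: eq_integral => s _; rewrite patchE.
case: ifPn => //= /negP sE; rewrite g0// ltNge; apply/negP => s0.
by apply: sE; rewrite inE/= /E/= in_itv/= andbT.
Qed.

Lemma measurable_rho_itv (i : interval R) : measurable ((fun x : 'rV[R]_n => rho x) @^-1` [set` i]).
Proof.
by rewrite -[X in measurable X]setTI; apply: measurable_vol => //; exact: measurable_itv.
Qed.

End radial_integrals.

Section profile_increments.
Context {R : realType} {n : nat} (p : R).
Hypotheses (n0 : (0 < n)%N) (p1 : 1 < p).
Local Notation leb := (lebesgue_rV R n).
Local Notation lam := (@lebesgue_measure R).
Local Notation c := (unit_vol n : R).
Local Notation rho := (vol (unit_vol n : R)).
Local Notation radius := (ball_radius n%:R (unit_vol n : R)).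
Context (u : 'rV[R]_n -> R) (G : 'rV[R]_n -> 'rV[R]_n).
Hypotheses (uL : u \in Lfun leb p%:E) (uG : is_weak_gradient p u G).
Hypothesis u_radial : radial u.
Hypothesis u_cont : forall x, x != 0 -> {for x, continuous u}.
Local Notation U := (profile n0 u).

Let c0 : 0 < c. Proof. exact: unit_vol_gt0. Qed.
Let nR : (0 : R) < n%:R. Proof. by rewrite ltr0n. Qed.

(** A trapezoid with steep sides: its derivative is the difference of a
  normalized bump right after [a] and one right after [b]. *)
Lemma increment_test (a b e : R) : 0 < a -> a < b -> 0 < e ->
  exists z : R -> R, [/\ smooth1 z, forall t, t <= a \/ b + e <= t -> z t = 0,
    forall t, a + e <= t <= b -> z t = 1, forall t, 0 <= z t <= 1 &
    `|\int[lam]_s (U s * (z^`()%classic) s) - (U a - U b)| <= e].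
Proof.
move=> a0 ab e0.
have e2 : 0 < e / 2 by lra.
have loc v : 0 < v -> exists2 d, 0 < d & forall t, v <= t <= v + d -> `|U t - U v| <= e / 2.
  move=> v0; have /cvgrPdist_le/(_ _ e2)[d /= d0 Hd] := profile_continuous (n0:=n0) u_cont v0.
  exists (d / 2); first lra.
  by move=> t vt; rewrite distrC; apply: Hd; rewrite /ball/= distrC ger0_norm; lra.
have [da da0 Ha] := loc a a0.
have [db db0 Hb] := loc b (lt_trans a0 ab).
pose m := Num.min (Num.min da db) (Num.min e (b - a)).
have m0 : 0 < m by rewrite !lt_min da0 db0 e0/= subr_gt0.
have [ma mb me mba] : [/\ m <= da, m <= db, m <= e & m <= b - a].
  by split; rewrite /m !ge_min lexx ?orbT.
have m4 : 0 < m / 4 by lra.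
have [j _ Hj] := near_infty_natSinv_lt (PosNum m4).
have {Hj} := Hj j (leqnn j); rewrite /=.
have : (0 : R) < j.+1%:R^-1 by rewrite invr_gt0.
have [d dE] : {d : R | d = j.+1%:R^-1} by exists j.+1%:R^-1.
rewrite -dE => d0 dm.
pose K v := plateau j (v + 2 * d) (v + 2 * d) : R -> R.
have sK v : smooth1 (K v) by exact: smooth1_plateau.
have K0 v t : 0 <= K v t by have /andP[] := plateau_range j (v + 2 * d) (v + 2 * d) t.
have Kv v t : t <= v \/ v + m <= t -> K v t = 0.
  move=> H; apply: (@plateau_eq0 _ j _ _ _ d); first by rewrite dE.
  by case: H => H; [left|right]; lra.
have Kp v : 0 < K v (v + 2 * d) by apply: plateau_gt0; rewrite lexx.
have [I [I' [z [I0 I0' KI KI' [sz dz z0 z1 z01]]]]] :=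
  smooth_trapezoid (sK a) (K0 a) (Kv a) (Kp a) (sK b) (K0 b) (Kv b) (Kp b)
  (ltac:(lra) : a + m <= b).
exists z; split=> //.
- by move=> t [ta|tb]; apply: z0; [left|right; lra].
- by move=> t tab; apply: z1; lra.
have iK v : lam.-integrable setT (EFin \o K v).
  exact: cont_supp_integrable (smooth1_continuous (sK v)) (Kv v).
have iUK v : 0 < v -> lam.-integrable setT (EFin \o (fun t => U t * K v t)).
  move=> v0; apply: (@cont_supp_integrable _ _ v (v + m)).
    apply: (mul_cut_continuous (fun s => @profile_continuous _ _ n0 u u_cont s) v0 (smooth1_continuous (sK v))) => t tv.
    by apply: Kv; left.
  by move=> t /Kv ->; rewrite mulr0.
have EI : \int[lam]_t K a t = I by rewrite /Rintegral KI.
have EI' : \int[lam]_t K b t = I' by rewrite /Rintegral KI'.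
have A1 : `|(\int[lam]_t (U t * K a t)) / I - U a| <= e / 2.
  apply: (weighted_average I0 (iUK a a0) (iK a) EI (K0 a) (Kv a)) => t tab.
  by apply: Ha; case/andP: tab => -> /= H; apply: (le_trans H); rewrite lerD2l.
have A2 : `|(\int[lam]_t (U t * K b t)) / I' - U b| <= e / 2.
  apply: (weighted_average I0' (iUK b (lt_trans a0 ab)) (iK b) EI' (K0 b) (Kv b)) => t tab.
  by apply: Hb; case/andP: tab => -> /= H; apply: (le_trans H); rewrite lerD2l.
have -> : \int[lam]_s (U s * (z^`()%classic) s) =
    (\int[lam]_t (U t * K a t)) / I - (\int[lam]_t (U t * K b t)) / I'.
  have b0 := lt_trans a0 ab.
  have e1 := RintegralZr I^-1 measurableT (iUK a a0).
  have e2' := RintegralZr I'^-1 measurableT (iUK b b0).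
  rewrite -e1 -e2' -(RintegralB measurableT (integrableZr measurableT I^-1 (iUK a a0))
    (integrableZr measurableT I'^-1 (iUK b b0))).
  by apply: eq_Rintegral => t _; rewrite (derive1_is dz) mulrBr !mulrA.
have -> : forall x y v w : R, x - y - (v - w) = (x - v) - (y - w) by move=> *; ring.
by apply: (le_trans (ler_normB _ _)); rewrite (splitr e) lerD.
Qed.

Lemma radial_part_integrable (a b : R) : 0 < a ->
  leb.-integrable setT (EFin \o (fun x => radial_part G x * \1_(rho @^-1` `[a, b]%classic) x)).
Proof.
move=> a0.
pose w (i : 'I_n) (x : 'rV[R]_n) : R := x ord0 i / (n%:R * rho x) * \1_(rho @^-1` `[a, b]%classic) x.
have mw i : measurable_fun setT (w i).
  apply: measurable_funM; last by apply: measurable_indic; exact: measurable_rho_itv.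
  apply: measurable_funM; first exact: measurable_coord.
  apply: measurable_funV_ge0; first by move=> x; rewrite mulr_ge0 ?vol_ge0// ltW.
  by apply: measurable_funM; [exact: measurable_cst|exact: measurable_vol].
have bw i : bsupp (w i) (radius b) (radius b / (n%:R * a)).
  split; first exact: mw.
    move=> x; rewrite /w indicE; case: (boolP (x \in _)) => [|_]; last first.
      rewrite mulr0 normr0 divr_ge0 ?mulr_ge0//; last exact: ltW.
      exact: powR_ge0.
    rewrite inE/= in_itv/= mulr1 => /andP[ax xb].
    have rx : 0 < rho x by exact: lt_le_trans a0 ax.
    have := rho_cube n0 xb i; rewrite -ler_norml => xr.
    rewrite normrM normfV (@ger0_norm _ (n%:R * rho x)); last by rewrite mulr_ge0// ltW.
    apply: ler_pM => //; first by rewrite invr_ge0 mulr_ge0// ltW.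
    have nr : 0 < n%:R * rho x by rewrite mulr_gt0.
    have na : 0 < n%:R * a by rewrite mulr_gt0.
    by rewrite lef_pV2 ?posrE// ler_wpM2l// ltW.
  move=> x xM; rewrite /w indicE memNset ?mulr0//= in_itv/= => /andP[_ xb].
  by apply: xM; exact: rho_cube.
have iw i := bsupp_mul_integrable (Lfun_locally_integrable (radius b) (ltW p1) (uG.1 i)) (bw i).
have [H _] := integrable_sum_Rintegral (index_enum 'I_n) iw.
rewrite (_ : (fun x => radial_part G x * _) = (fun x => \sum_i (G x ord0 i * w i x)))//.
apply/funext => x; rewrite /radial_part -mulrA mulr_suml; apply: eq_bigr => i _.
by rewrite /w !mulrA.
Qed.

(** The limit of [weak_gradient_radial] along the test functions of
  [increment_test]. *)
Lemma profile_increment (a b : R) : 0 < a -> a < b ->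
  U b - U a = \int[leb]_x (radial_part G x * \1_(rho @^-1` `]a, b]%classic) x).
Proof.
move=> a0 ab.
pose X x := radial_part G x * \1_(rho @^-1` `[a, b + 1]%classic) x.
have iX : leb.-integrable setT (EFin \o X) by exact: radial_part_integrable.
have Z k := increment_test a0 ab (ltac:(rewrite invr_gt0//) : 0 < k.+1%:R^-1 :> R).
have [z zP] := choice Z.
have zk1 k : (k.+1%:R : R)^-1 <= 1 by rewrite invf_le1// ler1n.
have zX k x : radial_part G x * z k (rho x) = X x * z k (rho x).
  rewrite /X indicE; case: (boolP (x \in _)) => [_|]; first by rewrite mulr1.
  rewrite notin_setE/= in_itv/= => H; have [_ z0 _ _ _] := zP k.
  rewrite z0 ?mulr0//; have [xa|ax] := leP (rho x) a; first by left.
  right; rewrite leNgt; apply/negP => xb; apply: H; rewrite (ltW ax)/=.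
  by apply/ltW; apply: (lt_le_trans xb); rewrite lerD2l.
have zlim (x : 'rV[R]_n) : z k (rho x) @[k --> \oo] --> (\1_(rho @^-1` `]a, b]%classic) x : R).
  rewrite indicE; case: (boolP (x \in _)) => [|].
    rewrite inE/= in_itv/= => /andP[ax xb].
    have d0 : 0 < rho x - a by rewrite subr_gt0.
    apply: (@cvg_trans _ ((fun=> 1 : R) @ \oo)); last exact: cvg_cst.
    apply: near_eq_cvg; have := near_infty_natSinv_lt (PosNum d0).
    apply: filterS => k /= kd; have [_ _ z1 _ _] := zP k.
    rewrite z1// xb andbT; move: (k.+1%:R^-1 : R) kd => d; lra.
  rewrite notin_setE/= in_itv/= => H.
  have [xa|ax] := leP (rho x) a.
    apply: (@cvg_trans _ ((fun=> 0 : R) @ \oo)); last exact: cvg_cst.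
    apply: near_eq_cvg; apply: nearW => k; have [_ z0 _ _ _] := zP k.
    by rewrite z0//; left.
  have d0 : 0 < rho x - b.
    by rewrite subr_gt0 ltNge; apply/negP => xb; apply: H; rewrite ax.
  apply: (@cvg_trans _ ((fun=> 0 : R) @ \oo)); last exact: cvg_cst.
  apply: near_eq_cvg; have := near_infty_natSinv_lt (PosNum d0).
  apply: filterS => k /= kd; have [_ z0 _ _ _] := zP k.
  rewrite z0//; right; move: (k.+1%:R^-1 : R) kd => d; lra.
have mz k : measurable_fun setT (fun x : 'rV[R]_n => z k (rho x)).
  have [sz _ _ _ _] := zP k.
  apply: (measurableT_comp (f := z k)); last exact: measurable_vol.
  by apply: continuous_measurable_fun; exact: smooth1_continuous.
have zb k (x : 'rV[R]_n) : `|z k (rho x)| <= 1.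
  by have [_ _ _ z01 _] := zP k; have /andP[? ?] := z01 (rho x); rewrite ger0_norm.
have lim1 := dct_bounded iX mz zb zlim.
have indX (x : 'rV[R]_n) : X x * \1_(rho @^-1` `]a, b]%classic) x = radial_part G x * \1_(rho @^-1` `]a, b]%classic) x.
  rewrite /X !indicE; case: (boolP (x \in rho @^-1` `]a, b]%classic)) => [|]; last by rewrite !mulr0.
  rewrite inE/= in_itv/= => /andP[ax xb]; rewrite mem_set ?mulr1//= in_itv/= (ltW ax)/=.
  lra.
have intb : leb.-integrable setT (EFin \o (fun x => X x * \1_(rho @^-1` `]a, b]%classic) x)).
  have := integrableMl measurableT iX (measurable_indic (measurable_rho_itv `]a, b])).
  apply; exists 1; split; first exact: num_real.
  move=> y y1 x _ /=; rewrite indicE; case: (x \in _); rewrite ?normr1 ?normr0; [exact: ltW|lra].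
under eq_Rintegral do rewrite -indX.
have lim2 : \int[leb]_x (X x * z k (rho x)) @[k --> \oo] -->
    \int[leb]_x (X x * \1_(rho @^-1` `]a, b]%classic) x).
  have fin : (\int[leb]_x (X x * \1_(rho @^-1` `]a, b]%classic) x)%:E)%E \is a fin_num.
    exact: (integrable_fin_num measurableT intb).
  by apply: fine_cvg; rewrite fineK.
have lim3 : \int[leb]_x (X x * z k (rho x)) @[k --> \oo] --> U b - U a.
  apply/cvgrPdist_le => e e0; have := near_infty_natSinv_lt (PosNum e0).
  apply: filterS => k /= ke; have [sz z0 _ _ zi] := zP k.
  have zab t : t <= a \/ b + k.+1%:R^-1 <= t -> z k t = 0 by exact: z0.
  have := weak_gradient_radial n0 p1 uL uG sz a0 zab.
  under [X in _ = - X -> _]eq_Rintegral do rewrite zX.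
  move=> H.
  have Hz2 : forall t, t <= a / 2 \/ b + 2 <= t -> ((z k)^`()%classic) t = 0.
    move=> t tab; apply: (derive1_support sz zab).
    have := zk1 k; move: (k.+1%:R^-1 : R) => d d1.
    by case: tab => tt; [left|right]; lra.
  have Hz : forall t, t <= a / 2 -> ((z k)^`()%classic) t = 0.
    by move=> t ta; apply: Hz2; left.
  have a2 : 0 < a / 2 by lra.
  have cz : continuous (z k)^`()%classic by exact: smooth1_continuous (smooth1_derive sz).
  have iU : lam.-integrable setT (EFin \o (fun s => U s * ((z k)^`()%classic) s)).
    apply: (@cont_supp_integrable _ _ (a / 2) (b + 2)).
      exact: (mul_cut_continuous (fun s => @profile_continuous _ _ n0 u u_cont s) a2 cz Hz).
    by move=> t /Hz2 ->; rewrite mulr0.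
  have EU : \int[leb]_x (u x * ((z k)^`()%classic) (rho x)) =
      \int[lam]_s (U s * ((z k)^`()%classic) s).
    under eq_Rintegral do rewrite (profile_rho n0 u_radial).
    apply: (Rintegral_rho n0 iU) => s s0; rewrite Hz ?mulr0//; lra.
  have -> : \int[leb]_x (X x * z k (rho x)) = - \int[lam]_s (U s * ((z k)^`()%classic) s).
    by rewrite -EU H opprK.
  rewrite (_ : U b - U a - _ = \int[lam]_s (U s * ((z k)^`()%classic) s) - (U a - U b)); last by ring.
  exact: le_trans zi (ltW ke).
exact: (cvg_unique _ lim3 lim2).
Qed.

End profile_increments.

(** * Absolute continuity of the profile *)

Lemma charge_density d (T : measurableType d) (R : realType)
  (nu : {charge set T -> \bar R}) (mu : {sigma_finite_measure set T -> \bar R}) :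
  (forall A, measurable A -> mu A = 0 -> nu A = 0)%E ->
  exists h : T -> R, mu.-integrable setT (EFin \o h) /\
    forall A, measurable A -> (nu A = \int[mu]_(x in A) (h x)%:E)%E.
Proof.
move=> H; have numu : null_dominates mu nu by apply/null_content_dominatesP => A; exact: H.
exists (fine \o Radon_Nikodym nu mu).
have RNE : EFin \o (fine \o Radon_Nikodym nu mu) = Radon_Nikodym nu mu.
  by apply/funext => s /=; rewrite fineK// Radon_Nikodym_fin_num.
split; first by rewrite RNE; exact: Radon_Nikodym_integrable.
move=> A mA; rewrite (Radon_Nikodym_integral numu mA); apply: eq_integral => s _.
by rewrite /= fineK// Radon_Nikodym_fin_num.
Qed.

Section density.
Context {R : realType} {n : nat}.
Hypothesis n0 : (0 < n)%N.
Local Notation leb := (lebesgue_rV R n).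
Local Notation lam := (@lebesgue_measure R).
Local Notation rho := (vol (unit_vol n : R)).

(** The conditional expectation of [X] given [rho], obtained as a
  Radon-Nikodym derivative of the image under [rho] of the measure of density
  [X]. *)
Lemma conditional_density (X : 'rV[R]_n -> R) : leb.-integrable setT (EFin \o X) ->
  exists h : R -> R, lam.-integrable setT (EFin \o h) /\
    forall A : set (measurableTypeR R), measurable A ->
      (\int[leb]_(x in rho @^-1` A) (X x)%:E = \int[lam]_(s in A) (h s)%:E)%E.
Proof.
move=> iX; have mrho : measurable_fun setT (rho : 'rV[R]_n -> measurableTypeR R).
  exact: measurable_vol.
pose nu := measure_function_pushforward__canonical__charge_Charge
  (charge_induced_charge__canonical__charge_Charge iX) mrho.
suff H (A : set (measurableTypeR R)) : measurable A -> lebesgue_measure A = 0%E -> nu A = 0%E.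
  have [h [ih hE]] := @charge_density _ (measurableTypeR R) R nu lebesgue_measure H.
  by exists h.
move=> mA A0; rewrite /nu/= /pushforward/= /induced_charge.
apply: null_set_integral.
- by rewrite -[X in measurable X]setTI; exact: measurable_vol.
- by apply: measurable_funTS; exact: measurable_int iX.
have mE : measurable (`[0, +oo[%classic : set (measurableTypeR R)) by exact: measurable_itv.
rewrite (_ : rho @^-1` A = rho @^-1` (A `&` `[0, +oo[%classic)); last first.
  by apply/seteqP; split=> [x Ax|x []//]; split=> //; rewrite /= in_itv/= vol_ge0.
have := @image_vol R n n0 _ (measurableI _ _ mA mE) (@subIsetr _ _ _).
rewrite /pushforward => H. apply: (etrans H); apply/eqP; rewrite eq_le measure_ge0 andbT.
by rewrite -A0; apply: le_measure => //; rewrite inE//; exact: measurableI.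
Qed.
End density.

Section shell_density.
Context {R : realType} {n : nat} (p : R).
Hypotheses (n0 : (0 < n)%N) (p1 : 1 < p).
Local Notation leb := (lebesgue_rV R n).
Local Notation lam := (@lebesgue_measure R).
Local Notation c := (unit_vol n : R).
Local Notation rho := (vol (unit_vol n : R)).
Local Notation radius := (ball_radius n%:R (unit_vol n : R)).
Context (u : 'rV[R]_n -> R) (G : 'rV[R]_n -> 'rV[R]_n).
Hypotheses (uL : u \in Lfun leb p%:E) (uG : is_weak_gradient p u G).
Hypothesis u_radial : radial u.
Hypothesis u_cont : forall x, x != 0 -> {for x, continuous u}.
Local Notation U := (profile n0 u).

(** The density of [U] is the conditional expectation of the radial part of
  the weak gradient. *)
Lemma profile_density (s1 s2 : R) : 0 < s1 ->
  exists h : R -> R, lam.-integrable setT (EFin \o h) /\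
    forall a b, s1 <= a -> a < b -> b <= s2 ->
      U b - U a = \int[lam]_(s in `]a, b]) h s.
Proof.
move=> s10; have [h [ih hE]] := conditional_density n0 (radial_part_integrable n0 p1 uG s2 s10).
exists h; split=> // a b sa ab bs; have a0 : 0 < a by exact: lt_le_trans s10 sa.
rewrite (profile_increment n0 p1 uL uG u_radial u_cont a0 ab) /Rintegral -hE; last exact: measurable_itv.
rewrite [in RHS]integral_mkcond; congr fine; apply: eq_integral => x _.
rewrite patchE indicE; case: ifPn => [xab|]; last by rewrite mulr0.
rewrite indicE (_ : x \in rho @^-1` `[s1, s2]%classic) ?mulr1//.
move: xab; rewrite !inE/= !in_itv/= => /andP[ax xb].
by rewrite (le_trans sa (ltW ax)) (le_trans xb bs).
Qed.

End shell_density.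

Section antiderivatives.
Context {R : realType}.
Local Notation lam := (@lebesgue_measure R).

Lemma continuous_integrable (g : R -> R) (a b : R) : continuous g ->
  lam.-integrable `[a, b] (EFin \o g).
Proof.
by move=> cg; apply: continuous_compact_integrable; [exact: segment_compact|exact: continuous_subspaceT].
Qed.

Lemma is_derive_integral (g : R -> R) (a t : R) : continuous g -> a < t ->
  is_derive t 1 (fun t => \int[lam]_(s in `[a, t]) g s) (g t).
Proof.
move=> cg at_; have tt : t < t + 1 by rewrite ltrDl.
have [] := @continuous_FTC1_closed R g a t (t + 1) tt (continuous_integrable a (t + 1) cg) at_ (cg t).
by rewrite derive1E => dF <-; exact: derivableP.
Qed.

(** The factor [z] hides the end point of the domain of the antiderivative. *)
Lemma is_derive_integral_mul (g z : R -> R) (K a t : R) : continuous g -> Ck1 1 z ->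
  (forall t, t <= a + 1 -> z t = 0) ->
  is_derive t 1 (fun t => (K + \int[lam]_(s in `[a, t]) g s) * z t)
    (g t * z t + (K + \int[lam]_(s in `[a, t]) g s) * (z^`()%classic) t).
Proof.
move=> cg cz z0; have [ta|at_] := ltP t (a + 1).
  rewrite z0 ?(ltW ta)// (Ck1_vanish cz z0 ta) !mulr0 addr0.
  apply: (@near_eq_is_derive _ _ _ (fun=> 0 : R)).
  by near=> t'; rewrite z0 ?mulr0//; apply/ltW; near: t'; apply: lt_nbhsl.
have at' : a < t by rewrite (lt_le_trans _ at_)// ltrDl.
apply: isd_eq (isdM (isdD (isd_cst K t) (is_derive_integral cg at')) (Ck1_is_derive cz t)) _.
by rewrite add0r addrC mulrC.
Unshelve. all: by end_near. Qed.

Lemma Ck1_integral_mul (g z : R -> R) (K a : R) : continuous g -> Ck1 1 z ->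
  (forall t, t <= a + 1 -> z t = 0) ->
  Ck1 1 (fun t => (K + \int[lam]_(s in `[a, t]) g s) * z t).
Proof.
move=> cg cz z0; have D t := is_derive_integral_mul K t cg cz z0.
apply: (Ck1S D).
split=> //.
have cdz : continuous z^`()%classic by have [_ [_ []]] := cz.
move=> t; have [ta|at_] := ltP t (a + 1).
  apply: (@near_eq_continuous _ _ (fun=> 0)); last exact: cst_continuous.
  near=> t'; have ta' : t' < a + 1 by near: t'; apply: lt_nbhsl.
  by rewrite z0 ?(ltW ta')// (Ck1_vanish cz z0 ta') !mulr0 addr0.
have at' : a < t by rewrite (lt_le_trans _ at_)// ltrDl.
have cI := derive_continuous (isdD (isd_cst K t) (is_derive_integral cg at')).
have := cvgD (cvgM (cg t) ((Ck1_continuous cz : continuous z) t)) (cvgM cI (cdz t)); exact.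
Unshelve. all: by end_near. Qed.

End antiderivatives.

(** * The weak gradient of a radial function is radial *)

Lemma integrable_mul_bounded d (T : measurableType d) (R : realType)
  (mu : {measure set T -> \bar R}) (X w : T -> R) (K : R) :
  mu.-integrable setT (EFin \o X) -> measurable_fun setT w -> (forall x, `|w x| <= K) ->
  mu.-integrable setT (EFin \o (fun x => X x * w x)).
Proof.
move=> iX mw wK; apply: (integrableMl measurableT iX mw).
exists K; split; first exact: num_real.
by move=> y Ky x _ /=; apply: le_trans (wK x) _; exact: ltW.
Qed.

Section approximation.
Context {R : realType}.
Local Notation lam := (@lebesgue_measure R).

Lemma continuous_approximation (h : R -> R) (a b e : R) :
  lam.-integrable setT (EFin \o h) -> 0 < e ->
  exists g : R -> R, [/\ continuous g,
    lam.-integrable setT (EFin \o (fun t => `|g t - h t| * \1_`[a, b] t)) &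
    \int[lam]_t (`|g t - h t| * \1_`[a, b] t) <= e].
Proof.
move=> ih e0; have mI : measurable (`[a, b]%classic : set (measurableTypeR R)).
  exact: measurable_itv.
have ihI : lam.-integrable `[a, b] (EFin \o h).
  exact: (@integrableS _ (measurableTypeR R) R lam setT).
have fin : (lam `[a, b]%classic < +oo)%E by rewrite lebesgue_measure_itv; case: ifP; rewrite ?ltry.
have [g_ [cg ig gh]] := @approximation_continuous_integrable R `[a, b] h mI fin ihI.
have : \forall k \near \oo, (\int[lam]_(z in `[a, b]) `|(h z - g_ k z)%:E| < e%:E)%E.
  have H : nbhs (0 : \bar R)%E [set y | (y < e%:E)%E].
    by apply: open_ereal_lt'; rewrite lte_fin.
  exact: gh _ H.
move=> [k _ /(_ k (leqnn k))/= ke]; exists (g_ k).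
have E : EFin \o (fun t => `|g_ k t - h t| * \1_`[a, b] t) =
    (fun t => `|(h t - g_ k t)%:E|%E) \_ `[a, b].
  apply/funext => t; rewrite patchE /= indicE; case: ifPn => _.
    by rewrite mulr1 distrC.
  by rewrite mulr0.
have iE : lam.-integrable `[a, b] (fun t => `|(h t - g_ k t)%:E|%E).
  have iB := @integrableB _ (measurableTypeR R) R lam _ mI _ _ ihI (ig k).
  exact: (@integrable_abse _ (measurableTypeR R) _ _ _ _ iB).
split => //.
  by rewrite E; apply: (iffLR (@integrable_mkcond _ (measurableTypeR R) R lam _ _ mI)).
rewrite /Rintegral.
have -> : (\int[lam]_t (`|g_ k t - h t| * \1_`[a, b] t)%:E =
    \int[lam]_(z in `[a, b]) `|(h z - g_ k z)%:E|)%E.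
  by rewrite [RHS]integral_mkcond -E.
have f : (\int[lam]_(z in `[a, b]) `|(h z - g_ k z)%:E|)%E \is a fin_num.
  exact: (@integrable_fin_num _ (measurableTypeR R)).
by rewrite -lee_fin fineK// ltW.
Qed.

End approximation.

Section shell_gradient.
Context {R : realType} {n : nat}.
Hypothesis n0 : (0 < n)%N.
Local Notation leb := (lebesgue_rV R n).
Local Notation lam := (@lebesgue_measure R).
Local Notation c := (unit_vol n : R).
Local Notation rho := (vol (unit_vol n : R)).
Local Notation radius := (ball_radius n%:R (unit_vol n : R)).

Let c0 : 0 < c. Proof. exact: unit_vol_gt0. Qed.
Let nR : (0 : R) < n%:R. Proof. by rewrite ltr0n. Qed.

Lemma sqn_gt0_rho (x : 'rV[R]_n) : 0 < rho x -> 0 < sqn x.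
Proof.
move=> r0; rewrite lt_neqAle sqn_ge0 andbT; apply/eqP => s0.
by move: r0; rewrite rho0// ltxx.
Qed.

Lemma enorm_grad_vol (x : 'rV[R]_n) : 0 < rho x ->
  enorm (\row_i grad_vol c x i) = sphere_area n%:R c (rho x).
Proof.
move=> r0; have s0 := sqn_gt0_rho r0; have e0 : 0 < enorm x by rewrite sqrtr_gt0.
rewrite /sphere_area radius_rho// {1}/enorm.
under eq_bigr do rewrite mxE /grad_vol exprMn.
rewrite -mulr_sumr -/(sqn x) -enorm_sqr -exprMn sqrtr_sqr ger0_norm.
  by field; rewrite gt_eqF.
apply: mulr_ge0; last exact: ltW.
apply: mulr_ge0; first by rewrite mulr_ge0 ?ltW.
by rewrite invr_ge0 ?exprn_ge0 ?ltW.
Qed.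

(** The restriction to a shell of a partial derivative of [rho]. *)
Definition shell_grad (s1 s2 : R) (i : 'I_n) (x : 'rV[R]_n) : R :=
  grad_vol c x i * \1_(rho @^-1` `[s1, s2]%classic) x.

Lemma shell_grad_bsupp (s1 s2 : R) i : 0 < s1 -> s1 <= s2 ->
  exists K, bsupp (shell_grad s1 s2 i) (radius s2) K.
Proof.
move=> s10 s12; exists (n%:R * s2 / radius s1); split.
- apply: measurable_funM; last by apply: measurable_indic; exact: measurable_rho_itv.
  apply: measurable_funM; last exact: measurable_coord.
  apply: measurable_funM.
    by apply: measurable_funM; [exact: measurable_cst|exact: measurable_vol].
  by apply: measurable_funV_ge0; [exact: sqn_ge0|exact: measurable_sqn].
- move=> x; rewrite /shell_grad indicE; case: (boolP (x \in _)) => [|H].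
    rewrite inE/= in_itv/= mulr1 => /andP[ax xb].
    have r0 : 0 < rho x by exact: lt_le_trans s10 ax.
    have s0 := sqn_gt0_rho r0; have e0 : 0 < enorm x by rewrite sqrtr_gt0.
    apply: (@le_trans _ _ (enorm (\row_i grad_vol c x i))).
      rewrite -sqrtr_sqr ler_wsqrtr//.
      have := coord_sqn (\row_i grad_vol c x i) i; rewrite mxE; exact.
    rewrite enorm_grad_vol// /sphere_area.
    have r1 := radius_gt0 n0 s10; have rr : radius s1 <= radius (rho x).
      apply: powR_le2r; [by rewrite invr_ge0|by rewrite divr_ge0// ltW|].
      by rewrite ler_pM2r// invr_gt0.
    apply: ler_pM.
    - by rewrite mulr_ge0 ?ltW.
    - by rewrite invr_ge0; apply/ltW; exact: radius_gt0.
    - by rewrite ler_wpM2l// ltW.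
    by rewrite lef_pV2 ?posrE//; exact: lt_le_trans rr.
  by rewrite mulr0 normr0 divr_ge0 ?powR_ge0// mulr_ge0// (le_trans _ s12)// ltW.
- move=> x xM; rewrite /shell_grad indicE memNset ?mulr0//= in_itv/= => /andP[_ xb].
  by apply: xM; exact: rho_cube.
Qed.

End shell_gradient.

Section gradient_test.
Context {R : realType} {n : nat} (p : R).
Hypotheses (n0 : (0 < n)%N) (p1 : 1 < p).
Local Notation leb := (lebesgue_rV R n).
Local Notation lam := (@lebesgue_measure R).
Local Notation c := (unit_vol n : R).
Local Notation rho := (vol (unit_vol n : R)).
Local Notation radius := (ball_radius n%:R (unit_vol n : R)).
Context (u : 'rV[R]_n -> R) (G : 'rV[R]_n -> 'rV[R]_n).
Hypotheses (uL : u \in Lfun leb p%:E) (uG : is_weak_gradient p u G).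
Hypothesis u_radial : radial u.
Hypothesis u_cont : forall x, x != 0 -> {for x, continuous u}.
Local Notation U := (profile n0 u).
Context (s1 s2 : R) (h : R -> R).
Hypotheses (s10 : 0 < s1) (s12 : s1 < s2).
Hypothesis ih : lam.-integrable setT (EFin \o h).
Hypothesis hU : forall a b, s1 <= a -> a < b -> b <= s2 ->
  U b - U a = \int[lam]_(s in `]a, b]) h s.

(** Replacing [h] by a continuous function replaces [U] by a continuously
  differentiable function that is close to it. *)
Lemma profile_approximation (e : R) : 0 < e ->
  exists (g : R -> R) (K : R), [/\ continuous g,
    lam.-integrable setT (EFin \o (fun t => `|g t - h t| * \1_`[s1, s2] t)),
    \int[lam]_t (`|g t - h t| * \1_`[s1, s2] t) <= e &
    forall t, s1 <= t <= s2 ->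
      `|K + \int[lam]_(s in `[s1 - 1, t]) g s - U t| <= e].
Proof.
move=> e0; have [g [cg ig ge]] := continuous_approximation s1 s2 ih e0.
exists g, (U s1 - \int[lam]_(s in `[s1 - 1, s1]) g s); split=> // t /andP[st ts].
have [->|s1t] := eqVneq t s1; first by rewrite subrK subrr normr0 ltW.
have {}s1t : s1 < t by rewrite lt_neqAle eq_sym s1t.
have mI (i : interval R) : measurable ([set` i] : set (measurableTypeR R)) by exact: measurable_itv.
have ihI : lam.-integrable `]s1, t] (EFin \o h).
  exact: (@integrableS _ (measurableTypeR R) R lam setT).
have igI : lam.-integrable `]s1, t] (EFin \o g).
  apply: (@integrableS _ (measurableTypeR R) R lam `[s1, t]) => //.
    exact: subset_itv_oc_cc.
  exact: continuous_integrable.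
have split_g : \int[lam]_(s in `[s1 - 1, t]) g s =
    \int[lam]_(s in `[s1 - 1, s1]) g s + \int[lam]_(s in `]s1, t]) g s.
  rewrite (_ : `[s1 - 1, t]%classic = `[s1 - 1, s1]%classic `|` `]s1, t]%classic); last first.
    by rewrite -itv_bndbnd_setU// bnd_simp ?gerBl ?ltW.
  rewrite (@Rintegral_setU _ (measurableTypeR R) R lam)//.
    rewrite -itv_bndbnd_setU// ?bnd_simp ?gerBl ?ltW//; exact: continuous_integrable.
  apply/disj_setPLR => s /=; rewrite !in_itv/= => /andP[_ ss] /andP[]; lra.
have -> : U s1 - \int[lam]_(s in `[s1 - 1, s1]) g s + \int[lam]_(s in `[s1 - 1, t]) g s - U t =
    \int[lam]_(s in `]s1, t]) (g s - h s).
  rewrite (@RintegralB _ (measurableTypeR R) R lam)// -(hU (lexx _) s1t ts) split_g; ring.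
have iB := @integrableB _ (measurableTypeR R) R lam _ (mI _) _ _ igI ihI.
apply: (le_trans (@le_normr_Rintegral _ (measurableTypeR R) R lam _ _ (mI _) iB)).
apply: le_trans ge; rewrite [leLHS](@Rintegral_mkcond _ (measurableTypeR R) R lam).
apply: (@le_Rintegral _ (measurableTypeR R) R lam) => //.
  rewrite -(@restrict_EFin _ _ _ _) .
  apply: (iffLR (@integrable_mkcond _ (measurableTypeR R) R lam _ _ (mI _))).
  exact: (@integrable_abse _ (measurableTypeR R) _ _ _ _ iB).
move=> s _; rewrite patchE indicE; case: ifPn => [|_]; last by rewrite mulr_ge0.
rewrite inE/= in_itv/= => /andP[a b]; rewrite mem_set ?mulr1//= in_itv/= (ltW a)/=.
exact: le_trans b ts.
Qed.

End gradient_test.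

Section gradient_test.
Context {R : realType} {n : nat} (p : R).
Hypotheses (n0 : (0 < n)%N) (p1 : 1 < p).
Local Notation leb := (lebesgue_rV R n).
Local Notation lam := (@lebesgue_measure R).
Local Notation c := (unit_vol n : R).
Local Notation rho := (vol (unit_vol n : R)).
Local Notation radius := (ball_radius n%:R (unit_vol n : R)).
Context (u : 'rV[R]_n -> R) (G : 'rV[R]_n -> 'rV[R]_n).
Hypotheses (uL : u \in Lfun leb p%:E) (uG : is_weak_gradient p u G).
Hypothesis u_radial : radial u.
Hypothesis u_cont : forall x, x != 0 -> {for x, continuous u}.
Local Notation U := (profile n0 u).
Context (s1 s2 : R) (h : R -> R).
Hypotheses (s10 : 0 < s1) (s12 : s1 < s2).
Hypothesis ih : lam.-integrable setT (EFin \o h).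
Hypothesis hU : forall a b, s1 <= a -> a < b -> b <= s2 ->
  U b - U a = \int[lam]_(s in `]a, b]) h s.
Local Notation w := (shell_grad s1 s2).

Let c0 : 0 < c. Proof. exact: unit_vol_gt0. Qed.

Section test.
Context (z : R -> R) (Q : 'rV[R]_n -> R).
Hypotheses (sz : smooth1 z) (z0 : forall t, t <= s1 \/ s2 <= t -> z t = 0).
Hypothesis sQ : smooth Q.
Let phi x := z (rho x) * Q x.

Let zl t : t <= s1 -> z t = 0. Proof. by move=> ts; apply: z0; left. Qed.
Let dz0 t : t < s1 \/ s2 < t -> (z^`()%classic) t = 0.
Proof. exact: derive1_support. Qed.

Let sphi : smooth phi.
Proof. by move=> k; apply: CkM; [exact: Ck_vol s10 zl (sz k)|exact: sQ]. Qed.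

Lemma shell_test0 x : ~ cube (radius s2) x -> z (rho x) * Q x = 0.
Proof.
move=> xM; rewrite z0 ?mul0r//; right; rewrite leNgt; apply/negP => xs.
by apply: xM; apply: (rho_cube n0); exact: ltW.
Qed.

Lemma shell_test : test_function (fun x => z (rho x) * Q x).
Proof. exact: compact_support_test sphi shell_test0. Qed.

Lemma isdv_shell_test i x : is_derive x (delta_mx ord0 i) (fun x => z (rho x) * Q x)
  (z (rho x) * partial i Q x + Q x * ((z^`()%classic) (rho x) * grad_vol c x i)).
Proof.
have H := isdv_vol n0 c0 i x s10 zl (sz 1%N).
exact: (isdvM H (Ck_is_derive i x (sQ 1%N))).
Qed.

(** Were [U] of class C^1, this would be the divergence theorem for [u * phi],
  where [phi] is the test function [z (rho x) * Q x]. It is applied to the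
  approximations [H] of [U] with continuous derivative [g]; the error is small
  because [g] is close to [h] in mean and [H] to [U] uniformly. *)
Lemma gradient_test i :
  \int[leb]_x ((G x ord0 i - h (rho x) * w i x) * (z (rho x) * Q x)) = 0.
Proof.
have p1' : 1 <= p by exact: ltW.
have [Kp Hp] := continuous_bsupp (Ck_continuous (sphi 0%N)) shell_test0.
have [Kd Hd] := continuous_bsupp (Ck_continuous (Ck_partial i (sphi 1%N)))
  (partial_support i shell_test0).
have [Kw Hw] := shell_grad_bsupp n0 i s10 (ltW s12).
have [mp bp _] := Hp; have [mw bw w0] := Hw; have [md bd _] := Hd.
have mwp : measurable_fun setT (fun x => w i x * phi x) by exact: measurable_funM.
have bwp x : `|w i x * phi x| <= Kw * Kp by rewrite normrM ler_pM.
have i1 : leb.-integrable setT (EFin \o (fun x => G x ord0 i * phi x)).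
  exact: (bsupp_mul_integrable (Lfun_locally_integrable _ p1' (uG.1 i)) Hp).
have i2 : leb.-integrable setT (EFin \o (fun x => u x * partial i phi x)).
  exact: (bsupp_mul_integrable (Lfun_locally_integrable _ p1' uL) Hd).
have i3 : leb.-integrable setT (EFin \o (fun x => h (rho x) * (w i x * phi x))).
  exact: (integrable_mul_bounded (integrable_rho n0 ih) mwp bwp).
have GU : \int[leb]_x (u x * partial i phi x) = - \int[leb]_x (G x ord0 i * phi x).
  by apply: fineN_Rintegral; apply: uG.2; exact: shell_test.
have -> : (fun x => (G x ord0 i - h (rho x) * w i x) * phi x) =
    (fun x => G x ord0 i * phi x - h (rho x) * (w i x * phi x)).
  by apply/funext => x; ring.
rewrite RintegralB//; set I := (X in X = 0).
pose B := \int[leb]_x `|partial i phi x| + Kw * Kp.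
have iB : leb.-integrable setT (EFin \o (fun x => `|partial i phi x|)).
  exact: (integrable_abse (bsupp_integrable Hd)).
suff H e : 0 < e -> `|I| <= e * B.
  have B0 : 0 <= B.
    rewrite addr_ge0//; first by apply: Rintegral_ge0.
    exact: le_trans (normr_ge0 _) (bwp 0).
  apply/eqP; rewrite -normr_le0; apply/ler_addgt0Pr => e e0; rewrite add0r.
  have B1 : 0 < B + 1 by rewrite ltr_wpDl.
  apply: (le_trans (H (e / (B + 1)) _)); first by rewrite divr_gt0.
  by rewrite mulrAC ler_pdivrMr// ler_pM2l// lerDl.
move=> e0; have [g [K [cg ig ge HU]]] := profile_approximation ih hU e0.
pose H t := K + \int[lam]_(s in `[s1 - 1, t]) g s.
have zl1 t : t <= s1 - 1 + 1 -> z t = 0 by rewrite subrK; exact: zl.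
pose y t := H t * z t.
have Cy : Ck1 1 y by exact: Ck1_integral_mul cg (sz 1%N) zl1.
have yl t : t <= s1 -> y t = 0 by move=> ts; rewrite /y zl ?mulr0.
have dy (t : R) : is_derive t 1 y (g t * z t + H t * (z^`()%classic) t).
  exact: is_derive_integral_mul cg (sz 1%N) zl1.
pose F x := y (rho x) * Q x.
have CF : Ck 1 F by apply: CkM; [exact: Ck_vol s10 yl Cy|exact: sQ].
have F0 x : ~ cube (radius s2) x -> F x = 0.
  by move=> /shell_test0 E; rewrite /F /y -mulrA E mulr0.
have outw x : w i x * phi x = grad_vol c x i * phi x.
  rewrite /shell_grad indicE; case: (boolP (x \in _)); first by rewrite mulr1.
  rewrite notin_setE/= in_itv/= => E; rewrite /phi z0 ?mul0r ?mulr0//.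
  have [?|E1] := leP (rho x) s1; [by left|right].
  by rewrite leNgt; apply/negP => E2; apply: E; rewrite (ltW E1) ltW.
have dF : partial i F = fun x => g (rho x) * (w i x * phi x) + H (rho x) * partial i phi x.
  apply: partialE => x.
  have H1 := isdvM (isdv_vol n0 c0 i x s10 yl Cy) (Ck_is_derive i x (sQ 1%N)).
  apply: (isdv_eq H1); rewrite outw (partialE (isdv_shell_test i)) (derive1_is dy).
  by rewrite /phi /y; ring.
have [Ke He] := continuous_bsupp (Ck_continuous (Ck_partial i CF)) (partial_support i F0).
have iF := bsupp_integrable He.
have IF : \int[leb]_x partial i F x = 0.
  rewrite /Rintegral (integral_partial0 (M := radius s2))//.
  - exact: Ck_continuous CF.
  - by move=> x; have [] := Ck_is_derive i x CF.
  - exact: Ck_continuous (Ck_partial i CF).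
have -> : I = \int[leb]_x (partial i F x - u x * partial i phi x - h (rho x) * (w i x * phi x)).
  rewrite RintegralB//; last exact: (integrableB measurableT iF i2).
  by rewrite RintegralB// IF sub0r GU opprK.
have iT := integrableB measurableT (integrableB measurableT iF i2) i3.
apply: (le_trans (le_normr_Rintegral measurableT iT)).
have igr := integrable_rho n0 ig.
have -> : e * B = e * \int[leb]_x `|partial i phi x| + Kw * Kp * e by rewrite /B; ring.
apply: (@le_trans _ _ (\int[leb]_x (e * `|partial i phi x| +
    Kw * Kp * (`|g (rho x) - h (rho x)| * \1_`[s1, s2] (rho x))))); last first.
  rewrite RintegralD//; last 2 first.
  - exact: (integrableZl measurableT e iB).
  - exact: (integrableZl measurableT (Kw * Kp) igr).
  rewrite RintegralZl// RintegralZl// lerD2l ler_wpM2l//; first exact: le_trans (normr_ge0 _) (bwp 0).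
  rewrite (Rintegral_rho n0 ig)// => s s0; rewrite indicE memNset ?mulr0//= in_itv/= => /andP[ss _].
  by have := lt_le_trans s10 ss; rewrite ltNge (ltW s0).
apply: le_Rintegral => //.
- exact: (integrable_abse iT).
- exact: (integrableD measurableT (integrableZl measurableT e iB)
    (integrableZl measurableT (Kw * Kp) igr)).
move=> x _; rewrite dF.
have -> : g (rho x) * (w i x * phi x) + H (rho x) * partial i phi x - u x * partial i phi x -
    h (rho x) * (w i x * phi x) = (H (rho x) - u x) * partial i phi x +
      (g (rho x) - h (rho x)) * (w i x * phi x) by ring.
have [xs|xs] := pselect (s1 <= rho x <= s2).
  apply: (le_trans (ler_normD _ _)); rewrite (normrM (H _ - _)) (normrM (g _ - _)).
  apply: lerD.
    by rewrite ler_wpM2r// (profile_rho n0 u_radial); exact: HU.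
  have -> : \1_`[s1, s2] (rho x) = 1 :> R by rewrite indicE mem_set//= in_itv.
  by rewrite mulr1 mulrC; apply: ler_wpM2r.
have p0 : phi x = 0.
  rewrite /phi z0 ?mul0r//; have [?|E1] := leP (rho x) s1; [by left|right].
  by rewrite leNgt; apply/negP => E2; apply: xs; rewrite (ltW E1) ltW.
rewrite p0 !mulr0 addr0 (_ : partial i phi x = 0) ?mulr0 ?normr0.
  by rewrite mulr0 add0r indicE memNset ?mulr0//= in_itv.
rewrite (partialE (isdv_shell_test i)) dz0 ?mul0r ?mulr0 ?addr0.
  rewrite z0 ?mul0r//; have [?|E1] := leP (rho x) s1; [by left|right].
  by rewrite leNgt; apply/negP => E2; apply: xs; rewrite (ltW E1) ltW.
have [?|E1] := ltP (rho x) s1; [by left|right].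
by rewrite ltNge; apply/negP => E2; apply: xs; rewrite E1 E2.
Qed.

End test.
End gradient_test.

Section products.
Context {R : realType} {n : nat}.

Lemma cvg_prod_seq (I : Type) (s : seq I) (f : I -> nat -> R) (l : I -> R) :
  (forall i, f i j @[j --> \oo] --> l i) ->
  (\prod_(i <- s) f i j) @[j --> \oo] --> \prod_(i <- s) l i.
Proof.
move=> fl; elim: s => [|i s IH].
  by rewrite big_nil; under eq_fun do rewrite big_nil; exact: cvg_cst.
rewrite big_cons; under eq_fun do rewrite big_cons.
have := cvgM (fl i) IH; exact.
Qed.

Lemma indic_box (a b : 'I_n -> R) (x : 'rV[R]_n) :
  \1_(box a b) x = \prod_i \1_`[a i, b i] (x ord0 i) :> R.
Proof.
have [xab|xab] := pselect (box a b x).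
  rewrite indicE mem_set// big1// => i _; rewrite indicE mem_set//= in_itv/=.
  exact: xab.
rewrite indicE memNset//; have /existsNP[i xi] := xab.
by rewrite (bigD1 i)//= indicE memNset ?mul0r//= in_itv.
Qed.

Definition box_plateau (j : nat) (a b : 'I_n -> R) (x : 'rV[R]_n) : R :=
  \prod_i plateau j (a i) (b i) (x ord0 i).

Lemma smooth_box_plateau j a b : smooth (box_plateau j a b).
Proof.
by move=> k; apply: Ck_prod => i; apply: Ck_comp1; [exact: smooth1_plateau|exact: Ck_coord].
Qed.

Lemma box_plateau_le1 j a b x : `|box_plateau j a b x| <= 1.
Proof.
rewrite normr_prod; apply: prodr_ile1 => i _; rewrite normr_ge0/=.
by have /andP[? ?] := plateau_range j (a i) (b i) (x ord0 i); rewrite ger0_norm.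
Qed.

Lemma box_plateau_cvg a b x : box_plateau j a b x @[j --> \oo] --> (\1_(box a b) x : R).
Proof. by rewrite indic_box; apply: cvg_prod_seq => i; exact: plateau_cvg. Qed.

End products.

Section gradient_shell.
Context {R : realType} {n : nat} (p : R).
Hypotheses (n0 : (0 < n)%N) (p1 : 1 < p).
Local Notation leb := (lebesgue_rV R n).
Local Notation lam := (@lebesgue_measure R).
Local Notation c := (unit_vol n : R).
Local Notation rho := (vol (unit_vol n : R)).
Local Notation radius := (ball_radius n%:R (unit_vol n : R)).
Context (u : 'rV[R]_n -> R) (G : 'rV[R]_n -> 'rV[R]_n).
Hypotheses (uL : u \in Lfun leb p%:E) (uG : is_weak_gradient p u G).
Hypothesis u_radial : radial u.
Local Notation U := (profile n0 u).
Context (s1 s2 : R) (h : R -> R).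
Hypotheses (s10 : 0 < s1) (s12 : s1 < s2).
Hypothesis ih : lam.-integrable setT (EFin \o h).
Hypothesis hU : forall a b, s1 <= a -> a < b -> b <= s2 ->
  U b - U a = \int[lam]_(s in `]a, b]) h s.
Local Notation w := (shell_grad s1 s2).

Let X (i : 'I_n) x := G x ord0 i * \1_(rho @^-1` `[s1, s2]%classic) x - h (rho x) * w i x.

Let iX i : leb.-integrable setT (EFin \o X i).
Proof.
have [Kw [mw bw _]] := shell_grad_bsupp n0 i s10 (ltW s12).
have b1 : bsupp (\1_((rho : 'rV[R]_n -> R) @^-1` `[s1, s2]%classic) : 'rV[R]_n -> R) (radius s2) 1.
  split; first by apply: measurable_indic; exact: measurable_rho_itv.
    by move=> x; rewrite indicE; case: (_ \in _); rewrite ?normr1 ?normr0.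
  move=> x xM; rewrite indicE memNset//= in_itv/= => /andP[_ xs].
  by apply: xM; exact: rho_cube.
have := integrableB measurableT
  (bsupp_mul_integrable (Lfun_locally_integrable _ (ltW p1) (uG.1 i)) b1)
  (integrable_mul_bounded (integrable_rho n0 ih) mw bw).
exact.
Qed.

Section inner.
Context (a b : R).
Hypotheses (s1a : s1 < a) (bs2 : b < s2).

Let weighted_limit i (Q : nat -> 'rV[R]_n -> R) (q : 'rV[R]_n -> R) :
  (forall j, smooth (Q j)) -> (forall j x, `|Q j x| <= 1) ->
  (forall x, Q j x @[j --> \oo] --> q x) ->
  (\int[leb]_x (X i x * (\1_`[a, b] (rho x) * q x))%:E = 0)%E.
Proof.
move=> sQ bQ Qq.
have d0 : 0 < Num.min (a - s1) (s2 - b) by rewrite lt_min !subr_gt0 s1a.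
have [J _ HJ] := near_infty_natSinv_lt (PosNum d0).
have z0 j t : t <= s1 \/ s2 <= t -> plateau (j + J) a b t = 0.
  move=> H; have := HJ (j + J)%N (leq_addl _ _); rewrite /= lt_min.
  move: (_^-1 : R) (@plateau_eq0 R (j + J) a b t) => d + /andP[d1 d2].
  move=> /(_ d (lexx _)); apply; case: H => H; [left|right]; lra.
have mz j : measurable_fun setT (fun x : 'rV[R]_n => plateau (j + J) a b (rho x) * Q j x).
  apply: measurable_funM; last by apply: continuous_measurable_rV; exact: Ck_continuous (sQ j 0%N).
  by apply: (measurableT_comp (measurable_plateau _ _ _)); exact: measurable_vol.
have bz j x : `|plateau (j + J) a b (rho x) * Q j x| <= 1.
  have /andP[? ?] := plateau_range (j + J) a b (rho x).
  by rewrite normrM -[1]mulr1 ler_pM// ger0_norm.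
have lz x : plateau (j + J) a b (rho x) * Q j x @[j --> \oo] --> \1_`[a, b] (rho x) * q x.
  have H : plateau (j + J) a b (rho x) @[j --> \oo] --> (\1_`[a, b] (rho x) : R).
    by rewrite (cvg_shiftn J (fun j => plateau j a b (rho x))); exact: plateau_cvg.
  have := cvgM H (Qq x); exact.
have := dct_bounded (iX i) mz bz lz.
rewrite (_ : (fun j => _) = cst 0%E) => [/(cvg_unique _ (cvg_cst 0%E))-> //|].
apply/funext => j.
have := gradient_test p1 uL uG u_radial s10 s12 ih hU (@smooth1_plateau R (j + J) a b) (z0 j) (sQ j) i.
have -> : (fun x => (G x ord0 i - h (rho x) * w i x) * (plateau (j + J) a b (rho x) * Q j x)) =
    (fun x => X i x * (plateau (j + J) a b (rho x) * Q j x)).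
  apply/funext => x; rewrite /X indicE; case: (boolP (x \in _)); first by rewrite mulr1.
  rewrite notin_setE/= in_itv/= => E; rewrite z0 ?mul0r ?mulr0//.
  have [?|E1] := leP (rho x) s1; [by left|right].
  by rewrite leNgt; apply/negP => E2; apply: E; rewrite (ltW E1) ltW.
have f := integrable_mul_bounded (iX i) (mz j) (bz j).
rewrite /Rintegral => E; rewrite -[LHS]fineK ?E//.
exact: (integrable_fin_num measurableT f).
Qed.

(** The test functions of [gradient_test] approximate the indicators of the
  boxes, which generate the Borel sets. *)
Lemma gradient_shell :
  {ae leb, forall x, a <= rho x <= b -> forall i, G x ord0 i = h (rho x) * grad_vol c x i}.
Proof.
have H i : ae_eq leb setT (EFin \o (fun x => X i x * \1_`[a, b] (rho x))) (cst 0%E).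
  apply: (ae_eq0_generator (@measurable_boxesE R n) (@boxesI R n)).
  - apply: (integrable_mul_bounded (K := 1)) => //.
      apply: (measurable_indic (measurable_rho_itv `[a, b])).
    by move=> x; rewrite indicE; case: (_ \in _); rewrite ?normr1 ?normr0.
  - have S1 (j : nat) : smooth (fun _ : 'rV[R]_n => 1 : R) by move=> k; exact: Ck_cst.
    have B1 (j : nat) (x : 'rV[R]_n) : `|1 : R| <= 1 by rewrite normr1.
    have C1 (x : 'rV[R]_n) : (fun _ : nat => 1 : R) @ \oo --> (1 : R) by exact: cvg_cst.
    rewrite -[RHS](weighted_limit i S1 B1 C1); apply: eq_integral => x _.
    by rewrite mulr1.
  move=> _ [[al be] _ <-] /=; rewrite integral_mkcond.
  rewrite -[RHS](weighted_limit i (fun j => smooth_box_plateau j al be)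
    (fun j => box_plateau_le1 j al be) (@box_plateau_cvg R n al be)).
  apply: eq_integral => x _; rewrite patchE [\1_(box _ _) x]indicE.
  by case: ifPn => _; rewrite ?mulr1// !mulr0.
have : {ae leb, forall x, forall i, (X i x * \1_`[a, b] (rho x))%:E = 0%E}.
  by apply: filter_forall => i; have := H i; apply: filterS => x; apply.
apply: filterS => x Hx xab i; have := Hx i.
rewrite indicE mem_set ?mulr1/=; last by rewrite in_itv.
move=> [] /eqP; rewrite /X /shell_grad !indicE !mem_set/= ?in_itv/=.
  by rewrite !mulr1 subr_eq0 => /eqP.
by case/andP: xab => ax xb; rewrite (le_trans (ltW s1a) ax) (le_trans xb (ltW bs2)).
Qed.

End inner.
End gradient_shell.

(** * Du Bois-Reymond's lemma *)

Section du_bois_reymond.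
Context {R : realType}.
Local Notation lam := (@lebesgue_measure R).

Lemma setI_closed_rays : setI_closed (@measurable_realfun.RGenCInfty.G R).
Proof.
move=> _ _ [x ->] [y ->]; exists (Num.max x y); apply/seteqP.
by split=> t /=; rewrite !in_itv/= !andbT ge_max => /andP.
Qed.

Lemma plateau_integrable j (a b : R) : lam.-integrable setT (EFin \o plateau j a b).
Proof.
apply: (@cont_supp_integrable _ _ (a - 1) (b + 1)).
  exact: smooth1_continuous (smooth1_plateau j a b).
by move=> t H; apply: (@plateau_eq0 _ _ _ _ _ 1) => //; rewrite invf_le1// ler1n.
Qed.

(** The fundamental lemma of the calculus of variations for a function
  orthogonal to the derivatives of nonnegative test functions. Such
  derivatives are differences of two normalized bumps, the positive one on the
  left; the bump on the right is kept fixed. *)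
Lemma du_bois_reymond (A : R -> R) (a t0 b : R) : a < t0 -> t0 < b ->
  lam.-integrable setT (EFin \o A) ->
  (forall z, smooth1 z -> (forall t, t <= a \/ b <= t -> z t = 0) ->
     (forall t, 0 <= z t) -> \int[lam]_t (A t * (z^`()%classic) t) = 0) ->
  exists C, forall al be, a < al -> be < t0 ->
    {ae lam, forall s, al <= s <= be -> A s = C}.
Proof.
move=> at0 t0b iA HA.
have supp al be d : 0 < d -> exists J, forall j t, t <= al - d \/ be + d <= t ->
    plateau (j + J) (al : R) be t = 0.
  move=> d0; have [J _ HJ] := near_infty_natSinv_lt (PosNum d0).
  exists J => j t H; apply: plateau_eq0 H.
  by apply/ltW; exact: (HJ (j + J)%N (leq_addl _ _)).
pose v := (t0 + b) / 2; have d0 : 0 < (b - t0) / 2 by lra.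
have [J' HJ'] := supp v v _ d0; pose K' := plateau (0 + J') v v.
have K'0 t : t <= t0 \/ b <= t -> K' t = 0.
  by move=> H; apply: HJ'; case: H => H; [left|right]; rewrite /v; lra.
have sK' : smooth1 K' by exact: smooth1_plateau.
have K'p : 0 < K' v by apply: plateau_gt0; rewrite lexx.
have K'ge t : 0 <= K' t by have /andP[] := plateau_range (0 + J') v v t.
pose C := (\int[lam]_t (A t * K' t)) / \int[lam]_t K' t.
exists C => al be a_al be_t0.
pose X t := A t - C * \1_`[a, b] t.
have mI (i : interval R) : measurable ([set` i] : set (measurableTypeR R)) by exact: measurable_itv.
have ind_int : lam.-integrable setT (EFin \o (\1_`[a, b] : R -> R)).
  have := @integrable_mkcond _ (measurableTypeR R) R lam `[a, b]%classic (cst 1%E) (mI _).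
  have -> : cst 1%E \_ `[a, b]%classic = EFin \o (\1_`[a, b] : R -> R).
    by apply/funext => t; rewrite patchE /= indicE; case: ifP.
  move=> <-; apply: (@continuous_integrable R (cst 1)); exact: cst_continuous.
have iX : lam.-integrable setT (EFin \o X).
  exact: (@integrableB _ (measurableTypeR R) R lam _ measurableT _ _ iA
    (@integrableZl _ (measurableTypeR R) R lam _ measurableT C _ ind_int)).
have mpl j al' be' : measurable_fun [set: measurableTypeR R] (plateau j al' be' : R -> R).
  exact: measurable_plateau.
have bpl j al' be' (t : R) : `|plateau j al' be' t| <= 1.
  by have /andP[? ?] := plateau_range j al' be' t; rewrite ger0_norm.
have iAp j al' be' : lam.-integrable setT (EFin \o (fun t => A t * plateau j al' be' t)).
  exact: (@integrable_mul_bounded _ (measurableTypeR R) R lam _ _ 1 iA (mpl _ _ _) (bpl _ _ _)).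
have step al' be' : a < al' -> al' <= be' -> be' < t0 ->
    (\int[lam]_t (X t * \1_`[al', be'] t)%:E = 0)%E.
  move=> a_al' albe be_t0'.
  have d'0 : 0 < Num.min (al' - a) (t0 - be') by rewrite lt_min !subr_gt0 a_al'.
  have [J HJ] := supp al' be' _ d'0.
  pose K j := plateau (j + J) al' be'.
  have K0 j t : t <= a \/ t0 <= t -> K j t = 0.
    move=> H; apply: HJ.
    by case: H => H; [left|right]; have [] := leP (al' - a) (t0 - be'); lra.
  have lim := @dct_bounded _ (measurableTypeR R) R lam X K (\1_`[al', be']) 1 iX
    (fun j => mpl _ _ _) (fun j => bpl _ _ _).
  have cK (t : R) : K j t @[j --> \oo] --> (\1_`[al', be'] t : R).
    by rewrite (cvg_shiftn J (fun j => plateau j al' be' t)); exact: plateau_cvg.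
  have {}lim := lim cK; apply: (cvg_unique _ lim) => //.
  rewrite (_ : (fun j => _) = cst 0%E); first exact: cvg_cst.
  apply/funext => j.
  have iXK := @integrable_mul_bounded _ (measurableTypeR R) R lam _ _ 1 iX
    (mpl (j + J)%N al' be') (bpl _ _ _).
  suff : \int[lam]_t (X t * K j t) = 0.
    rewrite /Rintegral => E; rewrite -[LHS]fineK ?E//.
    exact: (@integrable_fin_num _ (measurableTypeR R) R lam _ measurableT _ iXK).
  have Kge t : 0 <= K j t by have /andP[] := plateau_range (j + J) al' be' t.
  have Kp : 0 < K j al' by apply: plateau_gt0; rewrite lexx.
  have sK : smooth1 (K j) by exact: smooth1_plateau.
  have [I [I' [z [I0 I'0 KI K'I [sz dz z0 _ z01]]]]] :=
    smooth_trapezoid sK Kge (K0 j) Kp sK' K'ge K'0 K'p (lexx t0).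
  have zge t : 0 <= z t by have /andP[] := z01 t.
  have := HA z sz z0 zge; rewrite (derive1_is dz).
  have iK1 := @integrableZr _ (measurableTypeR R) R lam _ measurableT I^-1 _ (iAp (j + J)%N al' be').
  have iK2 := @integrableZr _ (measurableTypeR R) R lam _ measurableT I'^-1 _ (iAp (0 + J')%N v v).
  have -> : (fun t => A t * (K j t / I - K' t / I')) =
      (fun t => A t * K j t / I - A t * K' t / I') by apply/funext => t; ring.
  rewrite (@RintegralB _ (measurableTypeR R) R lam _ _ _ measurableT iK1 iK2).
  rewrite (@RintegralZr _ (measurableTypeR R) R lam _ _ _ measurableT (iAp _ _ _)).
  rewrite (@RintegralZr _ (measurableTypeR R) R lam _ _ _ measurableT (iAp _ _ _)).
  have EI : \int[lam]_t K j t = I by rewrite /Rintegral KI.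
  have EI' : \int[lam]_t K' t = I' by rewrite /Rintegral K'I.
  have CE : C = (\int[lam]_t (A t * K' t)) / I' by rewrite /C EI'.
  move=> /eqP; rewrite subr_eq0 => /eqP E; have {E}CE := etrans CE (esym E).
  have -> : (fun t => X t * K j t) = (fun t => A t * K j t - C * K j t).
    apply/funext => t; rewrite /X indicE; case: (boolP (t \in _)) => [_|]; first by rewrite mulr1 mulrBl.
    rewrite notin_setE/= in_itv/= => tab; rewrite K0 ?mulr0 ?subrr//.
    have [?|at_] := leP t a; [by left|right]; rewrite leNgt; apply/negP => tt.
    by apply: tab; rewrite (ltW at_) (ltW (lt_trans tt t0b)).
  rewrite (@RintegralB _ (measurableTypeR R) R lam _ _ _ measurableT (iAp _ _ _)); last first.
    exact: (@integrableZl _ (measurableTypeR R) R lam _ measurableT C _ (plateau_integrable _ _ _)).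
  rewrite (@RintegralZl _ (measurableTypeR R) R lam _ _ _ measurableT (plateau_integrable _ _ _)).
  by rewrite EI CE divfK ?subrr// gt_eqF.
have H : ae_eq lam setT (EFin \o (fun t => X t * \1_`[al, be] t)) (cst 0%E).
  have iXI : lam.-integrable setT (EFin \o (fun t => X t * \1_`[al, be] t)).
    apply: (@integrable_mul_bounded _ (measurableTypeR R) R lam _ _ 1 iX).
      exact: (measurable_indic (mI _)).
    by move=> t; rewrite indicE; case: (_ \in _); rewrite ?normr1 ?normr0.
  have step' al' : a < al' -> (\int[lam]_t (X t * \1_`[al', be] t)%:E = 0)%E.
    move=> a_al'; have [/step|ab] := leP al' be; first exact.
    rewrite integral0_eq// => t _; rewrite indicE memNset ?mulr0//=.
    by rewrite in_itv/= => /andP[h1 h2]; move: (le_trans h1 h2); rewrite leNgt ab.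
  apply: (@ae_eq0_generator _ (measurableTypeR R) R lam _ _
    (measurable_realfun.RGenCInfty.measurableE R) setI_closed_rays iXI); first exact: step'.
  move=> _ [x ->]; rewrite integral_mkcond.
  have am : a < Num.max x al by rewrite lt_max a_al orbT.
  rewrite -[RHS](step' _ am); apply: eq_integral => t _.
  rewrite patchE/= !indicE; case: ifPn => [|/negP]; rewrite inE/= in_itv/= andbT => xt.
    rewrite (_ : (t \in `[al, be]%classic) = (t \in `[Num.max x al, be]%classic))//.
    by apply/idP/idP; rewrite !inE/= !in_itv/= ge_max xt.
  rewrite memNset ?mulr0//= in_itv/= ge_max => /andP[/andP[xt' _] _]; exact: xt.
apply: filterS H => s /(_ I) [] /eqP; rewrite /= /X => /eqP E sab; move: E.
rewrite !indicE !mem_set/= ?in_itv//= ?mulr1.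
  by move=> /eqP; rewrite subr_eq0 => /eqP.
by case/andP: sab => s1 s2; rewrite (le_trans (ltW a_al) s1) (le_trans s2) ?ltW// (lt_trans be_t0).
Qed.

End du_bois_reymond.

(** * The energy of a weak gradient *)

Section gradient_norm.
Context {R : realType} {n : nat} (p : R).
Hypotheses (n0 : (0 < n)%N) (p1 : 1 < p).
Local Notation leb := (lebesgue_rV R n).
Context (G : 'rV[R]_n -> 'rV[R]_n).

Lemma enorm_ge0 (x : 'rV[R]_n) : 0 <= enorm x. Proof. exact: sqrtr_ge0. Qed.

Lemma enormZ (a : R) (x : 'rV[R]_n) : enorm (a *: x) = `|a| * enorm x.
Proof.
rewrite /enorm; under eq_bigr do rewrite mxE exprMn.
by rewrite -mulr_sumr sqrtrM ?sqr_ge0// sqrtr_sqr.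
Qed.

Lemma enorm_powR_le (x : 'rV[R]_n) :
  enorm x `^ p <= n%:R `^ p * \sum_i `|x ord0 i| `^ p.
Proof.
have p0 : 0 <= p by have P1 := p1; lra.
pose j := [arg max_(j > Ordinal n0) `|x ord0 j|]%O.
have xj i : `|x ord0 i| <= `|x ord0 j|.
  by rewrite /j; case: arg_maxP => // k _; exact.
have xe : enorm x <= n%:R * `|x ord0 j|.
  rewrite -[leRHS]ger0_norm ?mulr_ge0// -sqrtr_sqr ler_wsqrtr//.
  apply: (@le_trans _ _ (\sum_(i < n) `|x ord0 j| ^+ 2)).
    by apply: ler_sum => i _; rewrite -[x ord0 i ^+ 2]real_normK ?num_real// lerXn2r ?nnegrE.
  rewrite sumr_const card_ord -[X in X <= _]mulr_natl exprMn ler_wpM2r ?sqr_ge0//.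
  by rewrite -natrX ler_nat leq_pmulr.
apply: (le_trans (powR_le2r p0 (enorm_ge0 _) xe)).
rewrite powRM// ler_wpM2l ?powR_ge0// (bigD1 j)//= lerDl sumr_ge0//.
Qed.

Lemma measurable_enorm (V : 'rV[R]_n -> 'rV[R]_n) :
  (forall i, measurable_fun setT (fun x => V x ord0 i)) ->
  measurable_fun setT (fun x => enorm (V x)).
Proof.
move=> mV; rewrite (_ : (fun x => _) = fun x => sqn (V x) `^ (2^-1)); last first.
  by apply/funext => x; rewrite powR12_sqrt ?sqn_ge0.
apply: (measurableT_comp (measurable_powR _)).
by apply: measurable_sum => i; exact: measurable_funX.
Qed.

Lemma gradient_energy : (forall i, (fun x => G x ord0 i) \in Lfun leb p%:E) ->
  leb.-integrable setT (EFin \o (fun x => enorm (G x) `^ p)).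
Proof.
move=> GL; have i1 i : leb.-integrable setT (EFin \o (fun x => `|G x ord0 i| `^ p)).
  exact: Lfun_integrable (ltW p1) (GL i).
have [i2 _] := integrable_sum_Rintegral (index_enum 'I_n) i1.
have i3 := integrableZl measurableT (n%:R `^ p) i2.
apply: le_integrable i3 => //.
  apply/measurable_EFinP; apply: (measurableT_comp (measurable_powR _)).
  by apply: measurable_enorm => i; exact: Lfun_measurable (GL i).
move=> x _ /=; rewrite lee_fin ger0_norm ?powR_ge0// ger0_norm ?enorm_powR_le//.
by rewrite mulr_ge0 ?powR_ge0// sumr_ge0// => i _; exact: powR_ge0.
Qed.

End gradient_norm.

Section sphere_areas.
Context {R : realType} {n : nat}.
Hypotheses (n0 : (0 < n)%N).
Local Notation c := (unit_vol n : R).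
Local Notation radius := (ball_radius n%:R (unit_vol n : R)).
Local Notation sigma := (sphere_area n%:R (unit_vol n : R)).

Let c0 : 0 < c. Proof. exact: unit_vol_gt0. Qed.
Let nR : (0 : R) < n%:R. Proof. by rewrite ltr0n. Qed.

Lemma sphere_area_gt0 (s : R) : 0 < s -> 0 < sigma s.
Proof. by move=> s0; rewrite divr_gt0 ?mulr_gt0// radius_gt0. Qed.

Lemma sphere_area_continuous (s : R) : 0 < s -> {for s, continuous sigma}.
Proof.
move=> s0; have r0 := radius_gt0 n0 s0.
have H1 := derive_continuous (isdM (isd_cst (n%:R : R) s) (isd_id s)).
have H2 : {for s, continuous (fun s => (radius s)^-1)}.
  by apply: cvgV; [exact: lt0r_neq0|exact: radius_continuous].
have := cvgM H1 H2; exact.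
Qed.

Lemma measurable_radius : measurable_fun setT radius.
Proof.
apply: (measurableT_comp (measurable_powR _)).
by apply: measurable_funM; [exact: measurable_id|exact: measurable_cst].
Qed.

Lemma measurable_sphere_area : measurable_fun setT sigma.
Proof.
apply: measurable_funM; first by apply: measurable_funM.
by apply: measurable_funV_ge0; [move=> s; exact: powR_ge0|exact: measurable_radius].
Qed.

Lemma sphere_area_le (a b s : R) : 0 < a -> a <= s <= b ->
  sigma s <= n%:R * b / radius a.
Proof.
move=> a0 /andP[as_ sb]; have s0 := lt_le_trans a0 as_.
rewrite /sphere_area ler_pM ?invr_ge0 ?mulr_ge0 ?powR_ge0 ?(ltW s0) ?(ltW nR)//.
  by rewrite ler_wpM2l// ltW.
rewrite lef_pV2 ?posrE ?radius_gt0//; apply: powR_le2r.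
- by rewrite invr_ge0 ltW.
- by rewrite divr_ge0// ltW.
by rewrite ler_pM2r// invr_gt0.
Qed.

Lemma measurable_spow (a : R) : 0 < a -> measurable_fun setT (spow a : R -> R).
Proof.
by move=> a0; apply: nondecreasing_measurable => // x y xy; rewrite spow_le.
Qed.

End sphere_areas.

(** * The weak equation in the volume variable *)

Lemma weak_gradientP (R : realType) (N : nat) (p : R) (u : 'rV[R]_N -> R) :
  sobolev p u -> is_weak_gradient p u (weak_gradient p u).
Proof. by move=> [_ uG]; exact: (xgetPex (fun=> 0) uG). Qed.

Section radial_equation.
Context {R : realType} {n : nat} (p mu m : R) (f : R -> R) (u : 'rV[R]_n -> R).
Hypotheses (n0 : (0 < n)%N) (p1 : 1 < p) (cf : continuous f).
Hypotheses (u_radial : radial u) (u_cont : forall x, x != 0 -> {for x, continuous u}).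
Hypothesis u_pos : forall x, x != 0 -> 0 < u x.
Hypothesis u_sol : weak_solution p mu m f u.
Local Notation leb := (lebesgue_rV R n).
Local Notation lam := (@lebesgue_measure R).
Local Notation c := (unit_vol n : R).
Local Notation rho := (vol (unit_vol n : R)).
Local Notation radius := (ball_radius n%:R (unit_vol n : R)).
Local Notation sigma := (sphere_area n%:R (unit_vol n : R)).
Local Notation U := (profile n0 u).
Local Notation G := (weak_gradient p u).

Let c0 : 0 < c. Proof. exact: unit_vol_gt0. Qed.
Let u_sob : sobolev p u. Proof. by case: u_sol => -[]. Qed.
Let uG : is_weak_gradient p u G. Proof. exact: weak_gradientP. Qed.
Let GL i : (fun x => G x ord0 i) \in Lfun leb p%:E. Proof. exact: uG.1. Qed.
Let uL : u \in Lfun leb p%:E. Proof. exact: u_sob.1. Qed.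
Let mG i : measurable_fun setT (fun x => G x ord0 i).
Proof. exact: Lfun_measurable (GL i). Qed.

Context (a b : R) (h : R -> R).
Hypotheses (a0 : 0 < a) (ab : a < b) (mh : measurable_fun setT h).
Hypothesis Gh : {ae leb, forall x, a <= rho x <= b ->
  forall i, G x ord0 i = h (rho x) * grad_vol c x i}.

Lemma shell_enorm x : a <= rho x -> (forall i, G x ord0 i = h (rho x) * grad_vol c x i) ->
  enorm (G x) = `|h (rho x) * sigma (rho x)|.
Proof.
move=> ax Gx; have r0 := lt_le_trans a0 ax.
have -> : G x = h (rho x) *: \row_i grad_vol c x i.
  by apply/rowP => i; rewrite Gx !mxE.
rewrite enormZ (enorm_grad_vol n0 r0) normrM; congr (_ * _).
by rewrite ger0_norm// ltW// sphere_area_gt0.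
Qed.

Let mhs : measurable_fun setT (fun s => h s * sigma s).
Proof. by apply: measurable_funM => //; exact: measurable_sphere_area. Qed.

Let mI : measurable (`[a, b]%classic : set (measurableTypeR R)).
Proof. exact: measurable_itv. Qed.

Let I0 : (`[a, b]%classic : set (measurableTypeR R)) `<=` `[0, +oo[%classic.
Proof.
by move=> s /=; rewrite !in_itv/= andbT => /andP[as_ _]; exact: le_trans (ltW a0) as_.
Qed.

Lemma shell_energy_le :
  (\int[lam]_(s in `[a, b]) (`|h s * sigma s| `^ p)%:E <=
   \int[leb]_x (enorm (G x) `^ p)%:E)%E.
Proof.
have mE : measurable_fun setT (EFin \o (fun s : measurableTypeR R => `|h s * sigma s| `^ p)).
  apply/measurable_EFinP; apply: (measurableT_comp (measurable_powR _)).
  exact: measurableT_comp.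
rewrite -(@ge0_integral_vol R n n0 _ (EFin \o (fun s => `|h s * sigma s| `^ p)) mI I0); last 2 first.
- exact: measurable_funTS mE.
- by move=> s _; rewrite lee_fin powR_ge0.
have mS := @measurable_rho_itv R n `[a, b].
have mGp : measurable_fun setT (fun x => (enorm (G x) `^ p)%:E).
  by have := measurable_int _ (gradient_energy n0 p1 GL); exact.
apply: (@le_trans _ _ (\int[leb]_(x in rho @^-1` `[a, b]%classic) (enorm (G x) `^ p)%:E)%E).
  rewrite le_eqVlt; apply/orP; left; apply/eqP.
  apply: ge0_ae_eq_integral.
  - exact: mS.
  - apply: measurable_funTS; apply: (measurableT_comp mE); exact: measurable_vol.
  - exact: measurable_funTS.
  - by move=> x _; rewrite lee_fin powR_ge0.
  - by move=> x _; rewrite lee_fin powR_ge0.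
  apply: filterS Gh => x Gx /=; rewrite in_itv/= => /[dup] xab /andP[ax _].
  by rewrite (shell_enorm ax (Gx xab)).
apply: ge0_subset_integral => //.
by move=> x _; rewrite lee_fin powR_ge0.
Qed.

Lemma shell_energy_integrable :
  lam.-integrable `[a, b] (EFin \o (fun s => `|h s * sigma s| `^ p)).
Proof.
have mE : measurable_fun setT (EFin \o (fun s : measurableTypeR R => `|h s * sigma s| `^ p)).
  apply/measurable_EFinP; apply: (measurableT_comp (measurable_powR _)).
  exact: measurableT_comp.
apply/integrableP; split; first exact: measurable_funTS mE.
under eq_integral do rewrite gee0_abs ?lee_fin ?powR_ge0//.
apply: (le_lt_trans shell_energy_le).
have /integrableP[_] := gradient_energy n0 p1 GL.
by under eq_integral do rewrite gee0_abs ?lee_fin ?powR_ge0//.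
Qed.

(** The flux of [|grad u|^(p-2) grad u] through the sphere enclosing the
  volume [s], if [h] is the derivative of the profile: the radial derivative
  is then [h * sigma]. *)
Definition flux (s : R) : R := spow (p - 1) (h s * sigma s) * sigma s.

Let p10 : 0 < p - 1. Proof. by rewrite subr_gt0. Qed.

Let mflux : measurable_fun setT flux.
Proof.
apply: measurable_funM; last exact: measurable_sphere_area.
exact: (measurableT_comp (measurable_spow p10)).
Qed.

Lemma flux_integrable : lam.-integrable setT (EFin \o (fun s => flux s * \1_`[a, b] s)).
Proof.
pose K := n%:R * b / radius a.
have i1 : lam.-integrable `[a, b] (EFin \o (fun=> K)).
  by apply: continuous_integrable; exact: cst_continuous.
have i2 := @integrableZl _ (measurableTypeR R) R lam _ mI K _ shell_energy_integrable.
have i3 := @integrableD _ (measurableTypeR R) R lam _ mI _ _ i1 i2.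
rewrite (_ : EFin \o _ = (EFin \o flux) \_ `[a, b]); last first.
  by apply/funext => s; rewrite patchE /= indicE; case: ifP; rewrite ?mulr1 ?mulr0.
apply: (iffLR (@integrable_mkcond _ (measurableTypeR R) R lam _ _ mI)).
apply: (@le_integrable _ (measurableTypeR R) R lam _ _ _ _ _ _ i3) => //.
  by apply: measurable_funTS; apply/measurable_EFinP.
move=> s /=; rewrite in_itv/= => sab; rewrite lee_fin.
have s0 : 0 < s by case/andP: sab => as_ _; exact: lt_le_trans as_.
have sg0 := sphere_area_gt0 n0 s0.
rewrite normrM normr_spow ?gt_eqF// (gtr0_norm sg0).
have sK : sigma s <= K := sphere_area_le n0 a0 sab.
have K0 : 0 <= K := le_trans (ltW sg0) sK.
set y := `|h s * sigma s|.
have yp : y `^ (p - 1) <= 1 + y `^ p.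
  have q1 : 1 <= p / (p - 1) by rewrite ler_pdivlMr// mul1r gerBl.
  by have := le_1DpowR q1 (powR_ge0 y (p - 1)); rewrite -powRrM mulrC divfK// gt_eqF.
rewrite ger0_norm; last by rewrite addr_ge0// mulr_ge0// powR_ge0.
rewrite (_ : K + K * y `^ p = (1 + y `^ p) * K); last by ring.
by apply: ler_pM => //; [exact: powR_ge0|exact: ltW].
Qed.

(** The value of minus the p-Laplacian, according to the equation. *)
Definition source (s : R) : R :=
  (mu / radius s `^ p - m) * U s `^ (p - 1) + f (U s).

Lemma profile_gt0 s : 0 < s -> 0 < U s.
Proof. by move=> s0; apply: u_pos; exact: sphere_pt_neq0. Qed.

Lemma powR_profile_continuous s r : 0 < s -> {for s, continuous (fun s => U s `^ r)}.
Proof.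
move=> s0; apply: (@continuous_comp _ _ _ U (fun y => y `^ r)).
  exact: profile_continuous.
exact: derive_continuous (is_derive1_powR r (profile_gt0 s0)).
Qed.

Lemma source_continuous s : 0 < s -> {for s, continuous source}.
Proof.
move=> s0; have r0 := radius_gt0 n0 s0.
have cr : {for s, continuous (fun s => radius s `^ p)}.
  apply: (@continuous_comp _ _ _ radius (fun y => y `^ p)); first exact: radius_continuous.
  exact: derive_continuous (is_derive1_powR p r0).
have ci : {for s, continuous (fun s => (radius s `^ p)^-1)}.
  by apply: cvgV => //; rewrite gt_eqF// powR_gt0.
have c1 : {for s, continuous (fun s => (mu / radius s `^ p - m) * U s `^ (p - 1))}.
  have := cvgM (cvgB (cvgM (cvg_cst mu) ci) (cvg_cst m)) (@powR_profile_continuous s (p - 1) s0).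
  exact.
have c2 : {for s, continuous (fun s => f (U s))}.
  apply: (@continuous_comp _ _ _ U f); first exact: profile_continuous.
  exact: cf.
have := cvgD c1 c2; exact.
Qed.

Section test.
Context (z : R -> R).
Hypotheses (sz : smooth1 z) (z0 : forall t, t <= a \/ b <= t -> z t = 0).
Hypothesis z_ge0 : forall t, 0 <= z t.
Local Notation phi := (fun x : 'rV[R]_n => z (rho x)).
Local Notation dz := (z^`()%classic).

Let zl t : t <= a -> z t = 0. Proof. by move=> ta; apply: z0; left. Qed.

Let dz0 t : t < a \/ b < t -> dz t = 0.
Proof. exact: derive1_support. Qed.

Let cdz : continuous dz. Proof. exact: smooth1_continuous (smooth1_derive sz). Qed.

Let phi0 (x : 'rV[R]_n) : ~ cube (radius b) x -> z (rho x) = 0.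
Proof.
move=> xM; apply: z0; right; rewrite leNgt; apply/negP => xs.
by apply: xM; apply: (rho_cube n0); exact: ltW.
Qed.

Let tphi : test_function phi.
Proof.
apply: (compact_support_test _ phi0) => k; exact: Ck_vol a0 zl (sz k).
Qed.

Let dphi x i : partial i phi x = dz (rho x) * grad_vol c x i.
Proof. by rewrite (partialE (fun y => isdv_vol n0 c0 i y a0 zl (sz 1%N))). Qed.

Let u_rho x : 0 < rho x -> [/\ u x = U (rho x), 0 < u x & enorm x = radius (rho x)].
Proof.
by move=> r0; rewrite (profile_rho n0 u_radial) radius_rho//; split=> //; exact: profile_gt0.
Qed.

Lemma weak_form_shell x :
  (a <= rho x <= b -> forall i, G x ord0 i = h (rho x) * grad_vol c x i) ->
  weak_form p mu m u phi x =
  flux (rho x) * \1_`[a, b] (rho x) * dz (rho x) -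
  (source (rho x) - f (U (rho x))) * z (rho x).
Proof.
move=> Gx; rewrite /weak_form indicE.
have [/[dup] xab /andP[ax xb]|xab] := boolP (a <= rho x <= b); last first.
  rewrite memNset//=; last by rewrite in_itv/=; exact/negP.
  have out : rho x < a \/ b < rho x.
    by move: xab; rewrite negb_and -!ltNge => /orP[]; [left|right].
  have zx : z (rho x) = 0 by apply: z0; case: out => /ltW; [left|right].
  rewrite zx /dotp big1 => [|i _]; last by rewrite mxE dphi dz0// mul0r mulr0.
  ring.
rewrite mem_set//= mulr1; have {}Gx := Gx xab.
have r0 := lt_le_trans a0 ax; have [ux u0 ex] := u_rho r0.
have sg0 := sphere_area_gt0 n0 r0.
rewrite (shell_enorm ax Gx) /source ex !(gtr0_norm u0) -ux.
have up : u x `^ (p - 2) * u x = u x `^ (p - 1).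
  rewrite -[X in _ * X]powRr1 ?(ltW u0)// -powRD ?(gt_eqF u0) ?implybT//.
  by congr (_ `^ _); ring.
have -> : dotp (G x) (gradient phi x) = h (rho x) * sigma (rho x) ^+ 2 * dz (rho x).
  rewrite /dotp; have <- := enorm_grad_vol n0 r0; rewrite enorm_sqr /sqn mulr_sumr mulr_suml.
  by apply: eq_bigr => i _; rewrite !mxE dphi Gx; ring.
have fl : `|h (rho x) * sigma (rho x)| `^ (p - 2) * (h (rho x) * sigma (rho x)) =
    spow (p - 1) (h (rho x) * sigma (rho x)).
  set y := h (rho x) * sigma (rho x); have [->|y0] := eqVneq y 0; first by rewrite spow0 mulr0.
  rewrite {2}[y]numEsg /spow mulrCA; congr (_ * _).
  rewrite -[X in _ * X]powRr1// -powRD ?normr_eq0 ?y0 ?implybT//.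
  by congr (_ `^ _); ring.
rewrite up /flux -fl; ring.
Qed.

Let mweak_form : measurable_fun setT (weak_form p mu m u phi).
Proof.
have mu_ : measurable_fun setT u := Lfun_measurable uL.
have mphi : measurable_fun setT phi.
  by apply: continuous_measurable_rV; exact: Ck_continuous (tphi.1 0%N).
have mnl : measurable_fun setT (fun x => `|u x| `^ (p - 2) * u x).
  apply: measurable_funM => //; apply: (measurableT_comp (measurable_powR _)).
  exact: measurableT_comp.
have mid i : measurable_fun setT (fun x : 'rV[R]_n => x ord0 i) by exact: measurable_coord.
apply: measurable_funD.
  apply: measurable_funB.
    apply: measurable_funM.
      by apply: (measurableT_comp (measurable_powR _)); exact: measurable_enorm.
    apply: measurable_sum => i; apply: measurable_funM; first exact: mG.
    under eq_fun do rewrite mxE.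
    by apply: continuous_measurable_rV; exact: Ck_continuous (Ck_partial i (tphi.1 1%N)).
  apply: measurable_funM => //; apply: measurable_funM => //.
  apply: measurable_funM; first exact: measurable_cst.
  apply: measurable_funV_ge0; first by move=> x; exact: powR_ge0.
  apply: (measurableT_comp (measurable_powR _)).
  exact: (@measurable_enorm R n id).
by apply: measurable_funM => //; apply: measurable_funM => //; exact: measurable_cst.
Qed.

(** The two inequalities for sub- and supersolutions give an equality because
  [z] is nonnegative; the change of variables [image_vol] makes it
  one-dimensional. *)
Lemma radial_equation :
  \int[lam]_s (flux s * \1_`[a, b] s * dz s) = \int[lam]_s (source s * z s).
Proof.
have [K dzK] := cont_supp_bounded cdz dz0.
have cz : continuous z by exact: smooth1_continuous.
have cfU s : 0 < s -> {for s, continuous (fun s => f (U s))}.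
  by move=> s0; apply: (@continuous_comp _ _ _ U f); [exact: profile_continuous|exact: cf].
have mdz : measurable_fun [set: measurableTypeR R] dz by exact: continuous_measurable_fun.
have i1 : lam.-integrable setT (EFin \o (fun s => flux s * \1_`[a, b] s * dz s)).
  exact: (@integrable_mul_bounded _ (measurableTypeR R) R lam _ _ K flux_integrable mdz dzK).
have i2 : lam.-integrable setT (EFin \o (fun s => source s * z s)).
  apply: (@cont_supp_integrable _ _ a b); first exact: mul_cut_continuous source_continuous a0 cz zl.
  by move=> t /z0 ->; rewrite mulr0.
have i3 : lam.-integrable setT (EFin \o (fun s => f (U s) * z s)).
  apply: (@cont_supp_integrable _ _ a b); first exact: mul_cut_continuous cfU a0 cz zl.
  by move=> t /z0 ->; rewrite mulr0.
pose T s := flux s * \1_`[a, b] s * dz s - (source s * z s - f (U s) * z s).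
have i4 := @integrableB _ (measurableTypeR R) R lam _ measurableT _ _ i2 i3.
have iT : lam.-integrable setT (EFin \o T).
  exact: (@integrableB _ (measurableTypeR R) R lam _ measurableT _ _ i1 i4).
have weq : (\int[leb]_x (weak_form p mu m u phi x)%:E = \int[leb]_x (f (u x) * phi x)%:E)%E.
  case: u_sol => -[_ sub] [_ sup]; apply/le_anti; apply/andP.
  by split; [exact: sub|exact: sup].
have iTr := integrable_rho n0 iT.
have E1 : (\int[leb]_x (weak_form p mu m u phi x)%:E = \int[leb]_x (T (rho x))%:E)%E.
  apply: ae_eq_integral => //.
  - by apply/measurable_EFinP; exact: mweak_form.
  - exact: (measurable_int _ iTr).
  apply: filterS Gh => x Gx _; rewrite (weak_form_shell Gx) /T; congr (_%:E); ring.
have E2 : \int[leb]_x T (rho x) = \int[leb]_x (f (U (rho x)) * z (rho x)).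
  rewrite /Rintegral -E1 weq; congr fine; apply: eq_integral => x _.
  by rewrite (profile_rho n0 u_radial).
have neg s : s < 0 -> s <= a by move=> s0; exact: ltW (lt_trans s0 a0).
move: E2; rewrite (Rintegral_rho n0 iT); last first.
  move=> s s0; rewrite /T zl ?neg// dz0 ?mulr0 ?subrr//.
  by left; exact: lt_trans s0 a0.
rewrite (Rintegral_rho n0 i3); last by move=> s s0; rewrite zl ?neg ?mulr0.
rewrite (@RintegralB _ (measurableTypeR R) R lam _ _ _ measurableT i1 i4).
rewrite (@RintegralB _ (measurableTypeR R) R lam _ _ _ measurableT i2 i3).
move=> /eqP; rewrite subr_eq => /eqP ->; ring.
Qed.

End test.
End radial_equation.

(** * Regularity of the profile *)

Section signed_powers.
Context {R : realType}.

Lemma spowK (a x : R) : a != 0 -> spow a^-1 (spow a x) = x.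
Proof.
move=> a0; rewrite {1}/spow normr_spow// -powRrM mulfV// powRr1//.
have [->|x0] := eqVneq x 0; first by rewrite normr0 mulr0.
rewrite /spow sgrM sgr_id (@gtr0_sg _ (`|x| `^ a)) ?mulr1 ?powR_gt0 ?normr_gt0//.
by rewrite -numEsg.
Qed.

Lemma spowVK (a x : R) : a != 0 -> spow a (spow a^-1 x) = x.
Proof. by move=> a0; rewrite -{1}[a]invrK spowK// invr_eq0. Qed.

(** An increasing surjection is continuous. *)
Lemma spow_continuous (a : R) : 0 < a -> continuous (spow a).
Proof.
move=> a0 x; have aN : a != 0 by rewrite gt_eqF.
apply/cvgrPdist_lt => e e0; near=> t; rewrite ltr_distlC; apply/andP; split.
  rewrite -[ltLHS](spowVK _ aN) spow_lt//; near: t; apply: lt_nbhsr => /=.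
  by rewrite -(spow_lt _ _ a0) spowVK// gtrBl.
rewrite -[ltRHS](spowVK _ aN) spow_lt//; near: t; apply: lt_nbhsl => /=.
by rewrite -(spow_lt _ _ a0) spowVK// ltrDl.
Unshelve. all: by end_near. Qed.

End signed_powers.

Section regularity.
Context {R : realType} {n : nat} (p mu m : R) (f : R -> R) (u : 'rV[R]_n -> R).
Hypotheses (n0 : (0 < n)%N) (p1 : 1 < p) (cf : continuous f).
Hypotheses (u_radial : radial u) (u_cont : forall x, x != 0 -> {for x, continuous u}).
Hypothesis u_pos : forall x, x != 0 -> 0 < u x.
Hypothesis u_sol : weak_solution p mu m f u.
Local Notation leb := (lebesgue_rV R n).
Local Notation lam := (@lebesgue_measure R).
Local Notation c := (unit_vol n : R).
Local Notation rho := (vol (unit_vol n : R)).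
Local Notation radius := (ball_radius n%:R (unit_vol n : R)).
Local Notation sigma := (sphere_area n%:R (unit_vol n : R)).
Local Notation U := (profile n0 u).
Local Notation G := (weak_gradient p u).
Local Notation src := (source p mu m f u n0).

Let u_sob : sobolev p u. Proof. by case: u_sol => -[]. Qed.
Let uG : is_weak_gradient p u G. Proof. exact: weak_gradientP. Qed.
Let uL : u \in Lfun leb p%:E. Proof. exact: u_sob.1. Qed.

(** Du Bois-Reymond's lemma turns the weak equation into the statement that
  the flux is almost everywhere equal to an antiderivative of minus the
  source. *)
Lemma flux_antiderivative (h : R -> R) (a t0 b : R) : 0 < a -> a < t0 -> t0 < b ->
  measurable_fun setT h ->
  {ae leb, forall x, a <= rho x <= b -> forall i, G x ord0 i = h (rho x) * grad_vol c x i} ->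
  exists W : R -> R, (forall s, a < s -> is_derive s 1 W (- src s)) /\
    forall al be, a < al -> be < t0 -> {ae lam, forall s, al <= s <= be -> @flux R n p h s = W s}.
Proof.
move=> a0 at0 t0b mh Gh; have ab : a < b by exact: lt_trans t0b.
(* continuous on the whole line, and equal to the source where test functions live *)
pose g t := src (Num.max t a).
have gE (t : R) : a <= t -> g t = src t by move=> at_; rewrite /g (max_l at_).
have cg : continuous g.
  move=> t; apply: (@continuous_comp _ _ _ (fun t => Num.max t a) src).
    by apply: (@continuous_max R R id (cst a)); [exact: cvg_id|exact: cst_continuous].
  apply: source_continuous => //.
  by rewrite lt_max a0 orbT.
pose B t := \int[lam]_(s in `[a - 1, t]) g s.
have a1 t : a <= t -> a - 1 < t by move=> at_; rewrite (lt_le_trans _ at_)// gtrBl.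
have dB (t : R) : a <= t -> is_derive t 1 B (g t) by move=> /a1; exact: is_derive_integral.
have mI (i : interval R) : measurable ([set` i] : set (measurableTypeR R)) by exact: measurable_itv.
have iF := flux_integrable n0 p1 u_sol a0 mh Gh.
have iB : lam.-integrable setT (EFin \o (fun s => B s * \1_`[a, b] s)).
  rewrite (_ : EFin \o _ = (EFin \o B) \_ `[a, b]); last first.
    by apply/funext => s; rewrite patchE /= indicE; case: ifP; rewrite ?mulr1 ?mulr0.
  apply: (iffLR (@integrable_mkcond _ (measurableTypeR R) R lam _ _ (mI _))).
  apply: continuous_compact_integrable; first exact: segment_compact.
  apply: continuous_in_subspaceT => t; rewrite inE/= in_itv/= => /andP[at_ _].
  exact: derive_continuous (dB t at_).
pose A s := @flux R n p h s * \1_`[a, b] s + B s * \1_`[a, b] s.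
have iA : lam.-integrable setT (EFin \o A).
  exact: (@integrableD _ (measurableTypeR R) R lam _ measurableT _ _ iF iB).
have [|C HC] := du_bois_reymond at0 t0b iA.
  move=> z sz z0 zge0.
  have zl t : t <= a -> z t = 0 by move=> ta; apply: z0; left.
  have zl1 t : t <= a - 1 + 1 -> z t = 0 by rewrite subrK; exact: zl.
  have dz0 := derive1_support sz z0.
  have cdz : continuous (z^`()%classic) := smooth1_continuous (smooth1_derive sz).
  have out t : (z^`()%classic) t = (z^`()%classic) t * \1_`[a, b] t.
    rewrite indicE; case: (boolP (t \in _)) => [_|]; rewrite ?mulr1//.
    rewrite notin_setE/= in_itv/= => /negP; rewrite negb_and -!ltNge => /orP tt.
    by rewrite dz0 ?mul0r//.
  have dBz t := is_derive_integral_mul 0 t cg (sz 1%N) zl1.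
  have CBz := Ck1_integral_mul 0 cg (sz 1%N) zl1.
  have cBz : continuous (fun t => g t * z t + (0 + B t) * (z^`()%classic) t).
    by have := CBz.2.2; rewrite (derive1_is dBz) => -[].
  have zb t : b < `|t| -> z t = 0.
    move=> bt; apply: z0; have [t0'|t0'] := leP 0 t; first by right; rewrite ltW// -(ger0_norm t0').
    by left; rewrite ltW// (lt_trans t0').
  have dzb t : b < `|t| -> (z^`()%classic) t = 0.
    move=> bt; apply: dz0; have [t0'|t0'] := leP 0 t; first by right; rewrite -(ger0_norm t0').
    by left; rewrite (lt_trans t0').
  have I0 : \int[lam]_t (g t * z t + (0 + B t) * (z^`()%classic) t) = 0.
    rewrite /Rintegral (integral_derive_compact (M := b) dBz cBz)//.
      by move=> t bt; rewrite zb ?mulr0.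
    by move=> t bt; rewrite zb// dzb// !mulr0 addr0.
  have i0 : lam.-integrable setT (EFin \o (fun t => g t * z t + (0 + B t) * (z^`()%classic) t)).
    apply: (@cont_supp_integrable _ _ (a - 1) (b + 1)) => // t tt.
    rewrite z0 ?dz0 ?mulr0 ?addr0//; case: tt => tt; [left|right|left|right].
    - by apply: (lt_le_trans (y := a)); [apply: (le_lt_trans tt); rewrite gtrBl|].
    - by apply: (lt_le_trans (y := b + 1)) => //; rewrite ltrDl.
    - by apply: (le_trans tt); rewrite gerBl.
    - by apply: le_trans tt; rewrite lerDl.
  have i1 : lam.-integrable setT (EFin \o (fun t => g t * z t)).
    apply: (@cont_supp_integrable _ _ a b).
      by move=> t; have := cvgM (cg t) (smooth1_continuous sz (x := t)); exact.
    by move=> t /z0 ->; rewrite mulr0.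
  have [K dzK] := cont_supp_bounded cdz dz0.
  have mdz : measurable_fun [set: measurableTypeR R] (z^`()%classic).
    exact: continuous_measurable_fun.
  have i2 := @integrable_mul_bounded _ (measurableTypeR R) R lam _ _ K iF mdz dzK.
  have i3 := @integrableB _ (measurableTypeR R) R lam _ measurableT _ _ i0 i1.
  have -> : (fun t => A t * (z^`()%classic) t) = (fun t =>
      @flux R n p h t * \1_`[a, b] t * (z^`()%classic) t +
      (g t * z t + (0 + B t) * (z^`()%classic) t - g t * z t)).
    by apply/funext => t; rewrite /A mulrDl -[in RHS]mulrA; congr (_ + _);
      rewrite ?[in RHS]mulrA// -mulrA [_ * (z^`()%classic) t]mulrC -out; ring.
  rewrite (@RintegralD _ (measurableTypeR R) R lam _ _ _ measurableT i2 i3).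
  rewrite (@RintegralB _ (measurableTypeR R) R lam _ _ _ measurableT i0 i1) I0 sub0r.
  rewrite (radial_equation n0 p1 cf u_radial u_cont u_pos u_sol a0 mh Gh sz z0 zge0).
  apply/eqP; rewrite subr_eq0; apply/eqP; apply: eq_Rintegral => t _.
  have [ta|at_] := leP t a; first by rewrite zl// !mulr0.
  by congr (_ * _); apply/esym/gE/ltW.
exists (fun s => C - B s); split=> [s as_|al be a_al be_t0].
  apply: (isd_eq (isdB (isd_cst C s) (dB s (ltW as_)))).
  by rewrite sub0r (gE _ (ltW as_)).
have := HC _ _ a_al be_t0; apply: filterS; first exact: (ae_filter_ringOfSetsType lam).
move=> s /[swap] sab /(_ sab).
have in_ab : s \in `[a, b]%classic.
  rewrite inE/= in_itv/=; case/andP: sab => als sbe.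
  by rewrite (le_trans (ltW a_al) als) (le_trans sbe)// ltW// (lt_trans be_t0).
by rewrite /A !indicE in_ab !mulr1 => <-; rewrite addrK.
Qed.

End regularity.

Section shell_regularity.
Context {R : realType} {n : nat} (p mu m : R) (f : R -> R) (u : 'rV[R]_n -> R).
Hypotheses (n0 : (0 < n)%N) (p1 : 1 < p) (cf : continuous f).
Hypotheses (u_radial : radial u) (u_cont : forall x, x != 0 -> {for x, continuous u}).
Hypothesis u_pos : forall x, x != 0 -> 0 < u x.
Hypothesis u_sol : weak_solution p mu m f u.
Local Notation leb := (lebesgue_rV R n).
Local Notation lam := (@lebesgue_measure R).
Local Notation sigma := (sphere_area n%:R (unit_vol n : R)).
Local Notation U := (profile n0 u).
Local Notation G := (weak_gradient p u).
Local Notation src := (source p mu m f u n0).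
Local Notation flx := (@flux R n p).

Let u_sob : sobolev p u. Proof. by case: u_sol => -[]. Qed.
Let uG : is_weak_gradient p u G. Proof. exact: weak_gradientP. Qed.
Let uL : u \in Lfun leb p%:E. Proof. exact: u_sob.1. Qed.

(** The flux determines [h], by inverting the signed power. As the flux has a
  differentiable representative, [h] has a continuous one, [k]. *)
Lemma shell_regularity (al be : R) : 0 < al -> al < be ->
  exists k : R -> R, [/\ forall s, al < s < be -> is_derive s 1 U (k s),
    forall s, al < s < be -> is_derive s 1 (flx k) (- src s),
    forall s, al <= s -> {for s, continuous k} &
    (\int[lam]_(s in `[al, be]) (`|k s * sigma s| `^ p)%:E <=
     \int[leb]_x (enorm (G x) `^ p)%:E)%E].
Proof.
move=> al0 albe; have p10 : 0 < p - 1 by rewrite subr_gt0.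
pose a := al / 2; pose b := be + 2; pose t0 := be + 1.
have [a0 a_al be_t0 t0b] : [/\ 0 < a, a < al, be < t0 & t0 < b].
  by rewrite /a /b /t0; split; lra.
have at0 : a < t0 by rewrite (lt_trans a_al)// (lt_trans albe).
have s10 : 0 < a / 2 by rewrite divr_gt0.
have s1a : a / 2 < a by rewrite ltr_pdivrMr// ltr_pMr// ltr1n.
have bs2 : b < b + 1 by rewrite ltrDl.
have s12 : a / 2 < b + 1 by rewrite (lt_trans s1a)// (lt_trans at0)// (lt_trans t0b).
have [h [ih hU]] := profile_density n0 p1 uL uG u_radial u_cont (b + 1) s10.
have Gh := gradient_shell p1 uL uG u_radial s10 s12 ih hU s1a bs2.
have mh : measurable_fun setT h.
  have /integrableP[/measurable_EFinP] := ih; exact.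
have [W [dW HW]] := flux_antiderivative n0 p1 cf u_radial u_cont u_pos u_sol a0 at0 t0b mh Gh.
have {}HW := HW _ _ a_al be_t0.
pose k s := spow (p - 1)^-1 (W s / sigma s) / sigma s.
have sg0 s : al <= s -> 0 < sigma s.
  by move=> als; apply: sphere_area_gt0 => //; exact: lt_le_trans als.
have mI (i : interval R) : measurable ([set` i] : set (measurableTypeR R)) by exact: measurable_itv.
have hk : {ae lam, forall s, al <= s <= be -> h s = k s}.
  move: HW; apply: filterS; first exact: (ae_filter_ringOfSetsType lam).
  move=> s /[swap] /[dup] sab /andP[als _] /(_ sab) E.
  have s0 := sg0 s als; rewrite /k -E /flux mulfK ?gt_eqF// spowK ?gt_eqF//.
  by rewrite mulfK ?gt_eqF.
have ck s : al <= s -> {for s, continuous k}.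
  move=> als; have s0 : 0 < s by exact: lt_le_trans als.
  have ci : {for s, continuous (fun s => (sigma s)^-1)}.
    by apply: cvgV; [rewrite gt_eqF ?sg0|exact: sphere_area_continuous].
  have cW := derive_continuous (dW s (lt_le_trans a_al als)).
  have c1 : {for s, continuous (fun s => W s / sigma s)} by have := cvgM cW ci; exact.
  have c2 : {for s, continuous (fun s => spow (p - 1)^-1 (W s / sigma s))}.
    apply: (@continuous_comp _ _ _ (fun s => W s / sigma s) (spow (p - 1)^-1)) => //.
    by apply: spow_continuous; rewrite invr_gt0.
  have := cvgM c2 ci; exact.
have ik : lam.-integrable `[al, be] (EFin \o k).
  apply: continuous_compact_integrable; first exact: segment_compact.
  by apply: continuous_in_subspaceT => t; rewrite inE/= in_itv/= => /andP[at_ _]; exact: ck.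
exists k; split=> //.
- move=> s /andP[als sbe].
  have Uk t : al < t -> t < be -> U al + \int[lam]_(s in `]al, t]) k s = U t.
    move=> alt tbe; suff <- : U t - U al = \int[lam]_(s in `]al, t]) k s by rewrite addrC subrK.
    have a2al : a / 2 <= al by rewrite ltW// (lt_trans s1a).
    have tb1 : t <= b + 1 by rewrite ltW// (lt_trans tbe)// (lt_trans be_t0)// (lt_trans t0b).
    rewrite (hU _ _ a2al alt tb1) /Rintegral; congr fine.
    have sub : (`]al, t]%classic : set (measurableTypeR R)) `<=` `[al, be].
      move=> r /=; rewrite !in_itv/= => /andP[alr rt].
      by rewrite (ltW alr) (le_trans rt (ltW tbe)).
    apply: (@ae_eq_integral _ (measurableTypeR R) R lam).
    + exact: mI.
    + by apply: measurable_funTS; apply/measurable_EFinP.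
    + by apply: (measurable_funS (mI _) sub); exact: (measurable_int _ ik).
    move: hk; apply: filterS; first exact: (ae_filter_ringOfSetsType lam).
    by move=> r hr /sub /=; rewrite in_itv/= => /hr ->.
  have iko : lam.-integrable `]al, be] (EFin \o k).
    apply: (@integrableS _ (measurableTypeR R) R lam `[al, be]) => //.
    exact: subset_itv_oc_cc.
  have [] := @continuous_FTC1 R k (BRight al) s be sbe iko als (ck s (ltW als)).
  rewrite derive1E => dI I'; have dIk := isdD (isd_cst (U al) s) (derivableP dI).
  rewrite I' add0r in dIk.
  apply: near_eq_is_derive dIk.
  by near=> t; apply: Uk; near: t; [exact: lt_nbhsr|exact: lt_nbhsl].
- move=> s /andP[als sbe].
  apply: near_eq_is_derive (dW s (lt_trans a_al als)).
  near=> t; have alt : al < t by near: t; exact: lt_nbhsr.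
  have s0 := sg0 t (ltW alt).
  by rewrite /flux /k divfK ?gt_eqF// spowVK ?gt_eqF// divfK ?gt_eqF.
have sub : (`[al, be]%classic : set (measurableTypeR R)) `<=` `[a, b].
  move=> r /=; rewrite !in_itv/= => /andP[alr rbe].
  by rewrite (le_trans (ltW a_al) alr) (le_trans rbe)// ltW// (lt_trans be_t0).
have me (g : R -> R) : measurable_fun [set: measurableTypeR R] g ->
    measurable_fun [set: measurableTypeR R] (EFin \o (fun s => `|g s * sigma s| `^ p)).
  move=> mg; apply/measurable_EFinP; apply: (measurableT_comp (measurable_powR _)).
  apply: measurableT_comp => //.
  by apply: measurable_funM => //; exact: measurable_sphere_area.
apply: le_trans (shell_energy_le n0 p1 u_sol a0 mh Gh).
apply: (@le_trans _ _ (\int[lam]_(s in `[al, be]) (`|h s * sigma s| `^ p)%:E)%E).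
  rewrite le_eqVlt; apply/orP; left; apply/eqP; apply: (@ae_eq_integral _ (measurableTypeR R) R lam).
  - exact: mI.
  - apply/measurable_EFinP; apply: (measurableT_comp (measurable_powR _)).
    apply: measurableT_comp => //; apply: measurable_funM.
      by apply/measurable_EFinP; exact: (measurable_int _ ik).
    by apply: measurable_funTS; exact: measurable_sphere_area.
  - exact: measurable_funTS (me _ mh).
  move: hk; apply: filterS; first exact: (ae_filter_ringOfSetsType lam).
  by move=> r hr; rewrite /= in_itv/= => /hr ->.
apply: (@ge0_subset_integral _ (measurableTypeR R) R lam) => //.
  exact: measurable_funTS (me _ mh).
Unshelve. all: by end_near. Qed.

End shell_regularity.

Section classical_profile.
Context {R : realType} {n : nat} (p mu m : R) (f : R -> R) (u : 'rV[R]_n -> R).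
Hypotheses (n0 : (0 < n)%N) (p1 : 1 < p) (cf : continuous f).
Hypotheses (u_radial : radial u) (u_cont : forall x, x != 0 -> {for x, continuous u}).
Hypothesis u_pos : forall x, x != 0 -> 0 < u x.
Hypothesis u_sol : weak_solution p mu m f u.
Local Notation leb := (lebesgue_rV R n).
Local Notation lam := (@lebesgue_measure R).
Local Notation sigma := (sphere_area n%:R (unit_vol n : R)).
Local Notation U := (profile n0 u).
Local Notation dU := (U^`()%classic).
Local Notation G := (weak_gradient p u).
Local Notation src := (source p mu m f u n0).
Local Notation flx := (@flux R n p).

Let reg (al be : R) : 0 < al -> al < be ->
  exists k : R -> R, [/\ forall s, al < s < be -> dU s = k s,
    forall s, al < s < be -> is_derive s 1 U (k s),
    forall s, al < s < be -> is_derive s 1 (flx k) (- src s),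
    forall s, al <= s -> {for s, continuous k} &
    (\int[lam]_(s in `[al, be]) (`|k s * sigma s| `^ p)%:E <=
     \int[leb]_x (enorm (G x) `^ p)%:E)%E].
Proof.
move=> al0 albe.
have [k [dk fk ck ek]] := shell_regularity n0 p1 cf u_radial u_cont u_pos u_sol al0 albe.
by exists k; split=> // s /dk [_ <-]; rewrite derive1E.
Qed.

Lemma profile_is_derive (s : R) : 0 < s -> is_derive s 1 U (dU s).
Proof.
move=> s0; have [||k [dUk dk _ _ _]] := @reg (s / 2) (s + 1); [lra|lra|].
have sI : s / 2 < s < s + 1 by apply/andP; split; lra.
by rewrite (dUk _ sI); exact: dk.
Qed.

Lemma profile_flux (s : R) : 0 < s -> is_derive s 1 (flx dU) (- src s).
Proof.
move=> s0; have [||k [dUk _ fk _ _]] := @reg (s / 2) (s + 1); [lra|lra|].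
have sI : s / 2 < s < s + 1 by apply/andP; split; lra.
apply: near_eq_is_derive (fk _ sI).
near=> t; rewrite /flux dUk//; apply/andP; split; near: t.
  by apply: lt_nbhsr; case/andP: sI.
by apply: lt_nbhsl; case/andP: sI.
Unshelve. all: by end_near. Qed.

Lemma profile_derive_continuous (s : R) : 0 < s -> {for s, continuous dU}.
Proof.
move=> s0; have [||k [dUk _ _ ck _]] := @reg (s / 2) (s + 1); [lra|lra|].
have sI : s / 2 < s < s + 1 by apply/andP; split; lra.
apply: (@near_eq_continuous _ _ k); last by apply: ck; lra.
near=> t; rewrite dUk//; apply/andP; split; near: t.
  by apply: lt_nbhsr; case/andP: sI.
by apply: lt_nbhsl; case/andP: sI.
Unshelve. all: by end_near. Qed.

Let e s := `|dU s * sigma s| `^ p.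

Let ce s : 0 < s -> {for s, continuous e}.
Proof.
move=> s0; have c1 : {for s, continuous (fun s => dU s * sigma s)}.
  have := cvgM (profile_derive_continuous s0) (sphere_area_continuous n0 s0); exact.
have c2 : {for s, continuous (fun s => `|dU s * sigma s|)}.
  apply: (@continuous_comp _ _ _ (fun s => dU s * sigma s) Num.norm) => //.
  exact: norm_continuous.
have p0 : 0 < p by have P1 := p1; lra.
rewrite (_ : e = fun s => spow p `|dU s * sigma s|); last first.
  by apply/funext => t; rewrite spow_ge0E ?gt_eqF.
apply: (@continuous_comp _ _ _ (fun s => `|dU s * sigma s|) (spow p)) => //.
exact: spow_continuous.
Qed.

Let mI (i : interval R) : measurable ([set` i] : set (measurableTypeR R)).
Proof. exact: measurable_itv. Qed.

Let shell_e (al : R) : 0 < al -> al <= 1 ->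
  (\int[lam]_(s in `[al, 1%R]) (e s)%:E <= \int[leb]_x (enorm (G x) `^ p)%:E)%E.
Proof.
move=> al0 al1; have [||k [dUk _ _ ck ek]] := @reg (al / 2) 2; [lra|lra|].
apply: le_trans ek.
have inI s : al <= s <= 1 -> al / 2 < s < 2 by move=> /andP[? ?]; apply/andP; split; lra.
apply: (@le_trans _ _ (\int[lam]_(s in `[al, 1%R]) (`|k s * sigma s| `^ p)%:E)%E).
  rewrite le_eqVlt; apply/orP; left; apply/eqP; apply: eq_integral => s.
  by rewrite inE/= in_itv/= => /inI sI; rewrite /e dUk.
apply: (@ge0_subset_integral _ (measurableTypeR R) R lam) => //.
- apply/measurable_EFinP; apply: (measurableT_comp (measurable_powR _)).
  apply: measurableT_comp => //; apply: measurable_funM; last first.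
    by apply: measurable_funTS; exact: measurable_sphere_area.
  apply: subspace_continuous_measurable_fun; first exact: mI.
  apply: continuous_in_subspaceT => t; rewrite inE/= in_itv/= => /andP[at_ _].
  exact: ck.
- by move=> s /=; rewrite !in_itv/= => /inI/andP[h1 h2]; rewrite !ltW.
Qed.

(** The energy in the shells [al <= rho <= 1] is at most the integral of
  [|grad u|^p], uniformly in [al]. *)
Lemma profile_energy : lam.-integrable `]0, 1] (EFin \o e).
Proof.
have me : measurable_fun (`]0, 1]%classic : set (measurableTypeR R)) e.
  apply: subspace_continuous_measurable_fun; first exact: mI.
  apply: continuous_in_subspaceT => t; rewrite inE/= in_itv/= => /andP[t0 _].
  exact: ce.
apply/integrableP; split; first by apply/measurable_EFinP.
under eq_integral do rewrite gee0_abs ?lee_fin ?powR_ge0//.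
have fin : (\int[leb]_x (enorm (G x) `^ p)%:E < +oo)%E.
  have GL i : (fun x => G x ord0 i) \in Lfun leb p%:E.
    by have [[usob _] _] := u_sol; exact: (weak_gradientP usob).1.
  have /integrableP[_] := gradient_energy n0 p1 GL.
  by under eq_integral do rewrite gee0_abs ?lee_fin ?powR_ge0//.
apply: le_lt_trans fin.
rewrite (itv_open_bnd_bigcup false (1 : R) 0).
pose F (j : nat) : set (measurableTypeR R) := `[0 + j.+1%:R^-1, 1]%classic.
have Fpos j : F j `<=` `]0, 1].
  move=> s; rewrite /F /= !in_itv/= add0r => /andP[js ->]; rewrite andbT.
  by apply: lt_le_trans js; rewrite invr_gt0.
have L : ((\int[lam]_(s in F j) (EFin \o e) s)%E @[j --> \oo] -->
    (\int[lam]_(s in \bigcup_j F j) (EFin \o e) s)%E).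
  apply: (@ge0_nondecreasing_set_cvg_integral _ (measurableTypeR R) R F (EFin \o e) lam).
  - move=> i j ij; apply/subsetPset => s; rewrite /F /= !in_itv/= !add0r => /andP[h ->].
    by rewrite andbT (le_trans _ h)// lef_pV2 ?posrE// ler_nat.
  - by move=> j; exact: mI.
  - by move=> j; apply/measurable_EFinP; exact: measurable_funS (mI _) (Fpos j) me.
  - by move=> j s _; rewrite lee_fin powR_ge0.
rewrite -(cvg_lim _ L)//; apply: lime_le.
  by apply/cvg_ex; eexists; exact: L.
apply: nearW => j; rewrite /F add0r; apply: shell_e; first by rewrite invr_gt0.
by rewrite invf_le1// ler1n.
Qed.

Definition energy (s : R) : R := \int[lam]_(r in `]0, s]) e r.

Lemma energy_ge0 s : 0 <= energy s.
Proof. by apply: Rintegral_ge0 => t _; exact: powR_ge0. Qed.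

Lemma energy_is_derive (s : R) : 0 < s -> s < 1 ->
  is_derive s 1 energy (`|dU s * sigma s| `^ p).
Proof.
move=> s0 s1.
have [] := @continuous_FTC1 R e (BRight 0) s 1 s1 profile_energy s0 (ce s0).
by rewrite derive1E => dI I'; have := derivableP dI; rewrite I'.
Qed.

End classical_profile.

(** * Growth of the nonlinearity *)

Section growth.
Context {R : realType}.

Lemma limf_esup_le (F : set_system R) (g : R -> R) (A : R) :
  (limf_esup (fun t => (g t)%:E) F <= A%:E)%E ->
  exists2 V, F V & forall t, V t -> g t <= A + 1.
Proof.
move=> H; have /ereal_inf_lt[_ [V FV <-] HV] : (limf_esup (fun t => (g t)%:E) F < (A + 1)%:E)%E.
  by apply: (le_lt_trans H); rewrite lte_fin ltrDl.
exists V => // t Vt; rewrite -lee_fin; apply/ltW; apply: le_lt_trans HV.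
by apply: ereal_sup_ubound; exists t.
Qed.

(** The hypotheses at zero and at infinity control [f] outside a compact
  interval of positive numbers, where it is bounded; near zero the exponent
  can be lowered from [q] to [p]. *)
Lemma power_growth (f : R -> R) (p q r A : R) : continuous f -> 0 < p - 1 -> p < q -> 0 < A ->
  (limf_esup (fun t => ((`|f t| / `|t| `^ (q - 1))%R)%:E) (0%R : R)^' <= A%:E)%E ->
  (limf_esup (fun t => ((`|f t| / `|t| `^ (r - 1))%R)%:E) (@norm_oo_nbhs R) <= A%:E)%E ->
  exists2 C, 0 <= C & forall x, 0 < x -> `|f x| <= C * (x `^ (p - 1) + x `^ (r - 1)).
Proof.
move=> cf p1 pq A0 /limf_esup_le[V V0 HV] /limf_esup_le[W [M _ MW] HW].
have [d d0 dV] : exists2 d, 0 < d & forall t, 0 < t -> t < d -> V t.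
  have /nbhs_ballP[d /= d0 dV] := V0.
  exists d => // t t0 td; apply: dV; last by rewrite gt_eqF.
  by rewrite /ball/= sub0r normrN gtr0_norm.
pose d1 := Num.min d 1; pose b := `|M| + 1.
have d10 : 0 < d1 by rewrite lt_min d0 ltr01.
have [K [_ HK]] : bounded_set (f @` `[d1, b]).
  apply: compact_bounded; apply: continuous_compact; last exact: segment_compact.
  exact: continuous_subspaceT.
pose B := (`|K| + 1) / d1 `^ (p - 1).
have B0 : 0 <= B by rewrite divr_ge0 ?powR_ge0// addr_ge0.
have A1 : 0 <= A + 1 by lra.
exists (A + 1 + B); first by rewrite addr_ge0.
move=> x x0; have xp := powR_ge0 x (p - 1); have xr := powR_ge0 x (r - 1).
have [xd|dx] := ltP x d1.
  have [xd' x1] : x < d /\ x < 1 by move: xd; rewrite lt_min => /andP[].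
  have := HV x (dV x x0 xd'); rewrite (gtr0_norm x0) ler_pdivrMr ?powR_gt0// => H.
  apply: (le_trans H); apply: ler_pM; rewrite ?powR_ge0 ?lerDl//.
  apply: (@le_trans _ _ (x `^ (p - 1))); last by rewrite lerDl.
  by apply: ger_powR; [rewrite x0 ltW|lra].
have [xb|bx] := leP x b.
  have fx : `|f x| <= `|K| + 1.
    apply: HK; first by rewrite (le_lt_trans (ler_norm _))// ltrDl.
    by exists x => //=; rewrite in_itv/= dx xb.
  apply: (@le_trans _ _ (B * x `^ (p - 1))).
    rewrite /B mulrAC ler_pdivlMr ?powR_gt0//; apply: ler_pM => //; first exact: powR_ge0.
    by apply: powR_le2r => //; exact: ltW.
  by apply: ler_pM => //; rewrite ?lerDr ?lerDl.
have Mx : M < `|x|.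
  by rewrite (gtr0_norm x0); apply: le_lt_trans (ler_norm M) _; apply: lt_trans bx; rewrite ltrDl.
have := HW x (MW x Mx); rewrite (gtr0_norm x0) ler_pdivrMr ?powR_gt0// => H.
by apply: (le_trans H); apply: ler_pM; rewrite ?powR_ge0 ?lerDl ?lerDr.
Qed.

End growth.

(** * The behaviour at the origin *)

Theorem theorem1p1 (R : realType) (N : nat) (p m mu q A : R) (f : R -> R)
    (u : 'rV[R]_N -> R) (gamma1 : R)
  (p1 : 1 < p) (pN : p < N%:R) (m0 : 0 < m)
  (mu0 : 0 <= mu) (mu_lt : mu < mu_bar N p)
  (cf : continuous f) (pq : p < q) (A0 : 0 < A)
  (f0 : (limf_esup (fun t : R => (`|f t| / `|t| `^ (q - 1))%:E) (0%R : R)^'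
         <= A%:E)%E)
  (foo : (limf_esup (fun t : R => (`|f t| / `|t| `^ (p_star N p - 1))%:E)
            (@norm_oo_nbhs R)
          <= A%:E)%E)
  (u_radial : radial u)
  (u_cont : forall x, x != 0 -> {for x, continuous u})
  (u_pos : forall x, x != 0 -> 0 < u x)
  (u_sol : weak_solution p mu m f u)
  (g1 : is_gamma1 N p mu gamma1) :
  exists C : R, 0 < C /\
    (u x * enorm x `^ gamma1) @[x --> (0 : 'rV[R]_N)^'] --> C.
Proof.
have p0 : 0 < p by exact: lt_trans p1.
have N0 : (0 < N)%N by rewrite -(ltr_nat R) (lt_trans p0).
have c0 : 0 < (unit_vol N : R) by exact: unit_vol_gt0.
have [Cf Cf0 fC] := power_growth cf (ltac:(lra) : 0 < p - 1) pq A0 f0 foo.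
pose U := profile N0 u; pose dU := U^`()%classic.
have [g1k G0 _] := g1.
have ric : riccati_rhs p ((N%:R - p) / p) mu gamma1 = 0.
  rewrite -G0 /Gamma /riccati_rhs.
  case/andP: g1k => g10 _; rewrite spow_ge0E//; last by apply/eqP; lra.
  rewrite (ger0_norm g10) -[gamma1 `^ p](mulr_powRB1 g10 p0).
  by field; rewrite gt_eqF.
have U0 (s : R) : 0 < s -> s < 1 -> 0 < U s by move=> s0 _; apply: profile_gt0.
have DU (s : R) : 0 < s -> s < 1 -> is_derive s 1 U (dU s).
  by move=> s0 _; exact: (profile_is_derive N0 p1 cf u_radial u_cont u_pos u_sol).
have [C [C0 HC]] := radial_limit p1 pN c0 ltr01 U0 DU mu0 mu_lt g1k ric Cf0 m0 fC
  (fun s s0 s1 => energy_is_derive N0 p1 cf u_radial u_cont u_pos u_sol s0 s1)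
  (fun s _ _ => energy_ge0 p u N0 s) (fun s _ _ => erefl)
  (fun s s0 _ => profile_flux N0 p1 cf u_radial u_cont u_pos u_sol s0).
exists C; split=> //; apply/cvgrPdist_le => e e0.
have [t0 Ht0] := HC e e0.
have sq0 : sqn x @[x --> (0 : 'rV[R]_N)] --> (0 : R).
  have E : sqn (0 : 'rV[R]_N) = 0 by rewrite /sqn big1// => i _; rewrite mxE expr0n.
  by rewrite -[X in _ --> X]E; exact: (Ck_continuous (@Ck_sqn R N 0)).
have near0 : \forall x \near (0 : 'rV[R]_N)^', sqn x < expR t0 ^+ 2.
  have H : nbhs (0 : R) [set y | y < expR t0 ^+ 2].
    by apply: lt_nbhsl; rewrite exprn_gt0// expR_gt0.
  exact: nbhs_dnbhs (sq0 _ H).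
near=> x.
have x0 : x != 0 by near: x; exact: nbhs_dnbhs_neq.
have r0 := rho_gt0 N0 x0; have s0 := sqn_gt0_rho N0 r0.
have ex0 : 0 < enorm x by rewrite sqrtr_gt0.
have ext : ln (enorm x) <= t0.
  rewrite -[t0]expRK ler_ln ?posrE ?expR_gt0//.
  rewrite -(ler_pXn2r (n := 2)) ?nnegrE ?expR_ge0 ?(ltW ex0)// enorm_sqr.
  by apply/ltW; near: x.
have := Ht0 _ ext; rewrite distrC.
rewrite -/U (profile_rho N0 u_radial x) rho_enorm /powR (gt_eqF ex0).
exact.
Unshelve. all: by end_near. Qed.
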